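(* Let $k\geq3$ and $C_0\geq1$. There are constants $K=K(k,C_0)$, $C=C(k)$ and $c=c(k,C_0)>0$ such that the following holds. Let $N\geq1$ and let $0<\delta<c$. Let $H$ be a positive integer, set $B=N/H$, and assume $$\delta^{-C}\leq B\leq N\delta^C.$$ Set $L=\delta^{-C}$ and let $0<\eta\leq\delta^C$. Let $\nu\colon[N]\to\mathbb R_{\geq0}$ satisfy the $(K,L,\eta)$ linear forms condition at scale $(N,B,H)$ and suppose $$R_\nu^C/B\leq\delta^C.$$ Let $\lambda\colon\mathbb Z^k\to\mathbb C$ be $1$-bounded and supported on $([-C_0B,C_0B]\cap\mathbb Z)^k$, and let $f_1,\ldots,f_k\colon\mathbb Z\to\mathbb C$ be supported on $[N]$ with $|f_i|\leq\nu$ for every $i$. If $$|R_H(\lambda;f_1,\ldots,f_k)|\geq\delta B^k\frac{N^2}{B},$$ then $$\min_{1\leq i\leq k}\|f_i\|_{U^{1+}[N]}\geq c\,\delta^C.$$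
   Context: For a real number $X\geq1$, $[X]=\{1,\ldots,\lfloor X\rfloor\}$; $\mathbb E_{n\in S}$ denotes the average over a finite nonempty set $S$; a function is $1$-bounded if its values have modulus at most $1$. A function $\nu$ on $[N]$ is extended by zero to $\mathbb Z$, and $R_\nu=\max(1,\|\nu\|_{\ell^\infty([N])})$. Counting operator: $\displaystyle R_H(\lambda;f_1,\ldots,f_k)=\sum_{\mathbf b\in\mathbb Z^k}\lambda(\mathbf b)\sum_{x\in\mathbb Z}\sum_{m\in[H]}\prod_{i=1}^kf_i(x+b_im).$ Norm: $\displaystyle\|f\|_{U^{1+}[N]}=\frac1{|[N]|}\max_{P}\Bigl|\sum_{n\in P}f(n)\Bigr|$, over all arithmetic progressions $P\subseteq[N]$. Linear forms condition: let $N,B\geq1$, $H$ a positive integer, $K,L\geq2$, $0<\eta<1$. The function $\nu\colon[N]\to\mathbb R_{\geq0}$ satisfies the $(K,L,\eta)$ linear forms condition at scale $(N,B,H)$ if the following holds. Let $0\leq s\leq K$ and $1\leq J\leq K$ be integers, and let $I\subseteq[N]$ and $I_1,\ldots,I_s\subseteq[H]$ be intervals with $|I|\geq N/L$ and $|I_t|\geq H/L$ for $1\leq t\leq s$. For $1\leq j\leq J$ let $\Psi_j(x,\mathbf h)=x+a_j+\sum_{t=1}^sc_{j,t}h_t$ with integers $a_j,c_{j,t}$ satisfying $|a_j|\leq KN$, $|c_{j,t}|\leq KB$, and suppose the vectors $(c_{j,1},\ldots,c_{j,s})$, $1\leq j\leq J$, are pairwise distinct. Then for every $W_1,\ldots,W_J\in\{\nu,1_{[N]}\}$,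 $$\Bigl|\mathbb E_{x\in I}\mathbb E_{h_1\in I_1,\ldots,h_s\in I_s}\prod_{j=1}^JW_j(\Psi_j(x,\mathbf h))-\mathbb E_{x\in I}\mathbb E_{h_1\in I_1,\ldots,h_s\in I_s}\prod_{j=1}^J1_{[N]}(\Psi_j(x,\mathbf h))\Bigr|\leq\eta.$$ When $s=0$ the averages over the $h_t$ are omitted (and pairwise distinctness forces $J=1$). *)

(* Defs.v *)
From mathcomp Require Import all_boot all_order all_algebra finmap.
From mathcomp Require Import all_classical all_reals all_analysis.
From mathcomp Require Export complex.

Set Implicit Arguments.
Unset Strict Implicit.
Unset Printing Implicit Defensive.

Import Order.TTheory GRing.Theory Num.Theory.

Local Open Scope classical_set_scope.
Local Open Scope ring_scope.

Notation modulus := ComplexField.Normc.normc.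

Definition bracket (R : realType) (X : R) : set int :=
  [set n : int | 1 <= n <= Num.floor X].

(* Junk value 0 on infinite sets. *)
Definition ncard (T : choiceType) (S : set T) : nat := #|` fset_set S|.

Definition avg (R : realType) (T : choiceType) (S : set T) (F : T -> R) : R :=
  (ncard S)%:R^-1 * \sum_(n \in S) F n.

(* The functions nu on [N] are taken on all integers, vanishing off [N]. *)
Definition Rsup (R : realType) (N : R) (nu : int -> R) : R :=
  Num.max 1 (sup [set `|nu n| | n in bracket N]).

(* The sums over b and x are finitely supported sums: this is the intended
   value when lambda is finitely supported, 0 < k and every f i is finitely
   supported. *)
Definition counting_op (R : realType) (k H : nat)
    (lambda : {ffun 'I_k -> int} -> R[i]) (f : 'I_k -> int -> R[i]) : R[i] :=
  \sum_(b \in [set: {ffun 'I_k -> int}])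
    (lambda b * \sum_(x \in [set: int]) \sum_(m \in bracket (H%:R : R))
                  \prod_(i < k) f i (x + b i * m)).

Definition arith_prog (P : set int) : Prop :=
  exists (a d : int) (l : nat),
    0 < d /\ P = [set a + i%:Z * d | i in [set i : nat | (i < l)%N]].

(* There are only finitely many P, so the supremum is a maximum. *)
Definition U1plus (R : realType) (N : R) (f : int -> R[i]) : R :=
  (ncard (bracket N))%:R^-1 *
  sup [set modulus (\sum_(n \in P) f n) |
         P in [set P : set int | arith_prog P /\ P `<=` bracket N]].

(* For s = 0 this has exactly one element, so averaging over it is harmless. *)
Definition box (s : nat) (It : 'I_s -> interval int) :
    set {ffun 'I_s -> int} :=
  [set h | forall t, h t \in It t].

Definition linear_form (s : nat) (a : int) (c : {ffun 'I_s -> int})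
    (x : int) (h : {ffun 'I_s -> int}) : int :=
  x + a + \sum_(t < s) c t * h t.

Definition linear_forms_condition (R : realType) (K L eta N B : R) (H : nat)
    (nu : int -> R) : Prop :=
  forall (s J : nat) (I : interval int) (It : 'I_s -> interval int)
         (a : 'I_J -> int) (c : 'I_J -> {ffun 'I_s -> int})
         (W : 'I_J -> int -> R),
    s%:R <= K -> (1 <= J)%N -> J%:R <= K ->
    [set` I] `<=` bracket N -> N / L <= (ncard [set` I])%:R ->
    (forall t, [set` It t] `<=` bracket (H%:R : R)) ->
    (forall t, H%:R / L <= (ncard [set` It t])%:R) ->
    (forall j, `|a j|%:~R <= K * N) ->
    (forall j t, `|c j t|%:~R <= K * B) ->
    injective c ->
    (forall j, W j = nu \/ W j = \1_(bracket N)) ->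
    `| avg [set` I] (fun x => avg (box It) (fun h =>
         \prod_(j < J) W j (linear_form (a j) (c j) x h)))
     - avg [set` I] (fun x => avg (box It) (fun h =>
         \prod_(j < J) \1_(bracket N) (linear_form (a j) (c j) x h)))| <= eta.

(* Main.v *)
(* The integers are embedded in a large cyclic group, where translations are
   exact.  Fix i and let p be the real or imaginary part of f_i.  Averaging over
   the i-th coordinate of b, Cauchy-Schwarz removes lambda and the other f_j (the
   linear forms condition replaces nu by 1_[N]), so the self-correlations
   V(d) = sum_(x,m) p(x) p(x + d m) are large in mean square over differences
   d = b - b'.  The linear forms condition and three more Cauchy-Schwarz steps
   turn this into a large correlation of p with its translates by
   s_1 - s_2 - s_3 + s_4, each s_j being a product (b - b')(m - m') of two
   differences in independent variables.  With e_2 and e_3 the first factors of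
   s_2 and s_3, moving the variables of the second factors by (v_2, v_3) changes
   the translate by e_2 v_2 + e_3 v_3, which by Bezout runs through the multiples
   of gcd(e_2, e_3); as this gcd is small for most pairs, p has a large sum along
   some progression of step g. *)
Require Import Defs.
From mathcomp Require Import all_boot all_order all_algebra finmap.
From mathcomp Require Import all_classical all_reals all_analysis.
From mathcomp Require Import zify ring lra.

Set Implicit Arguments.
Unset Strict Implicit.
Unset Printing Implicit Defensive.

Import Order.TTheory GRing.Theory Num.Theory.

Local Open Scope ring_scope.

(** The norm divides by $N=BH$ whatever the length of the progression. A step of size $B$ leaves
    only about $H$ points in $[N]$, too few to reach $\delta^{O(1)}N$, so a single product
    $(b-b')(m-m')$ does not suffice: two are combined because the gcd of their steps is
    $\delta^{-O(1)}$ for most pairs. Two squarings turn one product into four. Two of these give the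
    gcd; the other two are summed beforehand ([slice]), which keeps the averaged kernel bounded
    independently of $R_\nu$.

    Only $|p|\le\nu$ is known, so each Cauchy-Schwarz step leaves a weight [nu], split as [o] plus
    [excess]. The linear forms condition controls the excess as long as the coefficient vectors are
    distinct. When some coincide, only bounds by powers of $R_\nu$ remain, but these configurations
    have density $O(1/A)$, where $A$ is the number of values of a coordinate of $b$; this is how the
    hypothesis on $R_\nu^C/B$ enters.

    Losses are recorded as powers of one [d] with $d\le1/200$: one more factor [d] absorbs the
    numerical constants, whence exponents such as 176 and 272. *)

Section CauchySchwarz.

Variables (R : realFieldType) (I : finType).

Lemma sqr_sum (F : I -> R) : (\sum_i F i) ^+ 2 = \sum_i \sum_j F i * F j.
Proof. by rewrite expr2 big_distrlr. Qed.

(** Lagrange's identity: the double sum of $w_iw_j(|g_i|-|g_j|)^2$ is nonnegative. The later uses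
    take for [w] the constant 1 or a product of values of [nu] that dominates the unknown factor [f]
    to be removed. *)
Lemma weighted_cauchy_schwarz (w f g : I -> R) :
  (forall i, `|f i| <= w i) ->
  (\sum_i f i * g i) ^+ 2 <= (\sum_i w i) * \sum_i w i * g i ^+ 2.
Proof.
move=> fw.
have w0 i : 0 <= w i by apply: le_trans (fw i).
have le1 : (\sum_i f i * g i) ^+ 2 <= (\sum_i w i * `|g i|) ^+ 2.
  rewrite -[X in X <= _]real_normK ?num_real // lerXn2r ?nnegrE ?sumr_ge0 //.
    by move=> i _; rewrite mulr_ge0.
  apply: le_trans (ler_norm_sum _ _ _) _.
  by apply: ler_sum => i _; rewrite normrM ler_wpM2r.
apply: le_trans le1 _.
have gE i : g i ^+ 2 = `|g i| ^+ 2 by rewrite real_normK ?num_real.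
under [X in _ <= _ * X]eq_bigr do rewrite gE.
set u := fun i => `|g i|.
have : 0 <= \sum_i \sum_j w i * w j * (u i - u j) ^+ 2.
  by apply: sumr_ge0 => i _; apply: sumr_ge0 => j _; exact: mulr_ge0 (mulr_ge0 _ _) (sqr_ge0 _).
have -> : \sum_i \sum_j w i * w j * (u i - u j) ^+ 2 =
   2 * ((\sum_i w i) * \sum_i w i * u i ^+ 2) - 2 * (\sum_i w i * u i) ^+ 2.
  transitivity (\sum_i \sum_j (w i * u i ^+ 2 * w j)
      + \sum_i \sum_j (w i * (w j * u j ^+ 2))
      - 2 * \sum_i \sum_j (w i * u i) * (w j * u j)).
    rewrite mulr_sumr -sumrN -!big_split /=; apply: eq_bigr => i _.
    by rewrite mulr_sumr -sumrN -!big_split /=; apply: eq_bigr => j _; ring.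
  rewrite -!big_distrlr /=; ring.
rewrite /u; lra.
Qed.

Lemma cauchy_schwarz_card (g : I -> R) :
  (\sum_i g i) ^+ 2 <= #|I|%:R * \sum_i g i ^+ 2.
Proof.
have := @weighted_cauchy_schwarz (fun=> 1) (fun=> 1) g.
rewrite sumr_const; under eq_bigr do rewrite mul1r.
under [X in _ * X]eq_bigr do rewrite mul1r.
by apply=> i; rewrite normr1.
Qed.

End CauchySchwarz.

Lemma sum_pair (R : nmodType) (I J : finType) (F : I * J -> R) :
  \sum_z F z = \sum_i \sum_j F (i, j).
Proof. by rewrite pair_bigA /=; apply: eq_bigr => -[]. Qed.

Section Translation.

Variables (R : nmodType) (V : finZmodType).

Lemma sum_shift (a : V) (F : V -> R) : \sum_x F (x + a) = \sum_x F x.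
Proof. by rewrite [RHS](reindex_inj (addIr a)). Qed.

End Translation.

(** * Linear forms in four parameters, and pseudorandomness in a finite group *)

Definition form := (int * (int * int * int * int))%type.

Section LinearForms.

Variables (R : realFieldType) (V : finZmodType) (e : V) (H : nat).
Variables (nu o : V -> R).

(** Four parameters, because [replace_nu] applies Cauchy-Schwarz twice to a sum in two parameters.
    Forms in fewer parameters get zero coefficients, and each idle parameter contributes a factor
    [H]. *)
Definition quad := ('I_H * 'I_H * 'I_H * 'I_H)%type.

Definition form_value (f : form) (h : quad) : int :=
  f.1 + f.2.1.1.1 * (h.1.1.1 : nat)%:Z + f.2.1.1.2 * (h.1.1.2 : nat)%:Z
      + f.2.1.2 * (h.1.2 : nat)%:Z + f.2.2 * (h.2 : nat)%:Z.

Lemma sum_quad (F : quad -> R) :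
  \sum_h F h = \sum_(h1 < H) \sum_(h2 < H) \sum_(h3 < H) \sum_(h4 < H)
                 F (h1, h2, h3, h4).
Proof.
rewrite pair_bigA /= pair_bigA /= pair_bigA /=.
by apply: eq_bigr => -[[[h1 h2] h3] h4] _.
Qed.

(** The boolean attached to a form selects its weight, so one list can be evaluated with mixed
    weights or, through a constant [W], with [o] throughout. *)
Definition lf_prod (W : bool -> V -> R) (l : seq (bool * form)) (h : quad)
    (x : V) : R := \prod_(f <- l) W f.1 (x + e *~ form_value f.2 h).

Definition lf_sum (W : bool -> V -> R) (l : seq (bool * form)) : R :=
  \sum_h \sum_x lf_prod W l h x.

Definition small_form (am cm : nat) (f : form) : bool :=
  [&& (absz f.1 <= am)%N, (absz f.2.1.1.1 <= cm)%N, (absz f.2.1.1.2 <= cm)%N,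
      (absz f.2.1.2 <= cm)%N & (absz f.2.2 <= cm)%N].

Definition weight (b : bool) : V -> R := if b then nu else o.

Definition mass : R := \sum_x o x.

Definition excess (x : V) : R := nu x - o x.

(** Constant terms are stripped before [uniq]: distinctness concerns the coefficient vectors alone,
    as in the linear forms condition. *)
Definition linear_forms_bound (K am cm : nat) (eta : R) : Prop :=
  forall l : seq (bool * form), (0 < size l <= K)%N ->
    all (small_form am cm) (map snd l) -> uniq (map snd (map snd l)) ->
    `|lf_sum weight l - lf_sum (fun=> o) l| <= eta * mass * H%:R ^+ 4.

Record pseudorandom (K am cm : nat) (eta : R) : Prop := Pseudorandom {
  pr_nu_ge0 : forall x, 0 <= nu x;
  pr_o_ge0 : forall x, 0 <= o x;
  pr_o_le1 : forall x, o x <= 1;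
  pr_H_gt0 : (0 < H)%N;
  pr_eta_ge0 : 0 <= eta;
  pr_eta_le1 : eta <= 1;
  pr_K_ge8 : (8 <= K)%N;
  pr_linear_forms : linear_forms_bound K am cm eta }.

End LinearForms.

(** * Consequences of pseudorandomness: replacing [nu] by [o] *)

Section Pseudorandom.

Variables (R : realFieldType) (V : finZmodType) (e : V) (H : nat).
Variables (nu o : V -> R) (K am cm : nat) (eta : R).
Hypothesis pr : pseudorandom e H nu o K am cm eta.

Let nu_ge0 := pr_nu_ge0 pr.
Let o_ge0 := pr_o_ge0 pr.
Let o_le1 := pr_o_le1 pr.
Let H_gt0 := pr_H_gt0 pr.
Let eta_ge0 := pr_eta_ge0 pr.
Let eta_le1 := pr_eta_le1 pr.
Let K_ge8 := pr_K_ge8 pr.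
Let nu_lf := pr_linear_forms pr.

Local Notation n := (mass o).
Local Notation D := (excess nu o).
Local Notation hr := (H%:R : R).
Local Notation "x ++> z" := (x + e *~ z) (at level 50).

Lemma mass_ge0 : 0 <= n. Proof. exact: sumr_ge0. Qed.

Lemma height_gt0 : 0 < hr. Proof. by rewrite ltr0n. Qed.

Lemma lf_sum_o_le (l : seq (bool * form)) :
  (0 < size l)%N -> lf_sum e H (fun=> o) l <= n * hr ^+ 4.
Proof.
case: l => // f l _; rewrite /lf_sum.
have hx h : \sum_x lf_prod e (fun=> o) (f :: l) h x <= n.
  rewrite /mass -[leRHS](sum_shift (e *~ form_value f.2 h)); apply: ler_sum => x _.
  rewrite /lf_prod big_cons -[leRHS]mulr1 ler_wpM2l //.
  by apply: prodr_ile1 => g _; rewrite o_ge0 o_le1.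
apply: le_trans; first by apply: ler_sum => h _; exact: hx.
by rewrite sumr_const !card_prod card_ord -[_ *+ _]mulr_natr !natrM !exprS
  expr0 mulr1 !mulrA.
Qed.


(** Expanding each [D] as [nu - o] gives $2^{|l'|}$ signed products, all within [eta] (relatively)
    of the same main term. The main terms cancel as soon as one [D] is present. The induction moves
    one form of [l'] into [l], once with each weight. *)
Lemma lf_sum_D_bound (l : seq (bool * form)) (l' : seq form) :
  (0 < size l + size l' <= K)%N ->
  all (small_form am cm) (map snd l ++ l') ->
  uniq (map snd (map snd l ++ l')) ->
  `|\sum_h \sum_x (lf_prod e (weight nu o) l h x *
        \prod_(g <- l') D (x ++> @form_value H g h))
    - (l' == [::])%:R * lf_sum e H (fun=> o) l| <= 2 ^+ size l' * (eta * n * hr ^+ 4).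
Proof.
elim: l' l => [|g l' IH] l /=.
  rewrite addn0 cats0 => sl al ul; rewrite mul1r expr0 mul1r.
  have := nu_lf sl al ul; rewrite /lf_sum.
  by under [X in _ -> `|X - _| <= _]eq_bigr do
     under eq_bigr do rewrite big_nil mulr1.
move=> sl al ul; rewrite mul0r subr0.
have IH' b : `|\sum_h \sum_x (lf_prod e (weight nu o) ((b, g) :: l) h x *
        \prod_(g <- l') D (x ++> @form_value H g h))
    - (l' == [::])%:R * lf_sum e H (fun=> o) ((true, g) :: l)|
       <= 2 ^+ size l' * (eta * n * hr ^+ 4).
  have -> : lf_sum e H (fun=> o) ((true, g) :: l) =
            lf_sum e H (fun=> o) ((b, g) :: l).
    by apply: eq_bigr => h _; apply: eq_bigr => x _; rewrite /lf_prod !big_cons.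
  have pe : perm_eq (map snd ((b, g) :: l) ++ l') (map snd l ++ g :: l').
    by rewrite /= -cat1s -[in X in perm_eq _ X]cat1s !catA perm_cat2r perm_catC.
  apply: IH; first by move: sl => /=; lia.
    by rewrite (perm_all _ pe).
  by rewrite (perm_uniq (perm_map snd pe)).
set S := \sum_h _.
have -> : S = \sum_h \sum_x (lf_prod e (weight nu o) ((true, g) :: l) h x *
        \prod_(g <- l') D (x ++> @form_value H g h))
   - \sum_h \sum_x (lf_prod e (weight nu o) ((false, g) :: l) h x *
        \prod_(g <- l') D (x ++> @form_value H g h)).
  rewrite -sumrB; apply: eq_bigr => h _; rewrite -sumrB; apply: eq_bigr => x _.
  by rewrite /lf_prod !big_cons /excess /weight /=; ring.
rewrite exprS -mulrA.
have := IH' true; have := IH' false.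
set Y := _%:R * _; set S1 := \sum_h _; set S2 := \sum_h _ => S2Y S1Y.
rewrite (_ : S2 - S1 = (S2 - Y) - (S1 - Y)); last by ring.
apply: le_trans (ler_normB _ _) _; lra.
Qed.

Lemma lf_sum_le (l : seq (bool * form)) :
  (0 < size l <= K)%N -> all (small_form am cm) (map snd l) ->
  uniq (map snd (map snd l)) ->
  lf_sum e H (weight nu o) l <= 2 * n * hr ^+ 4.
Proof.
move=> sl al ul; have := nu_lf sl al ul.
have := lf_sum_o_le (proj1 (andP sl)).
rewrite ler_norml .
have : 0 <= n * hr ^+ 4 by rewrite mulr_ge0 ?mass_ge0 // exprn_ge0 // ltW ?height_gt0.
set X := n * _ => X0; rewrite -(mulrA eta) -(mulrA 2) -/X => oX.
have : eta * X <= X by rewrite ler_piMl.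
lra.
Qed.

Lemma sum_const_quad (F : 'I_H -> 'I_H -> R) :
  \sum_(h : quad H) F h.1.1.1 h.1.1.2 = hr ^+ 2 * \sum_i \sum_j F i j.
Proof.
rewrite sum_quad mulr_sumr; apply: eq_bigr => i _.
rewrite mulr_sumr; apply: eq_bigr => j _ /=.
by rewrite !sumr_const !card_ord -mulrnA -[LHS]mulr_natl natrM.
Qed.

Lemma sum_nu_nu (a1 c1 d1 a2 c2 d2 : int) :
  (absz a1 <= am)%N -> (absz c1 <= cm)%N -> (absz d1 <= cm)%N ->
  (absz a2 <= am)%N -> (absz c2 <= cm)%N -> (absz d2 <= cm)%N ->
  (c1, d1) != (c2, d2) ->
  \sum_(i < H) \sum_(j < H) \sum_x
     nu (x ++> (a1 + c1 * (i : nat)%:Z + d1 * (j : nat)%:Z)) *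
     nu (x ++> (a2 + c2 * (i : nat)%:Z + d2 * (j : nat)%:Z)) <= 2 * n * hr ^+ 2.
Proof.
move=> a1m c1m d1m a2m c2m d2m cd.
have := @lf_sum_le [:: (true, (a1, (c1, d1, 0, 0))); (true, (a2, (c2, d2, 0, 0)))].
rewrite /= /small_form /= a1m c1m d1m a2m c2m d2m (leq_trans _ K_ge8) //.
rewrite !inE !xpair_eqE /= in cd *; rewrite eqxx !andbT cd /= => /(_ isT isT isT).
set L := lf_sum _ _ _ _; have -> : L = hr ^+ 2 * \sum_(i < H) \sum_(j < H) \sum_x
     nu (x ++> (a1 + c1 * (i : nat)%:Z + d1 * (j : nat)%:Z)) *
     nu (x ++> (a2 + c2 * (i : nat)%:Z + d2 * (j : nat)%:Z)).
  rewrite -(sum_const_quad (fun i j => \sum_x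
     nu (x ++> (a1 + c1 * (i : nat)%:Z + d1 * (j : nat)%:Z)) *
     nu (x ++> (a2 + c2 * (i : nat)%:Z + d2 * (j : nat)%:Z)))).
  apply: eq_bigr => h _; apply: eq_bigr => x _.
  by rewrite /lf_prod !big_cons big_nil mulr1 /form_value /= !mul0r !addr0.
have -> : 2 * n * hr ^+ 4 = hr ^+ 2 * (2 * n * hr ^+ 2) by ring.
by rewrite ler_pM2l // exprn_gt0 ?height_gt0.
Qed.

Lemma sum_nu : \sum_x nu x <= 2 * n.
Proof.
have := @lf_sum_le [:: (true, (0, (0, 0, 0, 0)))].
rewrite /= (leq_trans _ K_ge8) // => /(_ isT isT isT).
set L := lf_sum _ _ _ _; have -> : L = hr ^+ 2 * (hr * (hr * \sum_x nu x)).
  have -> : hr * (hr * \sum_x nu x) = \sum_(i < H) \sum_(j < H) \sum_x nu x.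
    by rewrite !sumr_const !card_ord -mulrnA -[RHS]mulr_natl natrM mulrA.
  rewrite -(sum_const_quad (fun i j => \sum_x nu x)).
  apply: eq_bigr => h _; apply: eq_bigr => x _.
  by rewrite /lf_prod !big_cons big_nil mulr1 /form_value /= !mul0r !addr0.
have -> : 2 * n * hr ^+ 4 = hr ^+ 2 * (hr * (hr * (2 * n))) by ring.
by rewrite !ler_pM2l // ?exprn_gt0 ?height_gt0.
Qed.


(** These eight forms are what remains when [replace_nu] has squared twice. As [c] and [c'] are
    nonzero, the coefficient vectors are distinct: each [nu] depends on one parameter, each [D] on
    one of [m1, m2] and one of [m3, m4]. The four [D] kill the main term and give $16=2^4$. *)
Lemma box_bound (c c' u u' : int) :
  c != 0 -> c' != 0 -> (absz c <= cm)%N -> (absz c' <= cm)%N ->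
  (absz u <= am)%N -> (absz u' <= am)%N ->
  \sum_(m1 < H) \sum_(m2 < H) \sum_(m3 < H) \sum_(m4 < H) \sum_x
    (nu (x ++> (- c * (m1 : nat)%:Z)) * nu (x ++> (- c * (m2 : nat)%:Z))) *
    ((nu (x ++> (u - c' * (m3 : nat)%:Z))
      * D (x ++> (u' - c * (m1 : nat)%:Z - c' * (m3 : nat)%:Z))
      * D (x ++> (u' - c * (m2 : nat)%:Z - c' * (m3 : nat)%:Z))) *
     (nu (x ++> (u - c' * (m4 : nat)%:Z))
      * D (x ++> (u' - c * (m1 : nat)%:Z - c' * (m4 : nat)%:Z))
      * D (x ++> (u' - c * (m2 : nat)%:Z - c' * (m4 : nat)%:Z))))
  <= 16 * (eta * n * hr ^+ 4).
Proof.
move=> c0 c'0 cM c'M uM u'M.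
have := @lf_sum_D_bound
  [:: (true, (0, (- c, 0, 0, 0))); (true, (0, (0, - c, 0, 0)));
      (true, (u, (0, 0, - c', 0))); (true, (u, (0, 0, 0, - c')))]
  [:: (u', (- c, 0, - c', 0)); (u', (0, - c, - c', 0));
      (u', (- c, 0, 0, - c')); (u', (0, - c, 0, - c'))].
rewrite /= K_ge8 /small_form /= !abszN cM c'M uM u'M /=.
rewrite !inE !xpair_eqE /= !eqr_oppLR oppr0 (negbTE c0) (negbTE c'0).
rewrite ![0 == - _]eq_sym !oppr_eq0 (negbTE c0) (negbTE c'0) /= ?andbF /=.
move=> /(_ isT isT isT); rewrite mul0r subr0 => /(le_trans (ler_norm _)).
rewrite sum_quad (_ : 2 ^+ 4 = 16); last by ring.
apply: le_trans; rewrite le_eqVlt; apply/orP; left; apply/eqP.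
apply: eq_bigr => m1 _; apply: eq_bigr => m2 _; apply: eq_bigr => m3 _.
apply: eq_bigr => m4 _; apply: eq_bigr => x _.
rewrite /lf_prod !big_cons !big_nil /form_value /= !mul0r !addr0 !add0r.
by rewrite !mulr1 !mulNr; ring.
Qed.

(** Two Cauchy-Schwarz steps remove the unknown functions: first [p], whose argument is made free of
    [m] by a translation, then the pair of values of [q]. Only [nu] and [D] remain, so [box_bound]
    applies; $128=2^2\cdot2\cdot16$. *)
Lemma replace_nu (p q : V -> R) (c c' u u' : int) :
  (forall x, `|p x| <= nu x) -> (forall x, `|q x| <= nu x) ->
  c != 0 -> c' != 0 -> (absz c <= cm)%N -> (absz c' <= cm)%N ->
  (absz (u - u') <= am)%N -> (absz u' <= am)%N ->
  (\sum_(m < H) \sum_(m' < H) \sum_x D x * p (x ++> (u + c * (m : nat)%:Z))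
         * q (x ++> (u' + c' * (m' : nat)%:Z))) ^+ 4
  <= 128 * eta * n ^+ 4 * hr ^+ 8.
Proof.
move=> pnu qnu c0 c'0 cM c'M uM u'M.
set T := \sum_(m < H) _.
pose G (m m' : 'I_H) x := D (x ++> (- (u + c * (m : nat)%:Z))) *
   q (x ++> (u' + c' * (m' : nat)%:Z - (u + c * (m : nat)%:Z))).
have T1 : T = \sum_(z : 'I_H * V) p z.2 * \sum_m G m z.1 z.2.
  rewrite sum_pair /= /T exchange_big /=.
  apply: eq_bigr => m' _; under [RHS]eq_bigr do rewrite mulr_sumr.
  rewrite [RHS]exchange_big /=; apply: eq_bigr => m _.
  rewrite -(sum_shift (e *~ (- (u + c * (m : nat)%:Z)))).
  apply: eq_bigr => x _; rewrite /G -!addrA -!mulrzDr addNr mulr0z addr0.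
  rewrite [in RHS]mulrCA mulrA; congr (_ * _ * q (x ++> _)); ring.
have T2 : T ^+ 2 <= (hr * (2 * n)) * \sum_(m1 < H) \sum_(m2 < H) \sum_x
    (q (x ++> (- c * (m1 : nat)%:Z)) * q (x ++> (- c * (m2 : nat)%:Z))) *
    \sum_(m' < H) (nu (x ++> (u - u' - c' * (m' : nat)%:Z))
      * D (x ++> (- u' - c * (m1 : nat)%:Z - c' * (m' : nat)%:Z))
      * D (x ++> (- u' - c * (m2 : nat)%:Z - c' * (m' : nat)%:Z))).
  rewrite T1; apply: le_trans (@weighted_cauchy_schwarz _ _ (fun z => nu z.2) _ _ _) _.
    by move=> z; apply: pnu.
  rewrite sum_pair /= sumr_const card_ord -[_ *+ H]mulr_natl.
  set S := \sum_(i : 'I_H * V) _; set S' := \sum_(m1 < H) _.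
  have SS : S = S'.
    rewrite /S sum_pair /= /S'.
    under eq_bigr do under eq_bigr do rewrite sqr_sum mulr_sumr.
    under eq_bigr do rewrite exchange_big /=.
    rewrite exchange_big /=; apply: eq_bigr => m1 _.
    under eq_bigr do under eq_bigr do rewrite mulr_sumr.
    under eq_bigr do rewrite exchange_big /=.
    rewrite exchange_big /=; apply: eq_bigr => m2 _.
    under [RHS]eq_bigr do rewrite mulr_sumr.
    rewrite [RHS]exchange_big /=; apply: eq_bigr => m' _.
    (* This translation makes both values of [q] independent of [m'], so they come out of the sum
       over [m'] and the second Cauchy-Schwarz step can remove them. *)
    rewrite -(sum_shift (e *~ (u - u' - c' * (m' : nat)%:Z))).
    apply: eq_bigr => x _; rewrite /G -!addrA -!mulrzDr.
    have E0 : forall A B C D E A' B' C' D' E' : R, A = A' -> B = B' -> C = C' -> D = D' ->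
       E = E' -> A * (B * C * (D * E)) = C' * E' * (A' * B' * D').
      by move=> A B C D' E A' B' C' D'' E' -> -> -> -> ->; ring.
    by apply: E0 => //; congr (_ (_ ++> _)); ring.
  have S0 : 0 <= S' by rewrite -SS; apply: sumr_ge0 => z _; rewrite mulr_ge0 ?sqr_ge0.
  rewrite SS ler_wpM2r // ler_wpM2l ?sum_nu //.
set S := (X in _ <= _ * X) in T2.
have S2 : S ^+ 2 <= (2 * n * hr ^+ 2) * (16 * (eta * n * hr ^+ 4)).
  rewrite /S; under eq_bigr do rewrite pair_bigA /=.
  rewrite pair_bigA /=.
  apply: le_trans (@weighted_cauchy_schwarz _ _ (fun z : 'I_H * ('I_H * V) =>
     nu (z.2.2 ++> (- c * (z.1 : nat)%:Z)) * nu (z.2.2 ++> (- c * (z.2.1 : nat)%:Z))) _ _ _) _.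
    by move=> z; rewrite normrM ler_pM.
  apply: ler_pM.
  - by apply: sumr_ge0 => z _; rewrite mulr_ge0.
  - apply: sumr_ge0 => z _; rewrite mulr_ge0 ?sqr_ge0 // mulr_ge0 //.
  - rewrite sum_pair; under eq_bigr do rewrite sum_pair /=.
    have := @sum_nu_nu 0 (- c) 0 0 0 (- c).
    rewrite !abszN cM /= xpair_eqE /= oppr_eq0 (negbTE c0) => /(_ isT isT isT isT isT isT isT).
    by under eq_bigr do under eq_bigr do under eq_bigr do rewrite !mul0r !add0r addr0.
  rewrite sum_pair /=.
  have := @box_bound c c' (u - u') (- u') c0 c'0 cM c'M uM.
  rewrite abszN => /(_ u'M); apply: le_trans.
  rewrite le_eqVlt; apply/orP; left; apply/eqP; apply: eq_bigr => m1 _.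
  rewrite sum_pair /=.
  apply: eq_bigr => m2 _.
  under eq_bigr => x _.
    rewrite sqr_sum mulr_sumr; under eq_bigr do rewrite mulr_sumr; over.
  by rewrite exchange_big /=; apply: eq_bigr => m3 _; rewrite exchange_big.
have n0 : 0 <= n := mass_ge0.
have hr0 : 0 <= hr by rewrite ltW ?height_gt0.
have S0 : 0 <= (hr * (2 * n)) ^+ 2 by rewrite sqr_ge0.
rewrite (_ : 4 = 2 * 2)%N // exprM.
have T20 : 0 <= T ^+ 2 by rewrite sqr_ge0.
apply: le_trans (_ : ((hr * (2 * n)) * S) ^+ 2 <= _).
  by rewrite lerXn2r // nnegrE // (le_trans T20).
rewrite exprMn; apply: le_trans (ler_wpM2l S0 S2) _.
rewrite le_eqVlt; apply/orP; left; apply/eqP; ring.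
Qed.

End Pseudorandom.

(** * Products of two differences as translates *)

Section DilateFamily.

Variables (H A : nat).

(** Bracketed so that [w.1] holds both ends of the first difference and one end of the second: for
    fixed [w.1], the dilate is affine in [w.2], the shape needed in [corr_excess_le]. *)
Definition dilates := ('I_A * 'I_A * 'I_H * 'I_H)%type.

Definition step (t : 'I_A * 'I_A * 'I_H) : int := (t.1.1 : nat)%:Z - (t.1.2 : nat)%:Z.

Definition dilate (w : dilates) : int :=
  step w.1 * ((w.2 : nat)%:Z - (w.1.2 : nat)%:Z).

Lemma absz_step t : (absz (step t) <= A)%N.
Proof. by rewrite /step; have := ltn_ord t.1.1; have := ltn_ord t.1.2; lia. Qed.

Lemma absz_dilate w : (absz (dilate w) <= A * H)%N.
Proof.
rewrite /dilate abszM leq_mul ?absz_step //.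
have := ltn_ord w.2; have := ltn_ord w.1.2; lia.
Qed.

End DilateFamily.

(** * Correlations of [p] with families of translates, and their squaring *)

Section Correlation.

Variables (R : realFieldType) (V : finZmodType) (e : V) (H : nat).
Variables (nu o : V -> R) (K am cm : nat) (eta : R).
Hypothesis pr : pseudorandom e H nu o K am cm eta.
Variables (p : V -> R) (M eps : R).
Hypothesis p_nu : forall x, `|p x| <= nu x.
Hypothesis nu_M : forall x, nu x <= M.
Hypothesis M_ge1 : 1 <= M.
Hypothesis eps_ge0 : 0 <= eps.
Hypothesis eta_eps : 128 * eta <= eps ^+ 4.

Let nu_ge0 := pr_nu_ge0 pr.
Let o_ge0 := pr_o_ge0 pr.
Let o_le1 := pr_o_le1 pr.
Let H_gt0 := pr_H_gt0 pr.

Local Notation n := (mass o).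
Local Notation D := (excess nu o).
Local Notation hr := (H%:R : R).
Local Notation "x ++> z" := (x + e *~ z) (at level 50).

Lemma replace_nu_eps (c c' u u' : int) :
  c != 0 -> c' != 0 -> (absz c <= cm)%N -> (absz c' <= cm)%N ->
  (absz (u - u') <= am)%N -> (absz u' <= am)%N ->
  `|\sum_(m < H) \sum_(m' < H) \sum_x D x * p (x ++> (u + c * (m : nat)%:Z))
         * p (x ++> (u' + c' * (m' : nat)%:Z))| <= n * hr ^+ 2 * eps.
Proof.
move=> c0 c'0 cM c'M uM u'M.
have n0 := mass_ge0 pr.
have B0 : 0 <= n * hr ^+ 2 * eps by rewrite !mulr_ge0 ?exprn_ge0.
rewrite -(@ler_pXn2r _ 4) ?nnegrE // -normrX ger0_norm; last first.
  by rewrite (_ : 4 = 2 * 2)%N // exprM sqr_ge0.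
apply: le_trans (replace_nu pr p_nu p_nu c0 c'0 cM c'M uM u'M) _.
have -> : (n * hr ^+ 2 * eps) ^+ 4 = eps ^+ 4 * (n ^+ 4 * hr ^+ 8) by ring.
by rewrite -(mulrA _ (n ^+ 4)) ler_wpM2r // mulr_ge0 ?exprn_ge0.
Qed.

Lemma trivial_excess_bound (x1 x2 : int) :
  `|\sum_x D x * p (x ++> x1) * p (x ++> x2)| <= 3 * n * M ^+ 2.
Proof.
apply: le_trans (ler_norm_sum _ _ _) _.
apply: le_trans (_ : \sum_x (nu x + o x) * M ^+ 2 <= _).
  apply: ler_sum => x _; rewrite !normrM expr2 mulrA.
  have pM y : `|p y| <= M by apply: le_trans (p_nu y) (nu_M y).
  rewrite ler_pM ?mulr_ge0 // ler_pM // /excess.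
  by apply: le_trans (ler_normB _ _) _; rewrite !ger0_norm.
rewrite -mulr_suml big_split /= ler_wpM2r ?sqr_ge0 //.
have := sum_nu pr; rewrite -/(mass o); lra.
Qed.

(** When [c] or [c'] vanishes, coefficient vectors coincide and only the pointwise bound by [M] is
    left. The indicators are kept, so that summing over the steps charges this cost to the rare zero
    steps alone. *)
Lemma excess_pair_bound (c c' u u' : int) :
  (absz c <= cm)%N -> (absz c' <= cm)%N ->
  (absz (u - u') <= am)%N -> (absz u' <= am)%N ->
  `|\sum_(m < H) \sum_(m' < H) \sum_x D x * p (x ++> (u + c * (m : nat)%:Z))
         * p (x ++> (u' + c' * (m' : nat)%:Z))|
  <= n * hr ^+ 2 * (eps + 3 * M ^+ 2 * ((c == 0)%:R + (c' == 0)%:R)).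
Proof.
move=> cM c'M uM u'M; have n0 := mass_ge0 pr.
have M0 : 0 <= M := le_trans ler01 M_ge1.
have [/andP[c0 c'0]|cc] := boolP ((c != 0) && (c' != 0)).
  rewrite (negbTE c0) (negbTE c'0) addr0 mulr0 addr0.
  exact: replace_nu_eps.
apply: le_trans (_ : n * hr ^+ 2 * (3 * M ^+ 2) <= _); last first.
  rewrite ler_wpM2l ?mulr_ge0 ?exprn_ge0 //.
  have: 1 <= (c == 0)%:R + (c' == 0)%:R :> R.
    by move: cc; case: (c == 0); case: (c' == 0) => //=; lra.
  have: 0 <= M ^+ 2 by rewrite exprn_ge0.
  set X := M ^+ 2; set Z := _%:R + _ => X0 Z1.
  have : 0 <= X * (Z - 1) by rewrite mulr_ge0 ?subr_ge0.
  have e0 := eps_ge0; lra.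
apply: le_trans (_ : \sum_(m < H) \sum_(m' < H) 3 * n * M ^+ 2 <= _).
  apply: le_trans (ler_norm_sum _ _ _) _; apply: ler_sum => m _.
  apply: le_trans (ler_norm_sum _ _ _) _; apply: ler_sum => m' _.
  exact: trivial_excess_bound.
by rewrite !sumr_const !card_ord -mulrnA -[leLHS]mulr_natl natrM; lra.
Qed.

(** The weight [nu] left by Cauchy-Schwarz is written [o + D] with [o <= 1]: the first sum carries
    no weight, and only the second calls for the linear forms condition. *)
Lemma weighted_square (F : V -> R) :
  (\sum_x p x * F x) ^+ 2
    <= 2 * n * (\sum_x F x ^+ 2 + \sum_x D x * F x ^+ 2).
Proof.
apply: le_trans (weighted_cauchy_schwarz _ p_nu) _.
apply: le_trans (ler_wpM2r _ (sum_nu pr)) _.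
  by apply: sumr_ge0 => x _; rewrite mulr_ge0 ?sqr_ge0.
rewrite ler_wpM2l ?mulr_ge0 ?(mass_ge0 pr) // -big_split /=.
apply: ler_sum => x _; rewrite /excess.
have := o_le1 x; have := sqr_ge0 (F x); nra.
Qed.

Definition corr (W : finType) (s : W -> int) : R :=
  \sum_w \sum_x p x * p (x ++> s w).

Definition corr_excess (W : finType) (s : W -> int) : R :=
  \sum_w \sum_w' \sum_x D x * p (x ++> s w) * p (x ++> s w').

(** By translation invariance, the sum over [x] of $p(x+s_w)p(x+s_{w'})$ depends only on
    $s_{w'}-s_w$, so squaring replaces the family by its differences. *)
Lemma corr_square (W : finType) (s : W -> int) :
  corr s ^+ 2 <= 2 * n * (corr (fun z : W * W => s z.2 - s z.1) + corr_excess s).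
Proof.
rewrite /corr exchange_big /=; under eq_bigr do rewrite -mulr_sumr.
apply: le_trans (weighted_square _) _; rewrite le_eqVlt; apply/orP; left; apply/eqP.
congr (_ * (_ + _)).
  under [LHS]eq_bigr do rewrite sqr_sum.
  rewrite [RHS]sum_pair exchange_big /=; apply: eq_bigr => w _.
  rewrite exchange_big /=; apply: eq_bigr => w' _.
  rewrite -(sum_shift (e *~ (- s w))); apply: eq_bigr => x _.
  by rewrite -!addrA -!mulrzDr addNr mulr0z addr0 [- _ + _]addrC.
rewrite /corr_excess.
under [LHS]eq_bigr do rewrite sqr_sum mulr_sumr.
rewrite exchange_big /=; apply: eq_bigr => w _.
under eq_bigr do rewrite mulr_sumr.
rewrite exchange_big /=; apply: eq_bigr => w' _.
by apply: eq_bigr => x _; rewrite mulrA.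
Qed.

Section Dilates.

Variable A : nat.
Hypothesis A_gt0 : (0 < A)%N.
Hypothesis A_cm : (A <= cm)%N.

Local Notation dilates := (dilates H A).
Local Notation ar := (A%:R : R).
(** Relative cost of one squaring: [eps] for pairs of nonzero steps, and [3 M^2] for a zero step on
    either side of the pair, zero steps having density [1/A]. *)
Definition loss : R := eps + 6 * M ^+ 2 / ar.

Lemma sum_step_eq0 :
  \sum_(t : 'I_A * 'I_A * 'I_H) (step t == 0)%:R = ar * hr :> R.
Proof.
rewrite sum_pair sum_pair /=.
transitivity (\sum_(i < A) \sum_(j < A) hr * (j == i)%:R).
  apply: eq_bigr => i _; apply: eq_bigr => j _.
  rewrite /step /= sumr_const card_ord -[LHS]mulr_natl subr_eq0 eqz_nat.
  by rewrite eq_sym.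
transitivity (\sum_(i < A) hr).
  apply: eq_bigr => i _; rewrite -mulr_sumr (bigD1 i) //= eqxx big1 ?addr0 ?mulr1 //.
  by move=> j /negbTE ->.
by rewrite sumr_const card_ord -[_ *+ A]mulr_natl.
Qed.

Lemma sum_pair_affine (T : finType) (a b c : R) (g : T -> R) :
  \sum_t \sum_t' a * (b + c * (g t + g t')) =
  a * (b * #|T|%:R ^+ 2 + 2 * c * #|T|%:R * \sum_t g t).
Proof.
have E (x z : R) : \sum_(t : T) (x + z * g t) = #|T|%:R * x + z * \sum_t g t.
  by rewrite big_split /= sumr_const -mulr_sumr -[_ *+ _]mulr_natl.
transitivity (\sum_t (a * (#|T|%:R * b + c * \sum_t g t) + a * #|T|%:R * c * g t)).
  apply: eq_bigr => t _; rewrite -mulr_sumr.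
  transitivity (a * \sum_t' (b + c * g t + c * g t')).
    by congr (_ * _); apply: eq_bigr => t' _; ring.
  by rewrite E; ring.
by rewrite E; ring.
Qed.

(** The shifts [y] carry the dilates not under consideration. With [t] fixed, the last variable of
    the singled-out dilate runs along a progression of step [step t.2], which is the situation of
    [excess_pair_bound]. *)
Lemma corr_excess_le (U : finType) (y : U -> int) (Y : nat) :
  (forall u, absz (y u) <= Y)%N -> (2 * (A * H + Y) <= am)%N ->
  corr_excess (fun z : U * dilates => y z.1 + dilate z.2) <=
    n * (#|U|%:R * ar ^+ 2 * hr ^+ 2) ^+ 2 * loss.
Proof.
move=> yY Yam; have n0 := mass_ge0 pr.
have ar0 : 0 < ar by rewrite ltr0n.
pose T : finType := (U * ('I_A * 'I_A * 'I_H))%type.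
pose v (t : T) : int := y t.1 - step t.2 * (t.2.2 : nat)%:Z.
have vY t : (absz (v t) <= A * H + Y)%N.
  have h1 := yY t.1; have : (absz (step t.2 * (t.2.2 : nat)%:Z)%R <= A * H)%N.
    by rewrite abszM leq_mul ?absz_step // ltnW ?ltn_ord.
  by rewrite /v; lia.
have -> : corr_excess (fun z : U * dilates => y z.1 + dilate z.2) =
   \sum_(t : T) \sum_(t' : T) \sum_(m < H) \sum_(m' < H) \sum_x
      D x * p (x ++> (v t + step t.2 * (m : nat)%:Z))
          * p (x ++> (v t' + step t'.2 * (m' : nat)%:Z)).
  rewrite /corr_excess sum_pair [RHS]sum_pair; apply: eq_bigr => u _.
  rewrite sum_pair; apply: eq_bigr => t _.
  under eq_bigr => m _ do rewrite sum_pair.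
  rewrite exchange_big /= [RHS]sum_pair /=; apply: eq_bigr => u' _.
  under eq_bigr => m _ do rewrite sum_pair.
  rewrite exchange_big /=; apply: eq_bigr => t' _.
  apply: eq_bigr => m _; apply: eq_bigr => m' _; apply: eq_bigr => x _.
  by rewrite /v /dilate /=; congr (_ * p (_ ++> _) * p (_ ++> _)); ring.
apply: le_trans (_ : \sum_(t : T) \sum_(t' : T) n * hr ^+ 2 *
   (eps + 3 * M ^+ 2 * ((step t.2 == 0)%:R + (step t'.2 == 0)%:R)) <= _).
  apply: ler_sum => t _; apply: ler_sum => t' _.
  apply: le_trans (ler_norm _) _; apply: excess_pair_bound.
  - exact: leq_trans (absz_step _) A_cm.
  - exact: leq_trans (absz_step _) A_cm.
  - by have := vY t; have := vY t'; lia.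
  - by have := vY t'; lia.
have cT : #|T|%:R = #|U|%:R * ar ^+ 2 * hr :> R.
  by rewrite !card_prod !card_ord !natrM; ring.
have sT : \sum_(t : T) (step t.2 == 0)%:R = #|U|%:R * (ar * hr) :> R.
  by rewrite sum_pair /= sum_step_eq0 sumr_const -[_ *+ _]mulr_natl.
rewrite sum_pair_affine sT cT le_eqVlt; apply/orP; left; apply/eqP.
by rewrite /loss; field; rewrite gt_eqF.
Qed.

(** The successor makes [m] range over $[H]$, which starts at 1; after a squaring only differences
    of its values survive. *)
Definition self_corr (d : int) : R := \sum_(m < H) \sum_x p x * p (x ++> d * (m : nat).+1%:Z).

(** For fixed [b, b'], [weighted_square] opens the squared self-correlation into the translates by
    $(b-b')(m'-m)$, which are the dilates. *)
Lemma first_corr (rho : R) :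
  (2 * (A * H) <= am)%N ->
  rho * (ar ^+ 2 * n ^+ 2 * hr ^+ 2) <=
    \sum_(b < A) \sum_(b' < A) self_corr ((b : nat)%:Z - (b' : nat)%:Z) ^+ 2 ->
  (rho / 2 - loss) * (ar ^+ 2 * n * hr ^+ 2) <= corr (@dilate H A).
Proof.
move=> Aam rhoV; have n0 := mass_ge0 pr.
have ar0 : 0 < ar by rewrite ltr0n.
pose d (b b' : 'I_A) : int := (b : nat)%:Z - (b' : nat)%:Z.
pose E b b' : R := \sum_(m < H) \sum_(m' < H) \sum_x
   D x * p (x ++> d b b' * (m : nat).+1%:Z) * p (x ++> d b b' * (m' : nat).+1%:Z).
pose G b b' : R := \sum_(m < H) \sum_(m' < H) \sum_x
   p x * p (x ++> d b b' * ((m' : nat)%:Z - (m : nat)%:Z)).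
have self_le b b' : self_corr (d b b') ^+ 2 <= 2 * n * (G b b' + E b b').
  rewrite /self_corr exchange_big /=; under eq_bigr do rewrite -mulr_sumr.
  apply: le_trans (weighted_square _) _; rewrite le_eqVlt; apply/orP; left; apply/eqP.
  congr (_ * (_ + _)).
    under eq_bigr do rewrite sqr_sum.
    rewrite exchange_big /=; apply: eq_bigr => m _.
    rewrite exchange_big /=; apply: eq_bigr => m' _.
    rewrite -(sum_shift (e *~ (- (d b b' * (m : nat).+1%:Z)))); apply: eq_bigr => x _.
    rewrite -!addrA -!mulrzDr addNr mulr0z addr0; congr (_ * p (_ ++> _)); rewrite !intS; ring.
  under eq_bigr do rewrite sqr_sum mulr_sumr.
  rewrite exchange_big /=; apply: eq_bigr => m _.
  under eq_bigr do rewrite mulr_sumr.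
  rewrite exchange_big /=; apply: eq_bigr => m' _.
  by apply: eq_bigr => x _; rewrite mulrA.
have corrE : corr (@dilate H A) = \sum_(b < A) \sum_(b' < A) G b b'.
  by rewrite /corr !sum_pair.
have E_le b b' : E b b' <= n * hr ^+ 2 * (eps + 6 * M ^+ 2 * (b' == b)%:R).
  have := @excess_pair_bound (d b b') (d b b') (d b b') (d b b').
  have dA : (absz (d b b') <= cm)%N.
    by apply: leq_trans (absz_step (b, b', Ordinal H_gt0)) A_cm.
  have dam : (absz (d b b') <= am)%N.
    apply: leq_trans (absz_step (b, b', Ordinal H_gt0)) _; apply: leq_trans Aam.
    by rewrite mulnC -mulnA leq_pmulr // muln_gt0 H_gt0.
  rewrite subrr dA dam => /(_ isT isT isT isT) /(le_trans (ler_norm _)).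
  have -> : (d b b' == 0) = (b' == b) by rewrite subr_eq0 eqz_nat eq_sym.
  have -> : E b b' = \sum_(m < H) \sum_(m' < H) \sum_x
     D x * p (x ++> (d b b' + d b b' * (m : nat)%:Z)) * p (x ++> (d b b' + d b b' * (m' : nat)%:Z)).
    apply: eq_bigr => m _; apply: eq_bigr => m' _; apply: eq_bigr => x _.
    by rewrite !intS !mulrDr !mulr1.
  move/le_trans; apply; rewrite ler_wpM2l ?mulr_ge0 ?exprn_ge0 //.
  by rewrite le_eqVlt; apply/orP; left; apply/eqP; ring.
have sumE : \sum_(b < A) \sum_(b' < A) E b b' <= n * hr ^+ 2 * (ar ^+ 2 * loss).
  apply: le_trans (ler_sum _ (fun b _ => ler_sum _ (fun b' _ => E_le b b'))) _.
  under eq_bigr => b _.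
    rewrite -mulr_sumr big_split /= sumr_const card_ord -mulr_sumr (bigD1 b) //= eqxx.
    rewrite big1 ?addr0 ?mulr1 -1?[eps *+ A]mulr_natl; first over.
    by move=> j /negbTE ->.
  rewrite sumr_const card_ord -[leLHS]mulr_natl le_eqVlt; apply/orP; left; apply/eqP.
  by rewrite /loss; field; rewrite gt_eqF.
have : rho * (ar ^+ 2 * n ^+ 2 * hr ^+ 2) <=
       2 * n * (corr (@dilate H A) + n * hr ^+ 2 * (ar ^+ 2 * loss)).
  apply: le_trans rhoV _.
  apply: le_trans (ler_sum _ (fun b _ => ler_sum _ (fun b' _ => self_le b b'))) _.
  under eq_bigr do rewrite -mulr_sumr big_split /=.
  by rewrite -mulr_sumr big_split /= corrE ler_wpM2l ?mulr_ge0 // lerD2l.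
(* The division by [2 n] needs [n != 0]; when [n = 0], [sum_nu] forces [nu], hence [p], to
   vanish. *)
have [n_eq0|n_neq0] := eqVneq n 0; last first.
  have n_gt0 : 0 < n by rewrite lt_def n_neq0.
  have -> : rho * (ar ^+ 2 * n ^+ 2 * hr ^+ 2) = 2 * n * (rho / 2 * (ar ^+ 2 * n * hr ^+ 2)).
    by field.
  rewrite ler_pM2l ?mulr_gt0 //; lra.
move=> _; rewrite n_eq0 mulr0 mul0r mulr0 /corr sumr_ge0 // => w _.
have nu0 x : nu x = 0.
  have := sum_nu pr; rewrite n_eq0 mulr0 => s0.
  apply/eqP; rewrite eq_le nu_ge0 andbT; apply: le_trans s0.
  by rewrite (bigD1 x) //= lerDl sumr_ge0.
rewrite sumr_ge0 // => x _.
by have := p_nu x; rewrite nu0 normr_le0 => /eqP ->; rewrite mul0r.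
Qed.

(** One dilate of [s] is singled out to feed [corr_excess_le]; the others sit in [U]. Each use
    doubles the number of dilates and turns the density [rho] into [rho ^+ 2 / 2 - loss]. *)
Lemma corr_step (U : finType) (y : U -> int) (Y : nat) (s : U * dilates -> int) (rho : R) :
  (forall z, s z = y z.1 + dilate z.2) ->
  (forall u, absz (y u) <= Y)%N -> (2 * (A * H + Y) <= am)%N -> 0 < n -> 0 <= rho ->
  rho * (n * (#|U|%:R * ar ^+ 2 * hr ^+ 2)) <= corr s ->
  (rho ^+ 2 / 2 - loss) * (n * (#|U|%:R * ar ^+ 2 * hr ^+ 2) ^+ 2) <=
    corr (fun z : (U * dilates) * (U * dilates) => s z.2 - s z.1).
Proof.
move=> sE yY Yam n_gt0 rho0 rhos.
have := corr_square s; set C2 := corr (fun z : (U * dilates) * (U * dilates) => s z.2 - s z.1) => C2P.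
have := corr_excess_le yY Yam.
have -> : corr_excess (fun z : U * dilates => y z.1 + dilate z.2) = corr_excess s.
  apply: eq_bigr => w _; apply: eq_bigr => w' _; apply: eq_bigr => x _.
  by rewrite !sE.
move: C2P rhos; set X := #|U|%:R * ar ^+ 2 * hr ^+ 2; move: (corr s) (corr_excess s) => c1 ex C2P c1P exP.
have X0 : 0 <= X by rewrite !mulr_ge0 ?exprn_ge0 ?ler0n.
have l0 : 0 <= rho * (n * X) by rewrite mulr_ge0 // mulr_ge0 // ltW.
have c1_ge0 : 0 <= c1 := le_trans l0 c1P.
have : (rho * (n * X)) ^+ 2 <= 2 * n * (C2 + ex).
  apply: le_trans C2P; rewrite lerXn2r // ?nnegrE //.
have -> : (rho * (n * X)) ^+ 2 = 2 * n * (rho ^+ 2 / 2 * (n * X ^+ 2)) by field.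
rewrite ler_pM2l ?mulr_gt0 //; lra.
Qed.

End Dilates.

End Correlation.

(** * Averaging a kernel over combinations of two steps *)

Section KernelAverage.

Variable R : realFieldType.

Definition diff (N : nat) (z : 'I_N * 'I_N) : int := (z.1 : nat)%:Z - (z.2 : nat)%:Z.

Lemma absz_diff N (z : 'I_N * 'I_N) : (absz (diff z) <= N)%N.
Proof. by rewrite /diff; have := ltn_ord z.1; have := ltn_ord z.2; lia. Qed.

Lemma shift_sum_nat (f : int -> R) (Q v : nat) (M : R) :
  (forall x : int, (absz x <= Q + v)%N -> `|f x| <= M) ->
  `|\sum_(m < Q) f ((m : nat)%:Z + v%:Z) - \sum_(m < Q) f (m : nat)%:Z| <= 2 * v%:R * M.
Proof.
elim: v => [|v IH] fM.
  under eq_bigr do rewrite addr0.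
  by rewrite subrr normr0 mulr0 mul0r.
have h : `|\sum_(m < Q) f ((m : nat)%:Z + v%:Z) - \sum_(m < Q) f (m : nat)%:Z| <= 2 * v%:R * M.
  by apply: IH => x xQ; apply: fM; lia.
have E : \sum_(m < Q) f ((m : nat)%:Z + v.+1%:Z) =
  \sum_(m < Q) f ((m : nat)%:Z + v%:Z) + f (Q%:Z + v%:Z) - f v%:Z.
  have := big_ord_recr Q (fun m : 'I_Q.+1 => f ((m : nat)%:Z + v%:Z)) (op := +%R) (idx := 0).
  rewrite [LHS]big_ord_recl /= => /eqP; rewrite addrC -subr_eq => /eqP E.
  rewrite add0r in E; rewrite -E subrK addrK.
  by apply: eq_bigr => m _; congr f; rewrite /bump /=; lia.
have f1 : `|f (Q%:Z + v%:Z)| <= M by apply: fM; lia.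
have f2 : `|f v%:Z| <= M by apply: fM; lia.
rewrite E; move: h f1 f2; set S1 := \sum_(m < Q) _; set S0 := \sum_(m < Q) _.
rewrite !ler_norml -natr1; lra.
Qed.

Lemma shift_sum (f : int -> R) (Q Y : nat) (v : int) (M : R) :
  0 <= M -> (absz v <= Y)%N ->
  (forall x : int, (absz x <= Q + 2 * Y)%N -> `|f x| <= M) ->
  `|\sum_(m < Q) f ((m : nat)%:Z + v) - \sum_(m < Q) f (m : nat)%:Z| <= 2 * Y%:R * M.
Proof.
move=> M0 vY fM.
have mono : 2 * (absz v)%:R * M <= 2 * Y%:R * M.
  by rewrite ler_wpM2r // ler_wpM2l // ler_nat.
apply: le_trans mono; case: (intP v) vY fM => [|w|w] vY fM.
- under eq_bigr do rewrite addr0.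
  by rewrite subrr normr0 mulr0 mul0r.
- by apply: shift_sum_nat => x xQ; apply: fM; lia.
have := @shift_sum_nat (fun x => f (x - w.+1%:Z)) Q w.+1 M.
rewrite distrC; under [X in `|_ - X|]eq_bigr do rewrite addrK.
rewrite abszN; apply=> x xQ; apply: fM; lia.
Qed.

(* A combination of two steps with gcd g moves along multiples of g by
   small coefficients: reduce the first coefficient modulo the second step. *)
Lemma bezout_shift (e2 e3 : int) (P Y T G w : nat) (t : nat) :
  (absz e2 <= P)%N -> (absz e3 <= P)%N -> (w <= absz e3)%N -> (0 < w)%N ->
  (gcdn (absz e2) (absz e3) <= G)%N -> (t < T)%N -> (P <= Y)%N ->
  (G * T <= w * (Y - P))%N ->
  exists v2 v3 : int, [/\ (absz v2 <= Y)%N, (absz v3 <= Y)%N &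
     e2 * v2 + e3 * v3 = (gcdn (absz e2) (absz e3))%:Z * t%:Z].
Proof.
move=> e2P e3P we3 w0 gG tT PY GT.
have [u [v uv]] := Bezoutz e2 e3.
have e30 : e3 != 0 by lia.
set g := gcdn _ _ in gG *.
have uv' : u * e2 + v * e3 = g%:Z by rewrite uv.
pose v2 := ((u * t%:Z) %% e3)%Z; pose q := ((u * t%:Z) %/ e3)%Z.
have v2E : u * t%:Z = q * e3 + v2 by rewrite /v2 /q -divz_eq.
have v20 : 0 <= v2 by rewrite modz_ge0.
have v2lt : v2 < `|e3| by rewrite ltz_mod.
exists v2, (v * t%:Z + q * e2).
have E : e2 * v2 + e3 * (v * t%:Z + q * e2) = g%:Z * t%:Z.
  have -> : v2 = u * t%:Z - q * e3 by rewrite v2E; ring.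
  by rewrite -uv'; ring.
split=> //; first by lia.
set v3 := v * t%:Z + q * e2 in E *.
(* From $e_3v_3=gt-e_2v_2$: $|e_2v_2|\le|e_3|P$ because $0\le v_2<|e_3|$, and $gt\le GT\le
   w(Y-P)\le|e_3|(Y-P)$. Dividing by $|e_3|$ leaves $|v_3|\le Y$. *)
have h1 : (absz (e3 * v3)%R <= absz e3 * P + w * (Y - P))%N.
  have -> : e3 * v3 = g%:Z * t%:Z - e2 * v2 by rewrite -E; ring.
  have a1 : (absz (g%:Z * t%:Z)%R <= w * (Y - P))%N.
    by rewrite abszM /=; apply: leq_trans GT; apply: leq_mul => //; apply: ltnW.
  have a2 : (absz (e2 * v2)%R <= absz e3 * P)%N.
    by rewrite abszM mulnC leq_mul //; lia.
  lia.
have h2 : (absz e3 * absz v3 <= absz e3 * Y)%N.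
  rewrite abszM in h1; apply: leq_trans h1 _.
  rewrite -{2}(subnKC PY) mulnDr leq_add2l leq_mul2r we3 orbT //.
by move: h2; rewrite leq_pmul2l //; lia.
Qed.

(** A residue class modulo [g] meets each block of [g] consecutive integers at most once, so
    [b %/ g] determines [b]. *)
Lemma card_congruent (P g : nat) (r : int) :
  (0 < g)%N -> (#|[pred b : 'I_P | (g%:Z %| ((b : nat)%:Z - r)%R)%Z]| <= (P %/ g).+1)%N.
Proof.
move=> g0; rewrite -[X in (_ <= X)%N]card_ord.
pose f (b : 'I_P) : 'I_(P %/ g).+1 := inord (b %/ g).
rewrite -(@card_in_imset _ _ f).
  exact: max_card.
move=> b b'; rewrite !inE => bg b'g /(congr1 val) /=.
have lt (c : 'I_P) : (c %/ g < (P %/ g).+1)%N.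
  by rewrite ltnS leq_div2r // ltnW.
rewrite !inordK // => E; apply/val_inj => /=.
have : (g%:Z %| ((b : nat)%:Z - (b' : nat)%:Z)%R)%Z.
  have -> : (b : nat)%:Z - (b' : nat)%:Z = ((b : nat)%:Z - r) - ((b' : nat)%:Z - r) by ring.
  by rewrite rpredB.
rewrite -eqz_mod_dvd => /eqP; rewrite !modz_nat => -[E'].
by rewrite (divn_eq b g) (divn_eq b' g) E E'.
Qed.

Lemma sum_dvd_diff (P g : nat) : (0 < g <= P)%N ->
  \sum_(z : 'I_P * 'I_P) (g%:Z %| diff z)%Z%:R <= 2 * P%:R ^+ 2 / g%:R :> R.
Proof.
case/andP=> g0 gP; rewrite sum_pair exchange_big /=.
have gr : 0 < g%:R :> R by rewrite ltr0n.
apply: le_trans (_ : \sum_(b < P) (2 * P%:R / g%:R) <= _); last first.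
  by rewrite sumr_const card_ord -[leLHS]mulr_natl le_eqVlt; apply/orP; left; apply/eqP; field; rewrite gt_eqF.
apply: ler_sum => b' _; rewrite -natr_sum /diff /= -big_mkcond /= sum1_card.
rewrite ler_pdivlMr // -!natrM ler_nat.
have := card_congruent P (b' : nat)%:Z g0; set c := #|_| => c_le.
have := leq_trunc_div P g; have : (1 <= P %/ g)%N by rewrite divn_gt0.
nia.
Qed.

Lemma sum_inv_sqr (G P : nat) : (0 < G)%N ->
  \sum_(G.+1 <= g < P.+1) (g%:R ^+ 2)^-1 <= G%:R^-1 :> R.
Proof.
move=> G0; have G0' : 0 < G%:R :> R by rewrite ltr0n.
have [PG|GP] := leqP P.+1 G.+1.
  by rewrite big_geq // invr_ge0 ltW.
suff : \sum_(G.+1 <= g < P.+1) (g%:R ^+ 2)^-1 <= G%:R^-1 - P%:R^-1 :> R.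
  by move/le_trans; apply; rewrite gerBl invr_ge0 ler0n.
have -> : G%:R^-1 - P%:R^-1 = \sum_(G.+1 <= g < P.+1) (g.-1%:R^-1 - g%:R^-1) :> R.
  have := @telescope_sumr R G.+1 P.+1 (fun g => - (g.-1%:R^-1)) (ltnW GP).
  by rewrite /= opprK addrC => <-; apply: eq_bigr => g _; rewrite opprK addrC.
rewrite !big_nat; apply: ler_sum => -[|g] /andP[Gg _] //=.
have g0 : 0 < g%:R :> R by rewrite ltr0n; lia.
rewrite -subr_ge0 -[g.+1%:R]natr1.
have -> : g%:R^-1 - (g%:R + 1)^-1 - ((g%:R + 1) ^+ 2)^-1 = (g%:R * (g%:R + 1) ^+ 2)^-1 :> R.
  field; rewrite !gt_eqF //; lra.
by rewrite invr_ge0 mulr_ge0 ?sqr_ge0 // ltW.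
Qed.

Definition bad_pair (P w G : nat) (z2 z3 : 'I_P * 'I_P) : bool :=
  (absz (diff z3) < w)%N || (G < gcdn (absz (diff z2)) (absz (diff z3)))%N.

Lemma sum_small_diff (P w : nat) :
  \sum_(z : 'I_P * 'I_P) ((absz (diff z) < w)%N : nat)%:R <= 2 * w%:R * P%:R :> R.
Proof.
rewrite sum_pair exchange_big /=.
apply: le_trans (_ : \sum_(b < P) (2 * w%:R) <= _); last first.
  by rewrite sumr_const card_ord -[leLHS]mulr_natr.
apply: ler_sum => b' _; rewrite -natr_sum /diff /= -big_mkcond /= sum1_card -natrM ler_nat.
rewrite -[X in (_ <= X)%N]card_ord.
have [w0|w0] := posnP w.
  by rewrite eq_card0 // => b; rewrite !inE w0.
have w2 : (0 < 2 * w)%N by rewrite muln_gt0.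
pose f (b : 'I_P) : 'I_(2 * w) := insubd (Ordinal w2) (b + w - b')%N.
rewrite -(@card_in_imset _ _ f) ?max_card // => b c.
move=> bw0 cw0.
have bw : (absz ((b : nat)%:Z - (b' : nat)%:Z)%R < w)%N := bw0.
have cw : (absz ((c : nat)%:Z - (b' : nat)%:Z)%R < w)%N := cw0.
move=> /(congr1 val); rewrite !val_insubd.
rewrite !ifT; try lia.
by move=> E; apply: val_inj => /=; lia.
Qed.

(** Small differences have density at most $2w/P$. Otherwise [diff z3] is nonzero, so the gcd [g]
    satisfies $G<g\le P$ and divides both differences. Each divisibility has density at most $2/g$,
    and summing $4/g^2$ over $g>G$ gives $4/G$. *)
Lemma sum_bad_pair (P w G : nat) : (0 < w)%N -> (0 < G)%N -> (0 < P)%N ->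
  \sum_(z2 : 'I_P * 'I_P) \sum_(z3 : 'I_P * 'I_P) (bad_pair w G z2 z3)%:R
    <= P%:R ^+ 4 * (2 * w%:R / P%:R + 4 / G%:R) :> R.
Proof.
move=> w0 G0 P0.
have Pr : 0 < P%:R :> R by rewrite ltr0n.
have Gr : 0 < G%:R :> R by rewrite ltr0n.
pose dv g (z : 'I_P * 'I_P) : R := (g%:Z %| diff z)%Z%:R.
apply: le_trans (_ : \sum_(z2 : 'I_P * 'I_P) \sum_(z3 : 'I_P * 'I_P)
   (((absz (diff z3) < w)%N : nat)%:R + \sum_(G.+1 <= g < P.+1) dv g z2 * dv g z3) <= _).
  apply: ler_sum => z2 _; apply: ler_sum => z3 _; rewrite /bad_pair.
  have s0 : 0 <= \sum_(G.+1 <= g < P.+1) dv g z2 * dv g z3.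
    by apply: sumr_ge0 => g _; rewrite mulr_ge0.
  case: ltnP => /= wz; first by rewrite lerDl.
  case: ltnP => Gg; rewrite add0r //.
  set g := gcdn _ _ in Gg *.
  have gP : (g < P.+1)%N.
    rewrite ltnS; apply: leq_trans (absz_diff z3); apply: dvdn_leq; last exact: dvdn_gcdr.
    lia.
  rewrite (bigD1_seq g) /=; first last.
  - exact: iota_uniq.
  - by rewrite mem_index_iota Gg gP.
  rewrite /dv !dvdzE /= dvdn_gcdl dvdn_gcdr mulr1 lerDl.
  by apply: sumr_ge0 => g' _; rewrite mulr_ge0.
under eq_bigr do rewrite big_split /= exchange_big /=.
rewrite big_split /= sumr_const card_prod card_ord.
rewrite mulrDr; apply: lerD.
  rewrite -[leLHS]mulr_natl natrM.
  apply: le_trans (ler_wpM2l _ (sum_small_diff P w)) _; first by rewrite mulr_ge0.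
  by rewrite le_eqVlt; apply/orP; left; apply/eqP; field; rewrite gt_eqF.
rewrite exchange_big /=.
apply: le_trans (_ : \sum_(G.+1 <= g < P.+1) 4 * P%:R ^+ 4 * (g%:R ^+ 2)^-1 <= _).
  rewrite !big_nat; apply: ler_sum => g /andP[Gg gP].
  have g0 : 0 < g%:R :> R by rewrite ltr0n; lia.
  under eq_bigr do rewrite -mulr_sumr.
  rewrite -mulr_suml.
  have := @sum_dvd_diff P g; rewrite -/(dv g) => /(_ _)/wrap[]; first lia.
  move=> sg.
  have s0 : 0 <= \sum_z dv g z by apply: sumr_ge0.
  apply: le_trans (ler_pM s0 s0 sg sg) _.
  by rewrite le_eqVlt; apply/orP; left; apply/eqP; field; rewrite gt_eqF.
rewrite -mulr_sumr.
have -> : P%:R ^+ 4 * (4 / G%:R) = 4 * P%:R ^+ 4 * G%:R^-1 :> R by ring.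
by rewrite ler_wpM2l ?sum_inv_sqr // mulr_ge0 ?exprn_ge0.
Qed.

Section Average.

Variables (Phi : int -> R) (P Q Y T G w : nat) (M1 M2 : R).
Hypothesis M1_ge0 : 0 <= M1.
Hypothesis M2_ge0 : 0 <= M2.
Hypothesis Phi_le : forall y : int, (absz y <= 8 * (P * Q))%N -> `|Phi y| <= M1.
Hypothesis Phi_sum_le : forall (y : int) (g : nat), (0 < g <= G)%N ->
  `|\sum_(t < T) Phi (y + g%:Z * (t : nat)%:Z)| <= M2.
Hypothesis w_gt0 : (0 < w)%N.
Hypothesis T_gt0 : (0 < T)%N.
Hypothesis P_gt0 : (0 < P)%N.
Hypothesis Q_gt0 : (0 < Q)%N.
Hypothesis G_gt0 : (0 < G)%N.
Hypothesis PY : (P <= Y)%N.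
Hypothesis YQ : (Y <= Q)%N.
Hypothesis GT : (G * T <= w * (Y - P))%N.

Lemma absz_mul_le (a b : int) (A B : nat) :
  (absz a <= A)%N -> (absz b <= B)%N -> (absz (a * b)%R <= A * B)%N.
Proof. by move=> aA bB; rewrite abszM leq_mul. Qed.

(** Adding [g t] to the argument amounts to shifting [(m1, m3)] by the pair [(v2, v3)] of
    [bezout_shift], which alters the sum by at most [4 Y Q M1]. Averaging over [t < T] then exposes
    the progression sums bounded by [M2]. *)
Lemma good_pair_bound (y e2 e3 : int) :
  (absz y <= 2 * (P * Q))%N -> (absz e2 <= P)%N -> (absz e3 <= P)%N ->
  (w <= absz e3)%N -> (gcdn (absz e2) (absz e3) <= G)%N ->
  `|\sum_(m1 < Q) \sum_(m3 < Q) Phi (y + e2 * (m1 : nat)%:Z + e3 * (m3 : nat)%:Z)|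
   <= Q%:R ^+ 2 * (M2 / T%:R) + 4 * Y%:R * Q%:R * M1.
Proof.
move=> yPQ e2P e3P we3 gG; set g := gcdn _ _ in gG.
have Tr : 0 < T%:R :> R by rewrite ltr0n.
set S := \sum_(m1 < Q) _.
pose St (t : 'I_T) := \sum_(m1 < Q) \sum_(m3 < Q)
  Phi (y + e2 * (m1 : nat)%:Z + e3 * (m3 : nat)%:Z + g%:Z * (t : nat)%:Z).
have StS t : `|St t - S| <= 4 * Y%:R * Q%:R * M1.
  have [v2 [v3 [v2Y v3Y vE]]] := bezout_shift e2P e3P we3 w_gt0 gG (ltn_ord t) PY GT.
  have YQ' := YQ.
  pose S' := \sum_(m1 < Q) \sum_(m3 < Q)
     Phi (y + e2 * ((m1 : nat)%:Z + v2) + e3 * (m3 : nat)%:Z).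
  have S'S : `|S' - S| <= Q%:R * (2 * Y%:R * M1).
    rewrite /S' /S exchange_big /= [X in _ - X]exchange_big /= -sumrB.
    apply: le_trans (ler_norm_sum _ _ _) _.
    apply: le_trans (_ : \sum_(m3 < Q) (2 * Y%:R * M1) <= _); last first.
      by rewrite sumr_const card_ord -[leLHS]mulr_natl.
    apply: ler_sum => m3 _.
    apply: (@shift_sum (fun x => Phi (y + e2 * x + e3 * (m3 : nat)%:Z))) => // x xQ.
    (* Here $|x|\le Q+2Y\le3Q$, so the argument is at most $(2+3+1)PQ$; the other shift gives
       $(2+2+3)PQ$. Both lie in the range $8PQ$ of [Phi_le]. *)
    apply: Phi_le; have := absz_mul_le e2P xQ.
    have := @absz_mul_le e3 (m3 : nat)%:Z _ Q e3P (ltnW (ltn_ord m3)).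
    have := leq_mul (leqnn P) YQ'; rewrite mulnDr; lia.
  have StS' : `|St t - S'| <= Q%:R * (2 * Y%:R * M1).
    rewrite /S' /St -sumrB; apply: le_trans (ler_norm_sum _ _ _) _.
    apply: le_trans (_ : \sum_(m3 < Q) (2 * Y%:R * M1) <= _); last first.
      by rewrite sumr_const card_ord -[leLHS]mulr_natl.
    apply: ler_sum => m1 _.
    have := @shift_sum (fun x => Phi (y + e2 * ((m1 : nat)%:Z + v2) + e3 * x)) Q Y v3 M1 M1_ge0 v3Y.
    have -> : \sum_(m < Q) Phi (y + e2 * ((m1 : nat)%:Z + v2) + e3 * ((m : nat)%:Z + v3)) =
       \sum_(m3 < Q) Phi (y + e2 * (m1 : nat)%:Z + e3 * (m3 : nat)%:Z + g%:Z * (t : nat)%:Z).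
      apply: eq_bigr => m3 _; rewrite -vE; congr Phi; ring.
    apply=> x xQ; apply: Phi_le; have := absz_mul_le e3P xQ.
    have m1v : (absz ((m1 : nat)%:Z + v2)%R <= Q + Y)%N by have := ltn_ord m1; lia.
    have := absz_mul_le e2P m1v.
    have := leq_mul (leqnn P) YQ'; rewrite !mulnDr; lia.
  have -> : St t - S = (St t - S') + (S' - S) by ring.
  apply: le_trans (ler_normD _ _) _; lra.
have sumSt : `|\sum_t St t| <= Q%:R ^+ 2 * M2.
  rewrite /St exchange_big /=; apply: le_trans (ler_norm_sum _ _ _) _.
  apply: le_trans (_ : \sum_(m1 < Q) \sum_(m3 < Q) M2 <= _); last first.
    by rewrite !sumr_const card_ord -mulrnA -[leLHS]mulr_natl natrM.
  apply: ler_sum => m1 _; rewrite exchange_big /=; apply: le_trans (ler_norm_sum _ _ _) _.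
  apply: ler_sum => m3 _; apply: Phi_sum_le; rewrite gG andbT /g.
  rewrite gcdn_gt0 orbC; apply/orP; left; exact: leq_trans w_gt0 we3.
have TS : T%:R * S = \sum_t St t - \sum_t (St t - S).
  by rewrite sumrB opprB addrC subrK sumr_const card_ord -[RHS]mulr_natl.
have : `|T%:R * S| <= Q%:R ^+ 2 * M2 + T%:R * (4 * Y%:R * Q%:R * M1).
  rewrite TS; apply: le_trans (ler_normB _ _) _; apply: lerD => //.
  apply: le_trans (ler_norm_sum _ _ _) _.
  apply: le_trans (ler_sum _ (fun t _ => StS t)) _.
  by rewrite sumr_const card_ord -[leLHS]mulr_natl.
rewrite normrM (ger0_norm (ltW Tr)) => TS_le.
rewrite -(ler_pM2l Tr); apply: le_trans TS_le _.
by rewrite le_eqVlt; apply/orP; left; apply/eqP; field; rewrite gt_eqF.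
Qed.

Lemma kernel_average :
  `|\sum_(z2 : 'I_P * 'I_P) \sum_(z3 : 'I_P * 'I_P)
     \sum_(m2 : 'I_Q * 'I_Q) \sum_(m3 : 'I_Q * 'I_Q)
       Phi (diff z2 * diff m2 + diff z3 * diff m3)|
  <= P%:R ^+ 4 * Q%:R ^+ 4 *
     (M1 * (2 * w%:R / P%:R + 4 / G%:R) + M2 / T%:R + 4 * (Y%:R / Q%:R) * M1).
Proof.
have Pr : 0 < P%:R :> R by rewrite ltr0n.
have Qr : 0 < Q%:R :> R by rewrite ltr0n.
have Tr : 0 < T%:R :> R by rewrite ltr0n.
have M10 := M1_ge0; have M20 := M2_ge0.
set gd := Q%:R ^+ 2 * (Q%:R ^+ 2 * (M2 / T%:R) + 4 * Y%:R * Q%:R * M1).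
have gd0 : 0 <= gd.
  by rewrite mulr_ge0 ?exprn_ge0 // addr_ge0 ?mulr_ge0 ?exprn_ge0 ?invr_ge0.
have PhiB (z2 z3 : 'I_P * 'I_P) (m2 m3 : 'I_Q * 'I_Q) :
    `|Phi (diff z2 * diff m2 + diff z3 * diff m3)| <= M1.
  apply: Phi_le; have := absz_mul_le (absz_diff z2) (absz_diff m2).
  have := absz_mul_le (absz_diff z3) (absz_diff m3); lia.
apply: le_trans (_ : \sum_(z2 : 'I_P * 'I_P) \sum_(z3 : 'I_P * 'I_P)
   (gd + Q%:R ^+ 4 * M1 * (bad_pair w G z2 z3)%:R) <= _).
  apply: le_trans (ler_norm_sum _ _ _) _; apply: ler_sum => z2 _.
  apply: le_trans (ler_norm_sum _ _ _) _; apply: ler_sum => z3 _.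
  have [bad|] := boolP (bad_pair w G z2 z3).
    apply: le_trans (_ : Q%:R ^+ 4 * M1 <= _); last by rewrite mulr1 lerDr.
    apply: le_trans (_ : \sum_(m2 : 'I_Q * 'I_Q) \sum_(m3 : 'I_Q * 'I_Q) M1 <= _).
      apply: le_trans (ler_norm_sum _ _ _) _; apply: ler_sum => m2 _.
      by apply: le_trans (ler_norm_sum _ _ _) _; apply: ler_sum => m3 _.
    rewrite !sumr_const card_prod card_ord -mulrnA -[leLHS]mulr_natl !natrM.
    by rewrite le_eqVlt; apply/orP; left; apply/eqP; ring.
  rewrite /bad_pair negb_or -!leqNgt => /andP[wz gG].
  rewrite mulr0 addr0.
  (* The subtracted ends [m2'] and [m3'] of the two differences are frozen and become part of the
     constant [y] of [good_pair_bound]. *)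
  have -> : \sum_(m2 : 'I_Q * 'I_Q) \sum_(m3 : 'I_Q * 'I_Q)
       Phi (diff z2 * diff m2 + diff z3 * diff m3) =
     \sum_(m2' < Q) \sum_(m3' < Q) \sum_(m2 < Q) \sum_(m3 < Q)
       Phi ((- (diff z2 * (m2' : nat)%:Z) - diff z3 * (m3' : nat)%:Z)
             + diff z2 * (m2 : nat)%:Z + diff z3 * (m3 : nat)%:Z).
    rewrite sum_pair exchange_big /=; apply: eq_bigr => m2' _.
    under eq_bigr do rewrite sum_pair exchange_big /=.
    rewrite exchange_big /=; apply: eq_bigr => m3' _.
    apply: eq_bigr => m2 _; apply: eq_bigr => m3 _; rewrite /diff /=.
    congr Phi; ring.
  apply: le_trans (_ : \sum_(m2' < Q) \sum_(m3' < Q)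
     (Q%:R ^+ 2 * (M2 / T%:R) + 4 * Y%:R * Q%:R * M1) <= _).
    apply: le_trans (ler_norm_sum _ _ _) _; apply: ler_sum => m2' _.
    apply: le_trans (ler_norm_sum _ _ _) _; apply: ler_sum => m3' _.
    apply: good_pair_bound => //; try exact: absz_diff.
    have := @absz_mul_le _ (m2' : nat)%:Z _ _ (absz_diff z2) (ltnW (ltn_ord m2')).
    have := @absz_mul_le _ (m3' : nat)%:Z _ _ (absz_diff z3) (ltnW (ltn_ord m3')).
    lia.
  by rewrite !sumr_const card_ord -mulrnA -[leLHS]mulr_natl natrM.
under eq_bigr do rewrite big_split /= sumr_const -mulr_sumr card_prod card_ord.
rewrite big_split /= sumr_const -mulr_sumr card_prod card_ord.
rewrite -mulrnA -[gd *+ _]mulr_natl.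
have := sum_bad_pair w_gt0 G_gt0 P_gt0; set bd := \sum_(z2 : 'I_P * 'I_P) _ => bd_le.
have c0 : 0 <= Q%:R ^+ 4 * M1 by rewrite mulr_ge0 ?exprn_ge0.
apply: le_trans (lerD (lexx _) (ler_wpM2l c0 bd_le)) _.
rewrite !natrM /gd le_eqVlt; apply/orP; left; apply/eqP.
by field; rewrite !gt_eqF // ltr0n.
Qed.

End Average.

End KernelAverage.

(** * The fourfold correlation, bounded from below and from above *)

Section FourfoldCorrelation.

Variables (R : realFieldType) (V : finZmodType) (e : V) (H : nat).
Variables (nu o : V -> R) (K am cm : nat) (eta : R).
Hypothesis pr : pseudorandom e H nu o K am cm eta.
Variables (p : V -> R) (M eps : R).
Hypothesis p_nu : forall x, `|p x| <= nu x.
Hypothesis nu_M : forall x, nu x <= M.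
Hypothesis M_ge1 : 1 <= M.
Hypothesis eps_ge0 : 0 <= eps.
Hypothesis eta_eps : 128 * eta <= eps ^+ 4.
Variable A : nat.
Hypothesis A_gt0 : (0 < A)%N.
Hypothesis A_cm : (A <= cm)%N.

Let nu_ge0 := pr_nu_ge0 pr.
Let H_gt0 := pr_H_gt0 pr.

Local Notation n := (mass o).
Local Notation hr := (H%:R : R).
Local Notation ar := (A%:R : R).
Local Notation "x ++> z" := (x + e *~ z) (at level 50).
Local Notation D := (dilates H A).
Local Notation corr_p := (corr e p).
Local Notation loss := (loss M eps A).

Lemma corr_reindex (W W' : finType) (f : W' -> W) (s : W -> int) :
  bijective f -> corr_p s = corr_p (s \o f).
Proof. by move=> [g fK gK]; rewrite /corr_p (reindex f) //=; exists g => w _. Qed.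

Definition fourfold_step (z : (D * D) * (D * D)) : int :=
  (dilate z.2.2 - dilate z.2.1) - (dilate z.1.2 - dilate z.1.1).

(** Three squarings: [first_corr], then [corr_step] with [U = unit], then [corr_step] with [U] the
    subtracted dilate. *)
Lemma corr4_lower (rho : R) :
  let r1 := rho / 2 - loss in let r2 := r1 ^+ 2 / 2 - loss in
  0 <= r1 -> 0 <= r2 -> 0 < n -> (4 * (A * H) <= am)%N ->
  rho * (ar ^+ 2 * n ^+ 2 * hr ^+ 2) <=
    \sum_(b < A) \sum_(b' < A) self_corr e H p ((b : nat)%:Z - (b' : nat)%:Z) ^+ 2 ->
  (r2 ^+ 2 / 2 - loss) * (n * (ar ^+ 2 * hr ^+ 2) ^+ 4) <= corr_p fourfold_step.
Proof.
move=> r1 r2 r1_ge0 r2_ge0 n_gt0 AHam rhoV.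
have c1 : r1 * (n * (ar ^+ 2 * hr ^+ 2)) <= corr_p (@dilate H A).
  have := first_corr pr p_nu nu_M M_ge1 eps_ge0 eta_eps A_gt0 A_cm _ rhoV.
  rewrite (_ : ar ^+ 2 * n * hr ^+ 2 = n * (ar ^+ 2 * hr ^+ 2)); last by ring.
  by apply; lia.
have step := corr_step pr p_nu nu_M M_ge1 eps_ge0 eta_eps A_gt0 A_cm.
have c2 : r2 * (n * (ar ^+ 2 * hr ^+ 2) ^+ 2) <=
    corr_p (fun z : D * D => dilate z.2 - dilate z.1).
  pose s (z : unit * D) := dilate z.2.
  have := @step unit (fun=> 0) 0%N s r1 _ _ _ n_gt0 r1_ge0.
  rewrite card_unit mul1r => /(_ _ _ _ _)/le_trans; apply.
  - by move=> z; rewrite add0r.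
  - by [].
  - lia.
  - apply: le_trans c1 _; rewrite (@corr_reindex _ _ (fun d : D => (tt, d)) s) //.
    by exists snd => // -[[]].
  rewrite (@corr_reindex _ _ (fun z : D * D => ((tt, z.1), (tt, z.2)))) //.
  by exists (fun z => (z.1.2, z.2.2)) => [[]|[[[] ?] [[] ?]]].
have := @step D (fun d => - dilate d) (A * H)%N (fun z => dilate z.2 - dilate z.1) r2 _ _ _ n_gt0 r2_ge0.
have -> : #|{: D}|%:R * ar ^+ 2 * hr ^+ 2 = (ar ^+ 2 * hr ^+ 2) ^+ 2.
  by rewrite !card_prod !card_ord !natrM; ring.
rewrite -exprM; apply.
- by move=> z; rewrite addrC.
- by move=> u; rewrite abszN absz_dilate.
- lia.
exact: c2.
Qed.

Lemma sum_dilates (F : int -> R) :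
  \sum_(d : D) F (dilate d) =
  \sum_(z : 'I_A * 'I_A) \sum_(m : 'I_H * 'I_H) F (diff z * diff m).
Proof.
rewrite !sum_pair; apply: eq_bigr => b _; apply: eq_bigr => b' _.
by rewrite !sum_pair exchange_big.
Qed.

(** The two dilates that [fourfold_step] subtracts are summed inside; the sum of the two added ones
    is the argument [y], to be averaged by [kernel_average]. *)
Definition slice (y : int) : R :=
  \sum_(a : D) \sum_(a' : D) \sum_x p x * p (x ++> (y - dilate a' - dilate a)).

Lemma corr4_slice :
  corr_p fourfold_step = \sum_(d : D) \sum_(d' : D) slice (dilate d + dilate d').
Proof.
rewrite /corr sum_pair sum_pair; apply: eq_bigr => d _.
rewrite /slice; under [RHS]eq_bigr do rewrite exchange_big /=.
rewrite [RHS]exchange_big /=; apply: eq_bigr => a _.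
rewrite sum_pair exchange_big /=; apply: eq_bigr => d' _; apply: eq_bigr => a' _.
apply: eq_bigr => x _; rewrite /fourfold_step /=; congr (_ * p (_ ++> _)); ring.
Qed.

(** The inner sum over [a'] separates the two values of [nu], so the linear forms condition gives a
    bound free of [M]. Zero steps cost a factor [M], offset by their density [1/A] and [M <= A]. The
    constant terms reach $(8+1)AH$. *)
Lemma slice_le (y : int) :
  (absz y <= 8 * (A * H))%N -> (9 * (A * H) <= am)%N -> M <= ar ->
  `|slice y| <= 4 * n * (ar ^+ 4 * hr ^+ 4).
Proof.
move=> yAH amAH MA; have n0 := mass_ge0 pr.
have H0 : 0 <= hr := ler0n _ _; have M0 : 0 <= M := le_trans ler01 M_ge1.
have row (z : 'I_A * 'I_A) (a : D) :
   \sum_(m : 'I_H * 'I_H) \sum_x nu x * nu (x ++> (y - diff z * diff m - dilate a))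
     <= 2 * n * hr ^+ 2 * (1 + M * (diff z == 0)%:R).
  have [dz|dz] := eqVneq (diff z) 0.
    apply: le_trans (_ : \sum_(m : 'I_H * 'I_H) 2 * n * M <= _); last first.
      rewrite sumr_const card_prod card_ord -[leLHS]mulr_natl natrM mulr1.
      have : 0 <= n * hr ^+ 2 by rewrite mulr_ge0 ?exprn_ge0.
      lra.
    apply: ler_sum => m _; apply: le_trans (_ : \sum_x nu x * M <= _).
      by apply: ler_sum => x _; rewrite ler_wpM2l.
    by rewrite -mulr_suml ler_wpM2r // (sum_nu pr).
  rewrite mulr0 addr0 mulr1.
  have h := @sum_nu_nu _ _ e H nu o K am cm eta pr 0 0 0 (y - dilate a) (- diff z) (diff z).
  have h1 : (absz (y - dilate a)%R <= am)%N.
    by have := absz_dilate a; move: (dilate a) yAH amAH => v; clear; lia.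
  have h2 : (absz (diff z) <= cm)%N := leq_trans (absz_diff z) A_cm.
  have h3 : (0, 0) != (- diff z, diff z) :> (int * int)%type.
    by rewrite xpair_eqE eq_sym oppr_eq0 (negbTE dz).
  apply: le_trans (h (leq0n _) (leq0n _) (leq0n _) h1 _ h2 h3); last by rewrite abszN.
  rewrite sum_pair le_eqVlt; apply/orP; left; apply/eqP.
  apply: eq_bigr => i _; apply: eq_bigr => j _; apply: eq_bigr => x _.
  rewrite !mul0r !addr0; congr (_ * nu (_ ++> _)); rewrite /diff /=; ring.
have total (a : D) : \sum_(a' : D) \sum_x nu x * nu (x ++> (y - dilate a' - dilate a)) <=
   2 * n * hr ^+ 2 * (2 * ar ^+ 2).
  rewrite (sum_dilates (fun v => \sum_x nu x * nu (x ++> (y - v - dilate a)))).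
  apply: le_trans (ler_sum _ (fun z _ => row z a)) _.
  rewrite -mulr_sumr ler_wpM2l ?mulr_ge0 ?exprn_ge0 //.
  rewrite big_split /= sumr_const card_prod card_ord -mulr_sumr.
  have -> : \sum_(z : 'I_A * 'I_A) (diff z == 0)%:R = ar.
    rewrite sum_pair; transitivity (\sum_(b < A) 1 : R); last by rewrite sumr_const card_ord.
    apply: eq_bigr => b _; rewrite (bigD1 b) //= /diff subrr eqxx big1 ?addr0 // => j jb.
    by rewrite /= subr_eq0 eqz_nat eq_sym (negbTE (jb : (j : nat) != b)).
  have : M * ar <= ar * ar by rewrite ler_wpM2r.
  rewrite natrM; lra.
apply: le_trans (ler_norm_sum _ _ _) _.
apply: le_trans (_ : \sum_(a : D) (2 * n * hr ^+ 2 * (2 * ar ^+ 2)) <= _); last first.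
  rewrite sumr_const !card_prod !card_ord -[leLHS]mulr_natl !natrM.
  by rewrite le_eqVlt; apply/orP; left; apply/eqP; ring.
apply: ler_sum => a _; apply: le_trans (total a).
apply: le_trans (ler_norm_sum _ _ _) _; apply: ler_sum => a' _.
apply: le_trans (ler_norm_sum _ _ _) _; apply: ler_sum => x _.
by rewrite normrM ler_pM.
Qed.

Lemma slice_sum_le (T g : nat) (tau : R) (y : int) :
  (forall x, `|\sum_(t < T) p (x ++> g%:Z * (t : nat)%:Z)| <= tau) ->
  `|\sum_(t < T) slice (y + g%:Z * (t : nat)%:Z)| <= 2 * n * tau * (ar ^+ 4 * hr ^+ 4).
Proof.
move=> p_tau.
have tau0 : 0 <= tau by apply: le_trans (p_tau 0).
rewrite /slice exchange_big /=; under eq_bigr do rewrite exchange_big /=.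
apply: le_trans (_ : \sum_(a : D) \sum_(a' : D) 2 * n * tau <= _); last first.
  rewrite !sumr_const !card_prod !card_ord -mulrnA -[leLHS]mulr_natl !natrM.
  by rewrite le_eqVlt; apply/orP; left; apply/eqP; ring.
apply: le_trans (ler_norm_sum _ _ _) _; apply: ler_sum => a _.
apply: le_trans (ler_norm_sum _ _ _) _; apply: ler_sum => a' _.
rewrite exchange_big /=; apply: le_trans (ler_norm_sum _ _ _) _.
apply: le_trans (_ : \sum_x nu x * tau <= _); last first.
  by rewrite -mulr_suml ler_wpM2r // (sum_nu pr).
apply: ler_sum => x _; rewrite -mulr_sumr normrM ler_pM //.
have := p_tau (x ++> (y - dilate a' - dilate a)).
by congr (_ <= _); congr Num.norm; apply: eq_bigr => t _; congr p; rewrite -addrA -mulrzDr; congr (_ + e *~ _); ring.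
Qed.

(** A dilate is a product of a difference below [A] and one below [H], so either factor may serve as
    the step: [P] is the range of the steps, [Q] that of the multipliers. *)
Lemma corr4_upper (P Q Y T G w : nat) (tau : R) :
  (P = A /\ Q = H) \/ (P = H /\ Q = A) ->
  (forall (x : V) (g : nat), (0 < g <= G)%N ->
     `|\sum_(t < T) p (x ++> g%:Z * (t : nat)%:Z)| <= tau) ->
  (0 < w)%N -> (0 < T)%N -> (0 < G)%N -> (P <= Y <= Q)%N ->
  (G * T <= w * (Y - P))%N -> (9 * (A * H) <= am)%N -> M <= ar ->
  corr_p fourfold_step <= n * (ar ^+ 2 * hr ^+ 2) ^+ 4 *
   (4 * (2 * w%:R / P%:R + 4 / G%:R) + 2 * tau / T%:R + 16 * (Y%:R / Q%:R)).
Proof.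
move=> PQ p_tau w0 T0 G0 /andP[PY YQ] GT amAH MA.
have n0 := mass_ge0 pr.
have PQA : (P * Q = A * H)%N by case: PQ => -[-> ->] //; rewrite mulnC.
have P0 : (0 < P)%N by case: PQ => -[-> _]; rewrite ?A_gt0 ?H_gt0.
have Q0 : (0 < Q)%N by case: PQ => -[_ ->]; rewrite ?A_gt0 ?H_gt0.
have tau0 : 0 <= tau by apply: le_trans (p_tau 0 1%N _).
have AH0 : 0 <= ar ^+ 4 * hr ^+ 4 by rewrite mulr_ge0 ?exprn_ge0.
have k1 : 0 <= 4 * n * (ar ^+ 4 * hr ^+ 4) by rewrite mulr_ge0 ?mulr_ge0.
have k2 : 0 <= 2 * n * tau * (ar ^+ 4 * hr ^+ 4) by rewrite mulr_ge0 ?mulr_ge0.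
have := @kernel_average R slice P Q Y T G w _ _ k1 k2 _ _ w0 T0 P0 Q0 G0 PY YQ GT.
move=> /(_ _ _)/(le_trans (ler_norm _)) kern.
have -> : corr_p fourfold_step = \sum_(z2 : 'I_P * 'I_P) \sum_(z3 : 'I_P * 'I_P)
     \sum_(m2 : 'I_Q * 'I_Q) \sum_(m3 : 'I_Q * 'I_Q)
       slice (diff z2 * diff m2 + diff z3 * diff m3).
  rewrite corr4_slice.
  under eq_bigr => d _ do rewrite (sum_dilates (fun v => slice (dilate d + v))).
  rewrite (sum_dilates (fun v => \sum_(z : 'I_A * 'I_A) \sum_(m : 'I_H * 'I_H)
     slice (v + diff z * diff m))).
  case: PQ => -[-> ->].
    by apply: eq_bigr => z _; rewrite exchange_big.
  rewrite exchange_big /=; apply: eq_bigr => z2 _.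
  under eq_bigr do rewrite exchange_big /=.
  rewrite exchange_big /=; apply: eq_bigr => z3 _.
  apply: eq_bigr => m2 _; apply: eq_bigr => m3 _.
  by rewrite [diff z2 * _]mulrC [diff z3 * _]mulrC.
apply: le_trans (kern _ _) _.
- by move=> y; rewrite PQA => yAH; apply: slice_le.
- by move=> y g gG; apply: slice_sum_le => x; apply: p_tau.
have -> : P%:R ^+ 4 * Q%:R ^+ 4 = ar ^+ 4 * hr ^+ 4.
  by rewrite -!exprMn -!natrM PQA.
rewrite le_eqVlt; apply/orP; left; apply/eqP; ring.
Qed.

End FourfoldCorrelation.

(** * Products of weights at several points $x+cm$ with common [x] and [m] *)

Section LinesThroughPoints.

Variables (R : realFieldType) (V : finZmodType) (e : V) (H : nat).
Variables (nu o : V -> R) (K am cm : nat) (eta : R).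
Hypothesis pr : pseudorandom e H nu o K am cm eta.
Variable M : R.
Hypothesis nu_M : forall x, nu x <= M.
Hypothesis M_ge1 : 1 <= M.

Let nu_ge0 := pr_nu_ge0 pr.
Let o_ge0 := pr_o_ge0 pr.
Let o_le1 := pr_o_le1 pr.
Let H_gt0 := pr_H_gt0 pr.

Local Notation n := (mass o).
Local Notation hr := (H%:R : R).
Local Notation "x ++> z" := (x + e *~ z) (at level 50).
Local Notation Z := ('I_H * V)%type.

Definition on_line (c : int) (z : Z) : V := z.2 ++> c * (z.1 : nat).+1%:Z.

Definition line_sum (W : bool -> V -> R) (cs : seq (bool * int)) : R :=
  \sum_(z : Z) \prod_(f <- cs) W f.1 (on_line f.2 z).

(** Since [m] starts at 0, [c (m+1)] is the form with constant term and first coefficient both [c];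
    hence [c] must be small against both [cm] and [am] below. The three idle parameters give
    [hr ^+ 3]. *)
Lemma lf_sum_line (W : bool -> V -> R) (cs : seq (bool * int)) :
  lf_sum e H W [seq (f.1, (f.2, (f.2, 0, 0, 0))) | f <- cs] = hr ^+ 3 * line_sum W cs.
Proof.
rewrite /lf_sum /line_sum sum_quad [in RHS]sum_pair mulr_sumr; apply: eq_bigr => m _.
rewrite (_ : _ * _ = \sum_(h2 < H) \sum_(h3 < H) \sum_(h4 < H)
  \sum_x \prod_(f <- cs) W f.1 (on_line f.2 (m, x))); last first.
  by rewrite !sumr_const !card_ord -!mulrnA -[RHS]mulr_natl !natrM; congr (_ * _); ring.
apply: eq_bigr => h2 _; apply: eq_bigr => h3 _; apply: eq_bigr => h4 _; apply: eq_bigr => x _.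
rewrite /lf_prod big_map; apply: eq_bigr => f _; rewrite /on_line /form_value /=.
by rewrite !mul0r !addr0 intS mulrDr mulr1.
Qed.

Lemma line_bound (cs : seq (bool * int)) :
  (0 < size cs <= K)%N ->
  all (fun c : int => (absz c <= cm)%N && (absz c <= am)%N) (map snd cs) ->
  uniq (map snd cs) ->
  `|line_sum (weight nu o) cs - line_sum (fun=> o) cs| <= eta * n * hr.
Proof.
move=> scs acs ucs.
have := pr_linear_forms pr (l := [seq (f.1, (f.2, (f.2, 0, 0, 0))) | f <- cs]).
rewrite size_map scs !lf_sum_line -mulrBr normrM ger0_norm ?exprn_ge0 // => /(_ isT).
have -> : eta * n * hr ^+ 4 = hr ^+ 3 * (eta * n * hr) by ring.
rewrite ler_pM2l ?exprn_gt0 ?ltr0n //; apply.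
  rewrite all_map in acs; rewrite -map_comp all_map; apply: sub_all acs => c /=.
  by move=> /andP[h1 h2]; rewrite /small_form /= h1 h2.
rewrite -!map_comp (eq_map (g := (fun c => (c, 0, 0, 0)) \o snd)) // map_comp.
by rewrite map_inj_uniq // => c c' [].
Qed.

Lemma line_sum_o_le (cs : seq (bool * int)) :
  (0 < size cs)%N -> line_sum (fun=> o) cs <= n * hr.
Proof.
move=> scs; have := lf_sum_o_le pr (l := [seq (f.1, (f.2, (f.2, 0, 0, 0))) | f <- cs]).
rewrite size_map lf_sum_line => /(_ scs).
have -> : n * hr ^+ 4 = hr ^+ 3 * (n * hr) by ring.
by rewrite ler_pM2l ?exprn_gt0 ?ltr0n.
Qed.

Lemma line_sum_le (cs : seq (bool * int)) :
  (0 < size cs <= K)%N ->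
  all (fun c : int => (absz c <= cm)%N && (absz c <= am)%N) (map snd cs) ->
  uniq (map snd cs) -> line_sum (weight nu o) cs <= 2 * n * hr.
Proof.
move=> scs acs ucs; have := line_bound scs acs ucs.
have := line_sum_o_le (proj1 (andP scs)).
have e1 := pr_eta_le1 pr; have n0 : 0 <= n * hr by rewrite mulr_ge0 ?(mass_ge0 pr).
rewrite ler_norml -mulrA => h1 /andP[_ h2].
have : eta * (n * hr) <= n * hr by rewrite ler_piMl.
lra.
Qed.

Lemma weight_ge0 b x : 0 <= weight nu o b x.
Proof. by case: b => /=. Qed.

Lemma weight_le b x : weight nu o b x <= M.
Proof. by case: b => /=; [exact: nu_M | exact: le_trans (o_le1 x) M_ge1]. Qed.

Lemma sum_weight_le b : \sum_x weight nu o b x <= 2 * n.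
Proof.
case: b => /=; first exact: sum_nu pr.
have := mass_ge0 pr; rewrite /mass; lra.
Qed.

Lemma line_sum_ge0 (cs : seq (bool * int)) : 0 <= line_sum (weight nu o) cs.
Proof. by apply: sumr_ge0 => z _; apply: prodr_ge0 => f _; exact: weight_ge0. Qed.

(** The substitute when coefficients coincide: one factor is summed over the group, the others are
    bounded by [M], and a spare factor [M] makes the exponent the number of points. *)
Lemma line_sum_trivial (cs : seq (bool * int)) :
  (0 < size cs)%N -> line_sum (weight nu o) cs <= M ^+ size cs * (2 * n * hr).
Proof.
case: cs => // f cs _.
have M0 : 0 <= M := le_trans ler01 M_ge1.
apply: le_trans (_ : \sum_(z : Z) M ^+ size cs * weight nu o f.1 (on_line f.2 z) <= _).
  apply: ler_sum => z _; rewrite big_cons mulrC ler_wpM2r ?weight_ge0 //.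
  apply: le_trans (_ : \prod_(g <- cs) M <= _).
    by apply: ler_prod => g _; rewrite weight_ge0 weight_le.
  by rewrite big_const_seq count_predT iter_mulr_1.
rewrite -mulr_sumr; apply: ler_pM => //; rewrite ?exprn_ge0 //.
- by apply: sumr_ge0 => z _; exact: weight_ge0.
- by rewrite /= exprS ler_peMl ?exprn_ge0.
rewrite sum_pair; apply: le_trans (_ : \sum_(m < H) 2 * n <= _).
  apply: ler_sum => m _; rewrite /on_line /= sum_shift; exact: sum_weight_le.
by rewrite sumr_const card_ord -[leLHS]mulr_natr.
Qed.

End LinesThroughPoints.

(** * Resampling one coordinate of [b], and counting coincidences *)

Section Updates.

Variables (R : realFieldType) (k A : nat).
Local Notation F := {ffun 'I_k -> 'I_A}.

Definition update (j : 'I_k) (b : F) (t : 'I_A) : F :=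
  [ffun l => if l == j then t else b l].

Lemma update_self j b : update j b (b j) = b.
Proof. by apply/ffunP => l; rewrite ffunE; case: eqP => [->|]. Qed.

Lemma update_update j b t t' : update j (update j b t) t' = update j b t'.
Proof. by apply/ffunP => l; rewrite !ffunE; case: eqP. Qed.

Lemma update_at j b t : update j b t j = t.
Proof. by rewrite ffunE eqxx. Qed.

(** The map exchanging the coordinate [b j] with the extra variable [t] is injective on pairs
    [(b, t)], hence permutes them. *)
Lemma sum_update_mulrn (S : nmodType) j (g : F -> S) :
  \sum_b \sum_t g (update j b t) = (\sum_b g b) *+ A.
Proof.
transitivity (\sum_(z : F * 'I_A) g (update j z.1 z.2)); first by rewrite sum_pair.
rewrite (reindex_inj (h := fun z : F * 'I_A => (update j z.1 z.2, z.1 j))); last first.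
  move=> [b t] [b' t'] /= [bb' bj]; congr (_, _).
    by rewrite -[b](update_self j) -[b'](update_self j) bj
       -(update_update j b t) bb' update_update.
  by rewrite -(update_at j b t) bb' update_at.
rewrite sum_pair /=; under eq_bigr do under eq_bigr do rewrite update_update update_self.
under eq_bigr do rewrite sumr_const card_ord.
by rewrite -sumrMnl.
Qed.

Lemma sum_update j (g : F -> R) : \sum_b \sum_t g (update j b t) = A%:R * \sum_b g b.
Proof. by rewrite sum_update_mulrn -[LHS]mulr_natl. Qed.

(** If an expression ignores the coordinate [j] of [b], the extra variable [t] can be stored there.
    In [sum_excess_product] this completes [k - 1] coordinates into a full vector. *)
Lemma sum_dummy (j : 'I_k) (g : 'I_A -> F -> R) :
  (forall t b t', g t (update j b t') = g t b) ->
  \sum_t \sum_b g t b = A%:R * \sum_(b : F) g (b j) b.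
Proof.
move=> gu; rewrite -(sum_update j) exchange_big /=.
apply: eq_bigr => b _; apply: eq_bigr => t _.
by rewrite update_at gu.
Qed.

Local Notation N0 := (#|{: F}|%:R : R).

Lemma sum_collision (j j' : 'I_k) : j != j' ->
  A%:R * \sum_(b : F) (b j == b j')%:R = N0.
Proof.
move=> jj'; rewrite -(sum_update j) -sum1_card natr_sum; apply: eq_bigr => b _.
rewrite (bigD1 (b j')) //= big1 ?addr0.
  by rewrite update_at ffunE [j' == j]eq_sym (negbTE jj') eqxx.
by move=> t tb; rewrite update_at ffunE [j' == j]eq_sym (negbTE jj') (negbTE tb).
Qed.

Lemma sum_collision2 (j j' : 'I_k) :
  A%:R * \sum_(b : F) \sum_(b' : F) (b j == b' j')%:R = N0 ^+ 2.
Proof.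
rewrite exchange_big mulr_sumr /=; transitivity (\sum_(b' : F) N0); last first.
  by rewrite sumr_const -[LHS]mulr_natl expr2.
apply: eq_bigr => b' _; rewrite -(sum_update j) -sum1_card natr_sum; apply: eq_bigr => b _.
rewrite (bigD1 (b' j')) //= big1 ?addr0 ?update_at ?eqxx // => t tb.
by rewrite update_at (negbTE tb).
Qed.

(** Union bound over pairs of distinct indices, each coincidence having density [1/A]. *)
Lemma sum_noninjective (B : F -> bool) :
  (forall b, B b -> [exists j, [exists j', (j != j') && (b j == b j')]]) ->
  A%:R * \sum_b (B b)%:R <= k%:R ^+ 2 * N0.
Proof.
move=> BP; apply: le_trans (_ : A%:R * \sum_(b : F) \sum_(j < k) \sum_(j' < k | j != j') (b j == b j')%:R <= _).
  rewrite ler_wpM2l //; apply: ler_sum => b _.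
  have s0 j : 0 <= \sum_(j' < k | j != j') (b j == b j')%:R :> R by apply: sumr_ge0.
  have [/BP/existsP[j /existsP[j' /andP[jj' bb]]]|_] := boolP (B b); last exact: sumr_ge0.
  rewrite (bigD1 j) //= (bigD1 j') //= bb -addrA lerDl addr_ge0 ?sumr_ge0 //.
rewrite exchange_big mulr_sumr /=.
apply: le_trans (_ : \sum_(j < k) (k%:R * N0) <= _); last first.
  by rewrite sumr_const card_ord -[leLHS]mulr_natl mulrA expr2.
apply: ler_sum => j _; rewrite exchange_big mulr_sumr /=.
under eq_bigr => j' jj' do rewrite sum_collision //.
rewrite sumr_const -[leLHS]mulr_natl ler_wpM2r // ler_nat.
by apply: leq_trans (max_card _) _; rewrite card_ord.
Qed.

Lemma sum_noninjective2 (B : F -> F -> bool) :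
  (forall b b', B b b' -> [exists j, [exists j', (j != j') && (b j == b j')]]
    || [exists j, [exists j', (j != j') && (b' j == b' j')]]
    || [exists j, [exists j', b j == b' j']]) ->
  A%:R * \sum_b \sum_b' (B b b')%:R <= 3 * k%:R ^+ 2 * N0 ^+ 2.
Proof.
move=> BP.
pose C (b : F) : bool := [exists j, [exists j', (j != j') && (b j == b j' :> 'I_A)]].
have Cle := @sum_noninjective C (fun b h => h).
apply: le_trans (_ : A%:R * (\sum_(b : F) \sum_(b' : F) (C b)%:R + \sum_(b : F) \sum_(b' : F) (C b')%:R
   + \sum_(b : F) \sum_(b' : F) \sum_(j < k) \sum_(j' < k) (b j == b' j')%:R) <= _).
  rewrite ler_wpM2l // -!big_split /=; apply: ler_sum => b _.
  rewrite -!big_split /=; apply: ler_sum => b' _.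
  have s0 j : 0 <= \sum_(j' < k) (b j == b' j')%:R :> R by apply: sumr_ge0.
  have s1 : 0 <= \sum_(j < k) \sum_(j' < k) (b j == b' j')%:R :> R by apply: sumr_ge0.
  have c0 : 0 <= (C b)%:R :> R by []. have c1 : 0 <= (C b')%:R :> R by [].
  have [/BP|_] := boolP (B b b'); last by rewrite !addr_ge0.
  rewrite -/(C b) -/(C b') => /orP[/orP[->|->]|/existsP[j /existsP[j' bb]]].
  - by rewrite -addrA lerDl addr_ge0.
  - by rewrite addrAC lerDr addr_ge0.
  - rewrite -[leLHS]add0r lerD ?addr_ge0 // (bigD1 j) //= (bigD1 j') //= bb.
    by rewrite -addrA lerDl addr_ge0 ?sumr_ge0.
have -> : \sum_(b : F) \sum_(b' : F) (C b)%:R = N0 * \sum_b (C b)%:R.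
  by rewrite mulr_sumr; apply: eq_bigr => b _; rewrite sumr_const -[LHS]mulr_natl.
have -> : \sum_(b : F) \sum_(b' : F) (C b')%:R = N0 * \sum_b (C b)%:R.
  by rewrite sumr_const -[LHS]mulr_natl.
have -> : \sum_(b : F) \sum_(b' : F) \sum_(j < k) \sum_(j' < k) (b j == b' j')%:R =
   \sum_(j < k) \sum_(j' < k) \sum_(b : F) \sum_(b' : F) (b j == b' j')%:R :> R.
  under eq_bigr do rewrite exchange_big /=.
  rewrite exchange_big /=; apply: eq_bigr => j _.
  under eq_bigr do rewrite exchange_big /=.
  by rewrite exchange_big.
rewrite mulrDr [X in _ + X <= _]mulr_sumr.
have -> : \sum_(j < k) A%:R * \sum_(j' < k) \sum_(b : F) \sum_(b' : F) (b j == b' j')%:R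
    = k%:R ^+ 2 * N0 ^+ 2.
  under eq_bigr do rewrite mulr_sumr.
  under eq_bigr do under eq_bigr do rewrite sum_collision2.
  by rewrite !sumr_const card_ord -mulrnA -[LHS]mulr_natl natrM expr2.
have N00 : 0 <= N0 := ler0n _ _.
have := ler_wpM2l N00 Cle; rewrite mulrDr !(mulrCA A%:R) => h.
have -> : 3 * k%:R ^+ 2 * N0 ^+ 2 = N0 * (k%:R ^+ 2 * N0) + N0 * (k%:R ^+ 2 * N0) + k%:R ^+ 2 * N0 ^+ 2 by ring.
by rewrite lerD2r lerD.
Qed.

End Updates.

(** * Squared entries of weighted Gram matrices *)

Section GramMatrix.

Variables (R : realFieldType) (T Z : finType) (q : T -> Z -> R).

Lemma gram_weighted (w : Z -> R) :
  \sum_t \sum_t' (\sum_z w z * (q t z * q t' z)) ^+ 2 =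
  \sum_z \sum_z' w z * w z' * (\sum_t q t z * q t z') ^+ 2.
Proof.
transitivity (\sum_t \sum_t' \sum_z \sum_z' w z * w z' * ((q t z * q t z') * (q t' z * q t' z'))).
  apply: eq_bigr => t _; apply: eq_bigr => t' _; rewrite sqr_sum.
  by apply: eq_bigr => z _; apply: eq_bigr => z' _; ring.
under eq_bigr do rewrite exchange_big /=.
rewrite exchange_big /=; apply: eq_bigr => z _.
under eq_bigr do rewrite exchange_big /=.
rewrite exchange_big /=; apply: eq_bigr => z' _.
rewrite sqr_sum mulr_sumr; apply: eq_bigr => t _.
by rewrite mulr_sumr.
Qed.

(** By [gram_weighted] the left side is a combination of squares with coefficients [w z * w z'], so
    raising the weights to 1 increases every term, whatever the signs of [q]. *)
Lemma gram_weight_le (w : Z -> R) : (forall z, 0 <= w z <= 1) ->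
  \sum_t \sum_t' (\sum_z w z * (q t z * q t' z)) ^+ 2 <=
  \sum_t \sum_t' (\sum_z q t z * q t' z) ^+ 2.
Proof.
move=> w01; have := gram_weighted (fun=> 1).
under [X in X = _]eq_bigr do under eq_bigr do under eq_bigr do rewrite mul1r.
move=> ->; rewrite gram_weighted; apply: ler_sum => z _; apply: ler_sum => z' _.
have /andP[w0 w1] := w01 z; have /andP[w0' w1'] := w01 z'.
by rewrite ler_wpM2r ?sqr_ge0 // mulr1 mulr_ile1.
Qed.

End GramMatrix.

(** * Removing [lambda] and the functions other than the [i]-th *)

Section FirstStage.

Variables (R : realFieldType) (V : finZmodType) (e : V) (H : nat).
Variables (nu o : V -> R) (K am cm : nat) (eta : R).
Hypothesis pr : pseudorandom e H nu o K am cm eta.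
Variables (p : V -> R) (M : R).
Hypothesis p_nu : forall x, `|p x| <= nu x.
Hypothesis nu_M : forall x, nu x <= M.
Hypothesis M_ge1 : 1 <= M.
Variables (k A c0 : nat) (i : 'I_k).
Local Notation F := {ffun 'I_k -> 'I_A}.
Variable lam : F -> R.
Hypothesis lam_le1 : forall b, `|lam b| <= 1.
Hypothesis k_gt1 : (1 < k)%N.
Hypothesis kK : (2 * k <= K)%N.
Hypothesis A_cm : (A + c0 <= cm)%N.
Hypothesis A_am : (A + c0 <= am)%N.
Hypothesis A_large : 2 * k%:R ^+ 2 * M ^+ (2 * k) <= A%:R.

Let nu_ge0 := pr_nu_ge0 pr.
Let o_ge0 := pr_o_ge0 pr.
Let o_le1 := pr_o_le1 pr.
Let H_gt0 := pr_H_gt0 pr.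

Local Notation n := (mass o).
Local Notation hr := (H%:R : R).
Local Notation ar := (A%:R : R).
Local Notation Z := ('I_H * V)%type.
Local Notation N0 := (#|{: F}|%:R : R).
Local Notation others := (enum (predC1 i)).

(** In the application [A = 2 * c0 + 1], so the offsets fill the symmetric interval from [-c0] to
    [c0]. *)
Definition offset (t : 'I_A) : int := (t : nat)%:Z - c0%:Z.

Definition point (t : 'I_A) (z : Z) : V := on_line e (offset t) z.

Definition fiber_prod (W : V -> R) (b : F) (z : Z) : R :=
  \prod_(j | j != i) W (point (b j) z).

Definition fiber_excess (b : F) (z : Z) : R := fiber_prod nu b z - fiber_prod o b z.

Lemma fiber_prod_update W b t z : fiber_prod W (update i b t) z = fiber_prod W b z.
Proof.
by apply: eq_bigr => j ji; rewrite ffunE (negbTE ji).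
Qed.

Lemma fiber_prod_ge0 b z : 0 <= fiber_prod nu b z.
Proof. exact: prodr_ge0. Qed.

Lemma offset_inj : injective offset.
Proof. by move=> t t' /addIr [] /val_inj. Qed.

Lemma offset_small t : (absz (offset t) <= cm)%N && (absz (offset t) <= am)%N.
Proof.
rewrite /offset; have := ltn_ord t; have := A_cm; have := A_am.
move: (nat_of_ord t) => s; clear; lia.
Qed.

Lemma fiber_prodE (w : bool) b z :
  fiber_prod (weight nu o w) b z =
  \prod_(f <- [seq (w, offset (b j)) | j <- others]) weight nu o f.1 (on_line e f.2 z).
Proof. by rewrite big_map big_enum. Qed.

Lemma size_others : size others = k.-1.
Proof. by rewrite -cardE cardC1 card_ord. Qed.

Lemma M_gt0 : 0 < M. Proof. exact: lt_le_trans ltr01 M_ge1. Qed.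

Lemma mass_height_ge0 : 0 <= n * hr.
Proof. by rewrite mulr_ge0 ?(mass_ge0 pr). Qed.

Lemma A_gt0r : 0 < ar.
Proof.
apply: lt_le_trans A_large; by rewrite !mulr_gt0 ?exprn_gt0 ?M_gt0 ?ltr0n ?(ltnW k_gt1).
Qed.

(** Injective [b] give distinct coefficients and [2 n H] each. The others have density at most
    $k^2/A$ and cost $M^{2k}$, which [A_large] keeps below one half; $3=2(1+1/2)$. *)
Lemma sum_fiber_prod : \sum_b \sum_z fiber_prod nu b z <= 3 * N0 * n * hr.
Proof.
have nh := mass_height_ge0; have nh2 : 0 <= 2 * n * hr by rewrite -mulrA mulr_ge0.
have M0 := M_gt0.
have row (b : F) : \sum_z fiber_prod nu b z <=
    2 * n * hr * (1 + M ^+ (2 * k) * (~~ injectiveb b)%:R).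
  have -> : \sum_z fiber_prod nu b z =
     line_sum e H (weight nu o) [seq (true, offset (b j)) | j <- others].
    by apply: eq_bigr => z _; rewrite -fiber_prodE.
  have sz : size [seq (true, offset (b j)) | j <- others] = k.-1.
    by rewrite size_map size_others.
  have km : (0 < k.-1)%N by rewrite -subn1 subn_gt0.
  have kp : (k.-1 <= 2 * k)%N by rewrite (leq_trans (leq_pred k)) // leq_pmull.
  have [/injectiveP binj|_] := boolP (injectiveb b).
    rewrite mulr0 addr0 mulr1; apply: (line_sum_le pr).
    - by rewrite sz km (leq_trans kp kK).
    - by rewrite -map_comp all_map; apply/allP => j _; exact: offset_small.
    - by rewrite -map_comp map_inj_uniq ?enum_uniq // => j j' /offset_inj /binj.
  apply: le_trans (line_sum_trivial pr nu_M M_ge1 _) _; first by rewrite sz.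
  rewrite sz mulr1 mulrC ler_wpM2l //.
  apply: le_trans (_ : M ^+ (2 * k) <= _); last by rewrite lerDr.
  by rewrite ler_weXn2l.
apply: le_trans (ler_sum _ (fun b _ => row b)) _.
rewrite -mulr_sumr big_split /= sumr_const -mulr_sumr.
have := @sum_noninjective R k A (fun b => ~~ injectiveb b) _.
set s := \sum_b _ => sP.
have sle : ar * s <= k%:R ^+ 2 * N0.
  apply: sP => b /injectivePn [j [j' jj' bb]].
  by apply/existsP; exists j; apply/existsP; exists j'; rewrite jj' bb eqxx.
have s0 : 0 <= s by apply: sumr_ge0.
have N00 : 0 <= N0 := ler0n _ _.
have MA : M ^+ (2 * k) * s <= N0 / 2.
  have k2 : 0 < 2 * k%:R ^+ 2 :> R.
    by rewrite mulr_gt0 ?exprn_gt0 // ltr0n (ltnW k_gt1).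
  rewrite -(ler_pM2l k2) mulrA; apply: le_trans (ler_wpM2r s0 A_large) _.
  by apply: le_trans sle _; rewrite le_eqVlt; apply/orP; left; apply/eqP; field.
have -> : 3 * N0 * n * hr = 2 * n * hr * (3 / 2 * N0) by field.
by rewrite ler_wpM2l //; lra.
Qed.

Lemma sum_point_pair :
  \sum_t \sum_t' \sum_z nu (point t z) * nu (point t' z) <= 3 * ar ^+ 2 * n * hr.
Proof.
have nh := mass_height_ge0; have nh2 : 0 <= 2 * n * hr by rewrite -mulrA mulr_ge0.
have M0 := M_gt0; have ar0 := A_gt0r.
have row t t' : \sum_z nu (point t z) * nu (point t' z) <=
    2 * n * hr * (1 + M ^+ 2 * (t' == t)%:R).
  have -> : \sum_z nu (point t z) * nu (point t' z) =
     line_sum e H (weight nu o) [:: (true, offset t); (true, offset t')].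
    by apply: eq_bigr => z _; rewrite !big_cons big_nil mulr1.
  have [_|tt'] := eqVneq t' t.
    apply: le_trans (line_sum_trivial pr nu_M M_ge1 _) _ => //.
    rewrite mulr1 mulrC ler_wpM2l //=.
    by rewrite lerDr.
  rewrite mulr0 addr0 mulr1; apply: (line_sum_le pr) => /=.
  - by rewrite (leq_trans _ kK) // (leq_trans k_gt1) // leq_pmull.
  - by rewrite !offset_small.
  - by rewrite inE andbT (inj_eq offset_inj) eq_sym tt'.
apply: le_trans (ler_sum _ (fun t _ => ler_sum _ (fun t' _ => row t t'))) _.
have E (t : 'I_A) : \sum_t' (2 * n * hr * (1 + M ^+ 2 * (t' == t)%:R)) = 2 * n * hr * (ar + M ^+ 2).
  rewrite -mulr_sumr; congr (_ * _); rewrite big_split /=; congr (_ + _).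
    by rewrite sumr_const card_ord.
  rewrite -mulr_sumr (bigD1 t) //= eqxx big1 ?addr0 ?mulr1 // => j /negbTE -> //.
under eq_bigr do rewrite E.
rewrite sumr_const card_ord -[leLHS]mulr_natl.
have -> : 3 * ar ^+ 2 * n * hr = ar * (2 * n * hr * (3 / 2 * ar)) by field.
rewrite ler_wpM2l ?(ltW ar0) // ler_wpM2l //.
have : 2 * M ^+ 2 <= ar.
  apply: le_trans A_large; rewrite -mulrA ler_pM2l //.
  rewrite -[leLHS]mul1r ler_pM ?exprn_ge0 ?(ltW M0) //.
    by rewrite -natrX ler1n expn_gt0 (ltnW k_gt1).
  by rewrite ler_weXn2l // leq_pmulr // (ltnW k_gt1).
lra.
Qed.

Definition collides (b b' : F) : bool :=
  ~~ [&& injectiveb b, injectiveb b' & [forall j, [forall j', b j != b' j']]].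

(** The product of the two excesses opens into four line sums through [2 k] points with signs
    $+,-,-,+$. Without coincidence each is within [eta] of one common sum, which cancels; otherwise
    each is at most $2M^{2k}nH$. *)
Lemma excess_product_le (b b' : F) :
  `|\sum_z nu (point (b i) z) * nu (point (b' i) z) * fiber_excess b z * fiber_excess b' z|
  <= n * hr * (4 * eta + 8 * M ^+ (2 * k) * (collides b b')%:R).
Proof.
have nh := mass_height_ge0; have nh2 : 0 <= 2 * n * hr by rewrite -mulrA mulr_ge0.
have M0 := M_gt0; have eta0 := pr_eta_ge0 pr.
pose cs (w w' : bool) : seq (bool * int) :=
  ((true, offset (b i)) :: [seq (w, offset (b j)) | j <- others]) ++
  ((true, offset (b' i)) :: [seq (w', offset (b' j)) | j <- others]).
have csE w w' : map snd (cs w w') =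
    map (offset \o b) (i :: others) ++ map (offset \o b') (i :: others).
  by rewrite /cs map_cat /= -!map_comp.
have sz w w' : size (cs w w') = (2 * k)%N.
  rewrite size_cat /= !size_map size_others prednK ?(ltnW k_gt1) //.
  by rewrite mul2n addnn.
pose L w w' := line_sum e H (weight nu o) (cs w w').
have -> : \sum_z nu (point (b i) z) * nu (point (b' i) z) * fiber_excess b z * fiber_excess b' z
   = L true true - L true false - L false true + L false false.
  rewrite /L /line_sum -!sumrN -!big_split /=; apply: eq_bigr => z _.
  rewrite /cs !big_cat /= !big_cons /= -!fiber_prodE /fiber_excess /point /weight /=; ring.
have k2 : (0 < 2 * k)%N by rewrite muln_gt0 (ltnW k_gt1).
have [coll|] := boolP (collides b b').
  have Lle w w' : L w w' <= M ^+ (2 * k) * (2 * n * hr).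
    by have := line_sum_trivial pr nu_M M_ge1 (cs := cs w w'); rewrite sz => /(_ k2).
  have L0 w w' : 0 <= L w w' by apply: (line_sum_ge0 pr).
  have := Lle true true; have := Lle true false; have := Lle false true.
  have := Lle false false; have := L0 true true; have := L0 true false.
  have := L0 false true; have := L0 false false.
  have : 0 <= (n * hr) * eta by rewrite mulr_ge0.
  have : 0 <= M ^+ (2 * k) * (2 * n * hr) by rewrite mulr_ge0 ?exprn_ge0 ?(ltW M0) // -mulrA mulr_ge0.
  move: (M ^+ (2 * k)) => M2; rewrite ler_norml /=.
  move: (L true true) (L true false) (L false true) (L false false) => l1 l2 l3 l4.
  move=> *; apply/andP; split; lra.
rewrite negbK => /and3P[/injectiveP binj /injectiveP b'inj /forallP bb'].
rewrite mulr0 addr0.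
have io : uniq (i :: others) by rewrite /= enum_uniq mem_enum !inE eqxx.
have Lb w w' : `|L w w' - line_sum e H (fun=> o) (cs true true)| <= eta * n * hr.
  have -> : line_sum e H (fun=> o) (cs true true) = line_sum e H (fun=> o) (cs w w').
    rewrite /line_sum; apply: eq_bigr => z _.
    rewrite -(big_map snd predT (fun c => o (on_line e c z))) csE.
    by rewrite -(csE w w') big_map.
  apply: (line_bound pr).
  - by rewrite sz k2.
  - rewrite csE all_cat !all_map; apply/andP; split; apply/allP => j _; exact: offset_small.
  - rewrite csE cat_uniq !map_inj_uniq //; first last.
    + by move=> j j' /offset_inj /binj.
    + by move=> j j' /offset_inj /b'inj.
    rewrite io andbT andTb; apply/hasPn => c /mapP[j _ ->].
    apply/mapP => -[j' _ /offset_inj E].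
    by have /forallP/(_ j) := bb' j'; rewrite E eqxx.
have := Lb true true; have := Lb true false; have := Lb false true; have := Lb false false.
move: (line_sum _ _ _) (L true true) (L true false) (L false true) (L false false) => l0 l1 l2 l3 l4.
rewrite !ler_norml; move=> /andP[? ?] /andP[? ?] /andP[? ?] /andP[? ?]; apply/andP; split; lra.
Qed.

(** [fiber_excess] ignores the [i]-th coordinate, so [sum_dummy] stores [t] and [t'] in [b i] and
    [b' i] and reduces the sum to [excess_product_le]. *)
Lemma sum_excess_product :
  \sum_t \sum_t' \sum_b \sum_b'
    `|\sum_z nu (point t z) * nu (point t' z) * fiber_excess b z * fiber_excess b' z|
  <= ar ^+ 2 * N0 ^+ 2 * n * hr * (4 * eta + 24 * k%:R ^+ 2 * M ^+ (2 * k) / ar).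
Proof.
have nh := mass_height_ge0; have nh2 : 0 <= 2 * n * hr by rewrite -mulrA mulr_ge0.
have M0 := M_gt0; have ar0 := A_gt0r.
pose q t t' b b' :=
   `|\sum_z nu (point t z) * nu (point t' z) * fiber_excess b z * fiber_excess b' z|.
have E : \sum_t \sum_t' \sum_b \sum_b' q t t' b b' =
   ar ^+ 2 * \sum_(b : F) \sum_(b' : F) q (b i) (b' i) b b'.
  transitivity (\sum_t \sum_(b : F) (ar * \sum_(b' : F) q t (b' i) b b')).
    apply: eq_bigr => t _; rewrite exchange_big /=; apply: eq_bigr => b _.
    apply: (@sum_dummy R k A i (fun t' b' => q t t' b b')) => t' b' s.
    by congr Num.norm; apply: eq_bigr => z _; rewrite /fiber_excess !fiber_prod_update.
  rewrite (@sum_dummy R k A i (fun t b => ar * \sum_(b' : F) q t (b' i) b b')).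
    by rewrite -mulr_sumr mulrA -expr2.
  move=> t b s; congr (_ * _); apply: eq_bigr => b' _.
  by congr Num.norm; apply: eq_bigr => z _; rewrite /fiber_excess !fiber_prod_update.
rewrite E [leRHS](_ : _ = ar ^+ 2 * (n * hr * (N0 ^+ 2 * (4 * eta) +
  8 * M ^+ (2 * k) * (3 * k%:R ^+ 2 * N0 ^+ 2 / ar)))); last first.
  by field; rewrite gt_eqF.
rewrite ler_wpM2l ?exprn_ge0 ?(ltW ar0) //.
apply: le_trans (ler_sum _ (fun b _ => ler_sum _ (fun b' _ => excess_product_le b b'))) _.
have := @sum_noninjective2 R k A collides _; set s := \sum_b _ => sP.
have sle : ar * s <= 3 * k%:R ^+ 2 * N0 ^+ 2.
  apply: sP => b b'; rewrite /collides !negb_and -orbA => /or3P[] /=.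
  - move/injectivePn => [j [j' jj' bb]]; apply/orP; left; apply/existsP.
    by exists j; apply/existsP; exists j'; rewrite jj' bb eqxx.
  - move/injectivePn => [j [j' jj' bb]]; apply/orP; right; apply/orP; left; apply/existsP.
    by exists j; apply/existsP; exists j'; rewrite jj' bb eqxx.
  - rewrite negb_forall => /existsP[j]; rewrite negb_forall => /existsP[j'].
    rewrite negbK => bb; apply/orP; right; apply/orP; right.
    by apply/existsP; exists j; apply/existsP; exists j'.
have -> : \sum_(b : F) \sum_(b' : F) n * hr * (4 * eta + 8 * M ^+ (2 * k) * (collides b b')%:R)
   = n * hr * (N0 ^+ 2 * (4 * eta) + 8 * M ^+ (2 * k) * s).
  have E1 x y (g : F -> R) : \sum_(b : F) (x + y * g b) = N0 * x + y * \sum_b g b.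
    by rewrite big_split /= sumr_const -mulr_sumr -[_ *+ _]mulr_natl.
  under eq_bigr do rewrite -mulr_sumr E1.
  by rewrite -mulr_sumr E1 /s; ring.
rewrite ler_wpM2l // lerD2l ler_wpM2l ?mulr_ge0 ?exprn_ge0 ?(ltW M0) //.
by rewrite ler_pdivlMr // mulrC.
Qed.

Definition first_sum : R :=
  \sum_b \sum_z fiber_prod nu b z * `|\sum_t lam (update i b t) * p (point t z)|.

Lemma self_corr_point (t t' : 'I_A) :
  self_corr e H p ((t' : nat)%:Z - (t : nat)%:Z) = \sum_z p (point t z) * p (point t' z).
Proof.
rewrite sum_pair; apply: eq_bigr => m _.
rewrite -[LHS](sum_shift (e *~ (offset t * (m : nat).+1%:Z))); apply: eq_bigr => x _.
by rewrite /point /on_line /= -addrA -mulrzDr; congr (_ * p (_ + _ *~ _)); rewrite /offset; ring.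
Qed.

(** Cauchy-Schwarz with weight [fiber_prod nu] squares the sum over [t], after which [lam] occurs
    only in the bounded products [ll]. Splitting the weight gives a main part [W], where [lam] is
    dropped by absolute values, and an error [Er], from which [p] is removed by one more
    Cauchy-Schwarz step. The constant $108=3\cdot36$ makes [Er] at most half of the total. *)
Lemma sum_pair_corr_ge (sigma : R) :
  0 <= sigma -> 0 < n ->
  108 * (4 * eta + 24 * k%:R ^+ 2 * M ^+ (2 * k) / ar) <= sigma ^+ 4 ->
  sigma * (N0 * ar * n * hr) <= first_sum ->
  sigma ^+ 4 / 36 * (ar ^+ 2 * n ^+ 2 * hr ^+ 2) <=
    \sum_(t < A) \sum_(t' < A) self_corr e H p ((t' : nat)%:Z - (t : nat)%:Z) ^+ 2.
Proof.
set kappa := 4 * eta + _ => sigma0 n0 kap Sge.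
have ar0 := A_gt0r; have hr0 : 0 < hr := height_gt0 pr.
have N00 : 0 < N0.
  have A0 : (0 < A)%N by rewrite -(ltr0n R).
  by rewrite ltr0n; apply/card_gt0P; exists [ffun=> Ordinal A0].
pose L b z := \sum_t lam (update i b t) * p (point t z).
pose Zs := \sum_b \sum_z fiber_prod nu b z * L b z ^+ 2.
have S_le : first_sum ^+ 2 <= 3 * N0 * n * hr * Zs.
  have := @weighted_cauchy_schwarz R (F * Z)%type (fun y => fiber_prod nu y.1 y.2)
     (fun y => fiber_prod nu y.1 y.2) (fun y => `|L y.1 y.2|).
  rewrite !sum_pair /= -/first_sum => /(_ _)/le_trans; apply.
    by move=> y; rewrite ger0_norm ?fiber_prod_ge0.
  have -> : \sum_b \sum_z fiber_prod nu b z * `|L b z| ^+ 2 = Zs.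
    by apply: eq_bigr => b _; apply: eq_bigr => z _; rewrite real_normK ?num_real.
  rewrite ler_wpM2r ?sum_fiber_prod //.
  by apply: sumr_ge0 => b _; apply: sumr_ge0 => z _; rewrite mulr_ge0 ?sqr_ge0 ?fiber_prod_ge0.
pose ll b t t' := lam (update i b t) * lam (update i b t').
have ll1 b t t' : `|ll b t t'| <= 1 by rewrite normrM mulr_ile1.
pose W := \sum_b \sum_t \sum_t' `|\sum_z fiber_prod o b z * (p (point t z) * p (point t' z))|.
pose Er := \sum_b \sum_t \sum_t' ll b t t' * \sum_z fiber_excess b z * (p (point t z) * p (point t' z)).
have Z_le : Zs <= W + Er.
  rewrite -big_split /=; apply: ler_sum => b _.
  under [leLHS]eq_bigr do rewrite /L sqr_sum mulr_sumr.
  rewrite [leLHS]exchange_big -big_split /=; apply: ler_sum => t _.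
  under [leLHS]eq_bigr do rewrite mulr_sumr.
  rewrite [leLHS]exchange_big -big_split /=; apply: ler_sum => t' _.
  rewrite -lerBlDr; apply: le_trans (_ : ll b t t' * \sum_z fiber_prod o b z * (p (point t z) * p (point t' z)) <= _).
    rewrite !mulr_sumr -sumrB le_eqVlt; apply/orP; left; apply/eqP.
    by apply: eq_bigr => z _; rewrite /ll /fiber_excess; ring.
  apply: le_trans (ler_norm _) _; rewrite normrM -[leRHS]mul1r.
  by rewrite ler_wpM2r.
have Er_le : Er ^+ 2 <= 3 * ar ^+ 2 * n * hr * (ar ^+ 2 * N0 ^+ 2 * n * hr * kappa).
  pose T2 : finType := (('I_A * 'I_A) * Z)%type.
  have -> : Er = \sum_(y : T2) p (point y.1.1 y.2) * p (point y.1.2 y.2) *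
      \sum_b ll b y.1.1 y.1.2 * fiber_excess b y.2.
    rewrite sum_pair sum_pair /= /Er exchange_big /=; apply: eq_bigr => t _.
    rewrite exchange_big /=; apply: eq_bigr => t' _.
    under eq_bigr do rewrite mulr_sumr.
    rewrite exchange_big /=; apply: eq_bigr => z _; rewrite mulr_sumr.
    by apply: eq_bigr => b _; ring.
  apply: le_trans (@weighted_cauchy_schwarz R T2
    (fun y => nu (point y.1.1 y.2) * nu (point y.1.2 y.2)) _ _ _) _.
    by move=> y; rewrite normrM ler_pM.
  apply: ler_pM.
  - by apply: sumr_ge0 => y _; rewrite mulr_ge0.
  - by apply: sumr_ge0 => y _; rewrite mulr_ge0 ?sqr_ge0 ?mulr_ge0.
  - by rewrite sum_pair sum_pair /=; exact: sum_point_pair.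
  apply: le_trans sum_excess_product; rewrite sum_pair sum_pair /=.
  apply: ler_sum => t _; apply: ler_sum => t' _.
  apply: le_trans (_ : \sum_b \sum_b' ll b t t' * ll b' t t' *
     (\sum_z nu (point t z) * nu (point t' z) * fiber_excess b z * fiber_excess b' z) <= _).
    under [leLHS]eq_bigr do rewrite sqr_sum mulr_sumr.
    rewrite [leLHS]exchange_big /=; apply: ler_sum => b _.
    under [leLHS]eq_bigr do rewrite mulr_sumr.
    rewrite [leLHS]exchange_big /=; apply: ler_sum => b' _.
    rewrite mulr_sumr le_eqVlt; apply/orP; left; apply/eqP.
    by apply: eq_bigr => z _; ring.
  apply: ler_sum => b _; apply: ler_sum => b' _.
  apply: le_trans (ler_norm _) _; rewrite normrM -[leRHS]mul1r ler_wpM2r //.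
  by rewrite normrM mulr_ile1.
set U := \sum_t _.
have W_le : W ^+ 2 <= N0 * ar ^+ 2 * (N0 * U).
  have := @cauchy_schwarz_card R (F * ('I_A * 'I_A))%type (fun y =>
     `|\sum_z fiber_prod o y.1 z * (p (point y.2.1 z) * p (point y.2.2 z))|).
  rewrite !sum_pair /=; under [X in X ^+ 2]eq_bigr do rewrite sum_pair /=.
  rewrite -/W => /le_trans; apply.
  rewrite !card_prod !card_ord !natrM -expr2 ler_wpM2l ?mulr_ge0 ?exprn_ge0 ?(ltW N00) //.
  apply: le_trans (_ : \sum_(b : F) U <= _); last by rewrite sumr_const -[leLHS]mulr_natl.
  apply: ler_sum => b _; rewrite sum_pair /=.
  under eq_bigr do under eq_bigr do rewrite real_normK ?num_real //.
  apply: le_trans (@gram_weight_le R 'I_A Z (fun t z => p (point t z)) _ _) _.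
    move=> z; rewrite prodr_ge0 //= prodr_ile1 // => j _.
    by rewrite o_ge0 o_le1.
  by under [leRHS]eq_bigr do under eq_bigr do rewrite self_corr_point.
have W0 : 0 <= W by do 3 (apply: sumr_ge0 => ? _).
have nh : 0 < n * hr by rewrite mulr_gt0.
have Er2 : Er <= sigma ^+ 2 / 6 * (ar ^+ 2 * N0 * (n * hr)).
  apply: le_trans (ler_norm _) _.
  have r0 : 0 <= sigma ^+ 2 / 6 * (ar ^+ 2 * N0 * (n * hr)).
    by rewrite !mulr_ge0 ?exprn_ge0 ?invr_ge0 // ltW.
  rewrite -(@ler_pXn2r _ 2) ?nnegrE // real_normK ?num_real //.
  apply: le_trans Er_le _.
  have -> : 3 * ar ^+ 2 * n * hr * (ar ^+ 2 * N0 ^+ 2 * n * hr * kappa) =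
     (108 * kappa) / 36 * (ar ^+ 2 * N0 * (n * hr)) ^+ 2 by field.
  have -> : (sigma ^+ 2 / 6 * (ar ^+ 2 * N0 * (n * hr))) ^+ 2 =
     sigma ^+ 4 / 36 * (ar ^+ 2 * N0 * (n * hr)) ^+ 2 by field.
  by rewrite ler_wpM2r ?sqr_ge0 // ler_wpM2r ?invr_ge0.
have WEr : sigma ^+ 2 / 3 * (ar ^+ 2 * N0 * (n * hr)) <= W + Er.
  have p3 : 0 < 3 * N0 * n * hr by rewrite !mulr_gt0.
  rewrite -(ler_pM2l p3); apply: le_trans (_ : first_sum ^+ 2 <= _); last first.
    by apply: le_trans S_le _; rewrite ler_wpM2l // ltW.
  have -> : 3 * N0 * n * hr * (sigma ^+ 2 / 3 * (ar ^+ 2 * N0 * (n * hr))) =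
     (sigma * (N0 * ar * n * hr)) ^+ 2 by field.
  have l0 : 0 <= sigma * (N0 * ar * n * hr) by rewrite !mulr_ge0 // ltW.
  by rewrite lerXn2r // nnegrE // (le_trans l0).
have Wge : sigma ^+ 2 / 6 * (ar ^+ 2 * N0 * (n * hr)) <= W.
  have -> : sigma ^+ 2 / 6 * (ar ^+ 2 * N0 * (n * hr)) =
    sigma ^+ 2 / 3 * (ar ^+ 2 * N0 * (n * hr)) - sigma ^+ 2 / 6 * (ar ^+ 2 * N0 * (n * hr)).
    by field.
  lra.
have cpos : 0 < N0 * ar ^+ 2 * N0 by rewrite !mulr_gt0 ?exprn_gt0.
rewrite -(ler_pM2l cpos); apply: le_trans (_ : W ^+ 2 <= _); last first.
  by apply: le_trans W_le _; rewrite mulrA.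
have -> : N0 * ar ^+ 2 * N0 * (sigma ^+ 4 / 36 * (ar ^+ 2 * n ^+ 2 * hr ^+ 2)) =
   (sigma ^+ 2 / 6 * (ar ^+ 2 * N0 * (n * hr))) ^+ 2 by field.
have r0 : 0 <= sigma ^+ 2 / 6 * (ar ^+ 2 * N0 * (n * hr)).
  by rewrite !mulr_ge0 ?exprn_ge0 ?invr_ge0 // ltW.
by rewrite lerXn2r // nnegrE.
Qed.

End FirstStage.

(** * Passing to shorter ranges of [b] *)

Section Pigeonhole.

Variables (R : realFieldType) (V : finZmodType) (e : V) (H : nat) (p : V -> R).

Local Notation corr_sum A :=
  (\sum_(t < A) \sum_(t' < A) self_corr e H p ((t' : nat)%:Z - (t : nat)%:Z) ^+ 2).

(* The Gram matrix of the translates has entries depending only on t' - t, so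
   blocks of equal length contribute equally and Cauchy-Schwarz over the blocks
   loses only the square of their number. *)
Lemma corr_sum_blocks (A q : nat) : corr_sum (q * A) <= q%:R ^+ 2 * corr_sum A.
Proof.
pose P (t : nat) (z : 'I_H * V) : R := p (z.2 + e *~ (t%:Z * (z.1 : nat).+1%:Z)).
have P_corr (t t' : nat) : self_corr e H p (t'%:Z - t%:Z) = \sum_z P t z * P t' z.
  rewrite sum_pair; apply: eq_bigr => m _.
  rewrite -[LHS](sum_shift (e *~ (t%:Z * (m : nat).+1%:Z))); apply: eq_bigr => x _.
  by rewrite /P /= -addrA -mulrzDr; congr (_ * p (_ + _ *~ _)); ring.
have gramE (B : nat) (f : 'I_B -> nat) :
   \sum_(t < B) \sum_(t' < B) self_corr e H p ((f t')%:Z - (f t)%:Z) ^+ 2 =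
   \sum_z \sum_z' (\sum_(t < B) P (f t) z * P (f t) z') ^+ 2.
  have := gram_weighted (fun (t : 'I_B) => P (f t)) (fun=> 1).
  under eq_bigr do under eq_bigr do under eq_bigr do rewrite mul1r.
  under [X in _ = X -> _]eq_bigr do under eq_bigr do rewrite !mul1r.
  move=> <-; apply: eq_bigr => t _; apply: eq_bigr => t' _.
  by rewrite P_corr.
rewrite (gramE _ (fun t => t : nat)).
have block z z' : \sum_(t < q * A) P t z * P t z' =
   \sum_(a < q) \sum_(t < A) P (a * A + t)%N z * P (a * A + t)%N z'.
  rewrite -(big_mkord xpredT (fun t => P t z * P t z')) big_nat_mul big_mkord.
  apply: eq_bigr => a _; rewrite -{1}[(a * A)%N]add0n big_addn mulSn addnK big_mkord.
  by apply: eq_bigr => t _; rewrite addnC.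
apply: le_trans (_ : \sum_z \sum_z' (q%:R * \sum_(a < q)
   (\sum_(t < A) P (a * A + t)%N z * P (a * A + t)%N z') ^+ 2) <= _).
  apply: ler_sum => z _; apply: ler_sum => z' _; rewrite block.
  by apply: le_trans (cauchy_schwarz_card _) _; rewrite card_ord.
under eq_bigr do rewrite -mulr_sumr exchange_big /=.
rewrite -mulr_sumr exchange_big /= expr2 -mulrA ler_wpM2l //.
apply: le_trans (_ : \sum_(a < q) corr_sum A <= _); last first.
  by rewrite sumr_const card_ord -[leLHS]mulr_natl.
apply: ler_sum => a _; rewrite -(gramE _ (fun t : 'I_A => (a * A + t)%N)).
rewrite le_eqVlt; apply/orP; left; apply/eqP.
apply: eq_bigr => t _; apply: eq_bigr => t' _; congr (self_corr _ _ _ _ ^+ 2).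
by rewrite !PoszD; ring.
Qed.

Lemma corr_sum_mono (A B : nat) : (A <= B)%N -> corr_sum A <= corr_sum B.
Proof.
move=> AB; rewrite -(big_mkord xpredT (fun t =>
  \sum_(t' < A) self_corr e H p ((t' : nat)%:Z - t%:Z) ^+ 2)).
rewrite -[leRHS](big_mkord xpredT (fun t =>
  \sum_(t' < B) self_corr e H p ((t' : nat)%:Z - t%:Z) ^+ 2)).
rewrite [leRHS](@big_cat_nat _ _ _ A) //=.
apply: le_trans (_ : \sum_(0 <= t < A) \sum_(t' < B) self_corr e H p ((t' : nat)%:Z - t%:Z) ^+ 2 <= _).
  apply: ler_sum => t _.
  rewrite -(big_mkord xpredT (fun t' => self_corr e H p (t'%:Z - t%:Z) ^+ 2)).
  rewrite -[leRHS](big_mkord xpredT (fun t' => self_corr e H p (t'%:Z - t%:Z) ^+ 2)).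
  by rewrite [leRHS](@big_cat_nat _ _ _ A) //= lerDl sumr_ge0 // => ? _; rewrite sqr_ge0.
by rewrite lerDl; do 2 (apply: sumr_ge0 => ? _); rewrite sqr_ge0.
Qed.

(** The number [q] of blocks covering the range is at most [2 B / A], whence the factor 4. *)
Lemma pigeonhole (A B : nat) : (0 < A <= B)%N ->
  corr_sum B <= 4 * (B%:R / A%:R) ^+ 2 * corr_sum A.
Proof.
case/andP=> A0 AB; have Ar : 0 < A%:R :> R by rewrite ltr0n.
pose q := (B %/ A).+1.
apply: le_trans (corr_sum_mono (_ : (B <= q * A)%N)) _; first by rewrite ltnW ?ltn_ceil.
apply: le_trans (corr_sum_blocks A q) _; rewrite ler_wpM2r //.
  by do 2 (apply: sumr_ge0 => ? _); rewrite sqr_ge0.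
have -> : 4 * (B%:R / A%:R) ^+ 2 = (2 * (B%:R / A%:R)) ^+ 2 :> R by ring.
rewrite lerXn2r // ?nnegrE ?mulr_ge0 ?invr_ge0 ?ler0n //.
rewrite mulrA ler_pdivlMr // -!natrM ler_nat /q.
have := leq_trunc_div B A; have : (1 <= B %/ A)%N by rewrite divn_gt0.
nia.
Qed.

End Pigeonhole.

(** * Choice of the scales in the kernel average *)

Section Scales.

Variable R : archiRealFieldType.

(** Up to rounding, $w=zP$, $Y=zQ$, $G=1/z$ and $T=w(Y-P)/G$, of order $z^3PQ$, so all error terms
    of [corr4_upper] are $O(z)$. The hypotheses give $zP\ge100$ and $zQ\ge100P$, so that rounding
    and the subtraction of [P] cost only constant factors. *)
Lemma choose_scales (d z : R) (P Q : nat) :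
  0 < d -> d <= 100^-1 -> 0 < z -> z <= 2^-1 ->
  1 <= d * z * P%:R -> P%:R <= d ^+ 2 * z * Q%:R ->
  exists w Y T G : nat,
    [/\ (0 < w)%N, (0 < T)%N & (0 < G)%N] /\
    [/\ (P <= Y <= Q)%N, (G * T <= w * (Y - P))%N, (G * T <= P * Q)%N,
        4 * (2 * w%:R / P%:R + 4 / G%:R) + 16 * (Y%:R / Q%:R) <= 48 * z &
        z ^+ 3 * P%:R * Q%:R / 16 <= T%:R].
Proof.
move=> d0 d1 z0 z1 dzP PQ.
pose a := z * P%:R; pose b := z * Q%:R.
have zi0 : 0 < z^-1 by rewrite invr_gt0.
have z_le1 : z <= 1 by lra.
have a0 : 0 <= a by rewrite mulr_ge0 // ltW.
have a_ge : 100 <= a.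
  have : a * d <= a * 100^-1 by rewrite ler_wpM2l.
  by move: dzP; rewrite -mulrA -/a; lra.
have aP : a <= P%:R / 2 by rewrite /a mulrC ler_wpM2l.
have b0 : 0 <= b by rewrite mulr_ge0 // ltW.
have Pb : P%:R <= d ^+ 2 * b by rewrite /b mulrA.
have d2 : d ^+ 2 <= 100^-1.
  rewrite expr2; apply: le_trans (_ : d * 1 <= _); last by rewrite mulr1.
  rewrite ler_wpM2l ?(ltW d0) //; lra.
have bP : 100 * P%:R <= b.
  have : d ^+ 2 * b <= 100^-1 * b by rewrite ler_wpM2r.
  lra.
have bQ : b <= Q%:R by rewrite /b ler_piMl.
pose w := (Num.truncn a).+1; pose Y := Num.truncn b; pose G := (Num.truncn z^-1).+1.
have /andP[W1 W2] := truncn_itv a0; have /andP[Y1 Y2] := truncn_itv b0.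
have /andP[G1 G2] := truncn_itv (ltW zi0).
have wE : w%:R = (Num.truncn a)%:R + 1 :> R by rewrite /w -natr1.
have GE : G%:R = (Num.truncn z^-1)%:R + 1 :> R by rewrite /G -natr1.
have YE : b < Y%:R + 1 by rewrite natr1.
pose T := ((w * (Y - P)) %/ G)%N.
have PY : (P <= Y)%N by rewrite -(ler_nat R); lra.
have YQ : (Y <= Q)%N by rewrite -(ler_nat R); apply: le_trans Y1 bQ.
have YP : (Y - P)%:R = Y%:R - P%:R :> R by rewrite natrB.
have G0 : 0 < G%:R :> R by rewrite ltr0n.
have GT : (G * T <= w * (Y - P))%N by rewrite mulnC leq_trunc_div.
have TE : w%:R * (Y - P)%:R < (T%:R + 1) * G%:R :> R.
  by rewrite natr1 -!natrM ltr_nat ltn_ceil.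
have zi1 : 1 <= z^-1 by rewrite invf_ge1.
have G2z : G%:R <= 2 * z^-1 by rewrite GE; lra.
have YPb : b / 2 <= (Y - P)%:R by rewrite YP; lra.
have ab : a * (b / 2) <= w%:R * (Y - P)%:R.
  by apply: ler_pM; rewrite ?divr_ge0 // /w ltW.
have Tz : a * (b / 2) * z <= 2 * (T%:R + 1).
  have t1 : 0 <= T%:R + 1 :> R by rewrite addr_ge0.
  have h : a * (b / 2) <= (T%:R + 1) * (2 * z^-1).
    by apply: le_trans ab _; apply: le_trans (ltW TE) _; rewrite ler_wpM2l.
  have -> : 2 * (T%:R + 1) = (T%:R + 1) * (2 * z^-1) * z by field; rewrite gt_eqF.
  by rewrite ler_wpM2r // ltW.
have abz : 100 <= a * b * z.
  have zb : a <= z * b.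
    apply: le_trans (_ : z * P%:R <= _) => //; rewrite ler_wpM2l ?(ltW z0) //; lra.
  have : 100 * 1 <= a * (z * b) by rewrite ler_pM // (le_trans _ zb) //; lra.
  by rewrite (_ : a * b * z = a * (z * b)); [lra | ring].
have Tge : z ^+ 3 * P%:R * Q%:R / 16 <= T%:R.
  have -> : z ^+ 3 * P%:R * Q%:R / 16 = a * b * z / 16 by rewrite /a /b; ring.
  have : a * (b / 2) * z = a * b * z / 2 by ring.
  lra.
have Pr0 : 0 < P%:R :> R by lra.
have Qr0 : 0 < Q%:R :> R by lra.
exists w, Y, T, G; split; split => //.
- by rewrite -(ltr0n R); lra.
- by rewrite PY.
- apply: leq_trans GT _; apply: leq_mul; last exact: leq_trans (leq_subr _ _) YQ.
  by rewrite -(ler_nat R) wE; lra.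
- have wz : w%:R / P%:R <= 2 * z.
    by rewrite ler_pdivrMr // wE -mulrA -/a; lra.
  have Yz : Y%:R / Q%:R <= z by rewrite ler_pdivrMr.
  have Gz : G%:R^-1 <= z.
    by rewrite -[leRHS]invrK lef_pV2 // /G; apply/ltW.
  lra.
Qed.

End Scales.

(** * A large sum along a progression of small step *)

Section ProgressionBound.

Variables (R : archiRealFieldType) (V : finZmodType) (e : V) (H : nat).
Variables (nu o : V -> R) (K am cm : nat) (eta : R).
Hypothesis pr : pseudorandom e H nu o K am cm eta.
Variables (p : V -> R) (M d tau : R).
Hypothesis p_nu : forall x, `|p x| <= nu x.
Hypothesis nu_M : forall x, nu x <= M.
Hypothesis M_ge1 : 1 <= M.
Hypothesis d_gt0 : 0 < d.
Hypothesis d_small : d <= 200^-1.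
Hypothesis eta_small : eta <= d ^+ 182.

Local Notation n := (mass o).
Local Notation hr := (H%:R : R).
Local Notation "x ++> z" := (x + e *~ z) (at level 50).

Lemma expr_small (i j : nat) : (i <= j)%N -> d ^+ j <= d ^+ i.
Proof.
by move=> ij; rewrite ler_wiXn2l // ?(ltW d_gt0) //; have := d_small; lra.
Qed.

(** The bookkeeping device: raising an exponent by one pays for any numerical constant up to 200. *)
Lemma expr_step (i : nat) : 200 * d ^+ i.+1 <= d ^+ i.
Proof.
rewrite exprS mulrA ler_piMl ?exprn_ge0 ?(ltW d_gt0) //.
by have := d_small; lra.
Qed.

(** With [eps = d ^+ 45] and $z=d^{44}$, the squarings carry the density from $d^9$ to $d^{10}$,
    $d^{21}$, $d^{43}$, which exceeds the error $48d^{44}$. Hence $\tau/T\ge d^{43}/4$, and $T\ge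
    d^{132}PQ/16$ gives the exponent $176=43+132+1$. *)
Lemma progression_of_blocks (A P Q : nat) :
  (P = A /\ Q = H) \/ (P = H /\ Q = A) ->
  (0 < A <= cm)%N -> (9 * (A * H) <= am)%N -> 0 < n ->
  M ^+ 2 <= d ^+ 45 * A%:R -> 1 <= d ^+ 45 * P%:R -> P%:R <= d ^+ 46 * Q%:R ->
  (forall (x : V) (g T : nat), (0 < g)%N -> (g * T <= A * H)%N ->
     `|\sum_(t < T) p (x ++> g%:Z * (t : nat)%:Z)| <= tau) ->
  d ^+ 9 * (A%:R ^+ 2 * n ^+ 2 * hr ^+ 2) <=
    \sum_(b < A) \sum_(b' < A) self_corr e H p ((b : nat)%:Z - (b' : nat)%:Z) ^+ 2 ->
  d ^+ 176 * (A%:R * hr) <= tau.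
Proof.
move=> PQ /andP[A0 Acm] amAH n0 MA dP PdQ p_tau blocks.
have d0 := d_gt0; have d1 := d_small.
have Ar : 0 < A%:R :> R by rewrite ltr0n.
have ap : A%:R * hr = P%:R * Q%:R :> R by case: PQ => -[-> ->] //; rewrite mulrC.
have PQA : (P * Q = A * H)%N by case: PQ => -[-> ->] //; rewrite mulnC.
have z0 : 0 < d ^+ 44 by rewrite exprn_gt0.
have z1 : d ^+ 44 <= 2^-1.
  by apply: le_trans (expr_small (isT : (1 <= 44)%N)) _; rewrite expr1; lra.
have [w [Y [T [G [[w0 T0 G0] [PYQ GT GPQ sc Tge]]]]]] :
    exists w Y T G : nat,
    [/\ (0 < w)%N, (0 < T)%N & (0 < G)%N] /\
    [/\ (P <= Y <= Q)%N, (G * T <= w * (Y - P))%N, (G * T <= P * Q)%N,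
        4 * (2 * w%:R / P%:R + 4 / G%:R) + 16 * (Y%:R / Q%:R) <= 48 * d ^+ 44 &
        (d ^+ 44) ^+ 3 * P%:R * Q%:R / 16 <= T%:R].
  by apply: (choose_scales d0) => //; lra.
have eps0 : 0 <= d ^+ 45 by rewrite exprn_ge0 // ltW.
(* The exponent in [eta_small]: $128d^{182}\le d^{180}=(d^{45})^4$. *)
have eta_eps : 128 * eta <= (d ^+ 45) ^+ 4.
  rewrite -exprM; apply: le_trans (_ : 128 * d ^+ 182 <= _).
    by rewrite ler_wpM2l.
  have : 0 <= d ^+ 181 by rewrite exprn_ge0 // ltW.
  have := expr_step 180; have := expr_step 181; rewrite (_ : 45 * 4 = 180)%N //; lra.
have MleA : M <= A%:R.
  have M2 : M <= M ^+ 2 by rewrite expr2 ler_peMl // (le_trans ler01).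
  apply: le_trans M2 _; apply: le_trans MA _; rewrite ler_piMl ?(ltW Ar) //.
  by have := expr_small (isT : (0 <= 45)%N); rewrite expr0.
have upper := corr4_upper pr p_nu nu_M M_ge1 A0 Acm PQ _ w0 T0 G0 PYQ GT amAH MleA (tau := tau).
have lossE : loss M (d ^+ 45) A <= d ^+ 44.
  rewrite /loss; have : M ^+ 2 / A%:R <= d ^+ 45 by rewrite ler_pdivrMr.
  by have := expr_step 44; rewrite -mulrA; lra.
have loss0 : 0 <= loss M (d ^+ 45) A.
  by rewrite /loss addr_ge0 // divr_ge0 ?mulr_ge0 ?exprn_ge0 // (le_trans ler01).
pose r1 := d ^+ 9 / 2 - loss M (d ^+ 45) A.
pose r2 := r1 ^+ 2 / 2 - loss M (d ^+ 45) A.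
have d10 : 0 <= d ^+ 10 by rewrite exprn_ge0 // ltW.
have d21 : 0 <= d ^+ 21 by rewrite exprn_ge0 // ltW.
have d43 : 0 <= d ^+ 43 by rewrite exprn_ge0 // ltW.
have r1_ge : d ^+ 10 <= r1.
  have := expr_step 9; have := expr_small (isT : (10 <= 44)%N); rewrite /r1; lra.
have r2_ge : d ^+ 21 <= r2.
  have : (d ^+ 10) ^+ 2 <= r1 ^+ 2 by rewrite lerXn2r // nnegrE // (le_trans d10).
  rewrite -exprM /r2.
  by have := expr_step 20; have := expr_small (isT : (21 <= 44)%N); lra.
have r3_ge : d ^+ 43 <= r2 ^+ 2 / 2 - loss M (d ^+ 45) A.
  have : (d ^+ 21) ^+ 2 <= r2 ^+ 2 by rewrite lerXn2r // nnegrE // (le_trans d21).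
  rewrite -exprM.
  by have := expr_step 42; have := expr_small (isT : (43 <= 44)%N); lra.
have AH4 : (4 * (A * H) <= am)%N.
  by apply: leq_trans amAH; rewrite leq_mul2r orbT.
have lower := corr4_lower pr p_nu nu_M M_ge1 eps0 eta_eps A0 Acm
  (le_trans d10 r1_ge) (le_trans d21 r2_ge) n0 AH4 blocks.
have pt : forall (x : V) (g : nat), (0 < g <= G)%N ->
     `|\sum_(t < T) p (x ++> g%:Z * (t : nat)%:Z)| <= tau.
  move=> x g /andP[g0 gG]; apply: p_tau => //; rewrite -PQA; apply: leq_trans GPQ.
  by rewrite leq_mul2r gG orbT.
have := le_trans lower (upper pt).
have hr0 : 0 < hr := height_gt0 pr.
set X := n * _; have X0 : 0 < X by rewrite mulr_gt0 ?exprn_gt0 ?mulr_gt0 ?exprn_gt0.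
rewrite mulrC ler_pM2l // => main.
have {main}main := le_trans r3_ge main.
have Tr : 0 < T%:R :> R by rewrite ltr0n.
have tauT : d ^+ 43 / 4 <= tau / T%:R.
  have -> : tau / T%:R = 2 * tau / T%:R / 2 by field; rewrite gt_eqF.
  have := expr_step 43; move: sc main d43; lra.
have tauT' : d ^+ 43 / 4 * T%:R <= tau by rewrite -ler_pdivlMr.
apply: le_trans tauT'; rewrite ap.
have PQ0 : 0 <= P%:R * Q%:R :> R by rewrite mulr_ge0.
apply: le_trans (_ : d ^+ 43 / 4 * (d ^+ 132 * (P%:R * Q%:R) / 16) <= _); last first.
  rewrite ler_wpM2l ?divr_ge0 // mulrA; apply: le_trans Tge.
  by rewrite -exprM.
have -> : d ^+ 43 / 4 * (d ^+ 132 * (P%:R * Q%:R) / 16) = d ^+ 175 / 64 * (P%:R * Q%:R).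
  by rewrite (_ : 175 = 43 + 132)%N // exprD; field.
rewrite ler_wpM2r //; have := expr_step 175.
have : 0 <= d ^+ 176 by rewrite exprn_ge0 // ltW.
lra.
Qed.

Variables (k A0 c0 : nat) (i : 'I_k) (B : R).
Variable lam : {ffun 'I_k -> 'I_A0} -> R.
Hypothesis lam_le1 : forall b, `|lam b| <= 1.
Hypothesis k_gt1 : (1 < k)%N.
Hypothesis kK : (2 * k <= K)%N.
Hypothesis A0_cm : (A0 + c0 <= cm)%N.
Hypothesis A0_am : (A0 + c0 <= am)%N.
Hypothesis A0H_am : (9 * (A0 * H) <= am)%N.
Hypothesis B_A0 : B <= A0%:R.
Hypothesis M_B : k%:R ^+ 2 * M ^+ (2 * k) <= d ^+ 140 * B.
Hypothesis H_large : 1 <= d ^+ 45 * hr.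

(* The two lengths A (of the blocks) and H play symmetric roles; the kernel
   average needs one of them much shorter than the other, so A is taken as
   B when H is short and as a small multiple of B otherwise. *)
Lemma progression_lower_bound :
  0 < n ->
  (forall (x : V) (g T : nat), (0 < g)%N -> (g * T)%:R <= B * hr ->
     `|\sum_(t < T) p (x ++> g%:Z * (t : nat)%:Z)| <= tau) ->
  d ^+ 2 * (#|{: {ffun 'I_k -> 'I_A0}}|%:R * A0%:R * n * hr)
     <= first_sum e H nu p c0 i lam ->
  d ^+ 272 * (B * hr) <= tau.
Proof.
move=> n0 p_tau first.
have d0 := d_gt0; have d1 := d_small; have hr0 : 0 < hr := height_gt0 pr.
have M1 := M_ge1; have dge0 j : 0 <= d ^+ j by rewrite exprn_ge0 // ltW.
have dgt0 j : 0 < d ^+ j by rewrite exprn_gt0.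
have dle1 j : d ^+ j <= 1 by have := expr_small (leq0n j); rewrite expr0.
have k1 : 1 <= k%:R ^+ 2 :> R by rewrite -natrX ler1n expn_gt0 ltnW.
have Mk1 : 1 <= M ^+ (2 * k) by rewrite exprn_ege1.
have M2k : M ^+ 2 <= M ^+ (2 * k) by rewrite ler_weXn2l // leq_pmulr // ltnW.
have kM1 : M ^+ (2 * k) <= k%:R ^+ 2 * M ^+ (2 * k).
  by rewrite ler_peMl // (le_trans ler01).
have B1 : 1 <= d ^+ 140 * B by apply: le_trans M_B; lra.
have B0 : 0 < B by rewrite -(pmulr_rgt0 _ (dgt0 140%N)); lra.
have A0r : 0 < A0%:R :> R by apply: lt_le_trans B_A0.
have M_A0 : k%:R ^+ 2 * M ^+ (2 * k) <= d ^+ 140 * A0%:R.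
  by apply: le_trans M_B _; rewrite ler_wpM2l.
have large : 2 * k%:R ^+ 2 * M ^+ (2 * k) <= A0%:R.
  rewrite -mulrA; apply: le_trans (_ : 2 * (d ^+ 140 * A0%:R) <= _).
    by rewrite ler_wpM2l.
  rewrite mulrA ler_piMl ?(ltW A0r) //.
  have := expr_step 139; have := dle1 139%N; have := dge0 140%N; lra.
have stage1 := sum_pair_corr_ge pr p_nu nu_M M_ge1 lam_le1 k_gt1 kK A0_cm A0_am large
   (dge0 2%N) n0 _ first.
have {stage1}stage1 : (d ^+ 2) ^+ 4 / 36 * (A0%:R ^+ 2 * n ^+ 2 * hr ^+ 2) <=
    \sum_(t < A0) \sum_(t' < A0) self_corr e H p ((t' : nat)%:Z - (t : nat)%:Z) ^+ 2.
  apply: stage1; rewrite -exprM.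
  have : 24 * k%:R ^+ 2 * M ^+ (2 * k) / A0%:R <= 24 * d ^+ 140.
    by rewrite ler_pdivrMr //; move: M_A0; lra.
  have := expr_small (isT : (10 <= 140)%N); have := expr_small (isT : (10 <= 182)%N).
  have := expr_step 8; have := expr_step 9; have := eta_small; have := dge0 10%N.
  rewrite (_ : 2 * 4 = 8)%N //; set x := _ / A0%:R; lra.
have reduce (A : nat) : (0 < A <= A0)%N ->
   d ^+ 9 * (A%:R ^+ 2 * n ^+ 2 * hr ^+ 2) <=
    \sum_(b < A) \sum_(b' < A) self_corr e H p ((b' : nat)%:Z - (b : nat)%:Z) ^+ 2.
  move=> AA0; have A0' : 0 < A%:R :> R by rewrite ltr0n; case/andP: AA0.
  have := le_trans stage1 (pigeonhole e H p AA0); set U := \sum_(b < A) _ => le1.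
  have c : 0 < 4 * (A0%:R / A%:R) ^+ 2 :> R by rewrite mulr_gt0 ?exprn_gt0 ?divr_gt0.
  rewrite -(ler_pM2l c); apply: le_trans le1.
  have -> : 4 * (A0%:R / A%:R) ^+ 2 * (d ^+ 9 * (A%:R ^+ 2 * n ^+ 2 * hr ^+ 2)) =
     4 * d ^+ 9 * (A0%:R ^+ 2 * n ^+ 2 * hr ^+ 2) by field; rewrite gt_eqF.
  rewrite ler_wpM2r ?mulr_ge0 ?exprn_ge0 ?(ltW hr0) ?(ltW n0) // -exprM.
  by have := expr_step 8; have := dge0 9%N; lra.
(* It is enough to find a length [A] not much below [B] that is far from [H] in size. The lower
   bound $d^{95}B$ accounts for $140=45+95$ in [M_B] and, with one power to spare, for
   $272=176+96$. *)
have scale (A : nat) : d ^+ 95 * B <= A%:R -> A%:R <= B ->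
   (exists P Q, [/\ (P = A /\ Q = H) \/ (P = H /\ Q = A), 1 <= d ^+ 45 * P%:R
      & P%:R <= d ^+ 46 * Q%:R]) -> d ^+ 272 * (B * hr) <= tau.
  move=> BA AB [P [Q [PQ dP PdQ]]].
  have A1 : 0 < A%:R :> R by apply: lt_le_trans BA; rewrite mulr_gt0.
  have AA0 : (A <= A0)%N by rewrite -(ler_nat R) (le_trans AB).
  have A_gt0 : (0 < A)%N by rewrite -(ltr0n R).
  apply: le_trans (progression_of_blocks PQ _ _ n0 _ dP PdQ _ _).
  - rewrite mulrA mulrA ler_wpM2r ?(ltW hr0) //.
    rewrite (_ : 272 = 176 + 96)%N // exprD -mulrA ler_wpM2l //.
    by apply: le_trans BA; rewrite ler_wpM2r ?(ltW B0) // expr_small.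
  - by rewrite A_gt0 (leq_trans AA0) // (leq_trans _ A0_cm) // leq_addr.
  - by apply: leq_trans A0H_am; rewrite leq_mul2l leq_mul2r AA0 orbT.
  - apply: le_trans M2k _; apply: le_trans kM1 _; apply: le_trans M_B _.
    by rewrite (_ : 140 = 45 + 95)%N // exprD -mulrA ler_wpM2l.
  - move=> x g T g0 gT; apply: p_tau => //.
    apply: le_trans (_ : (A * H)%:R <= _); first by rewrite ler_nat.
    by rewrite natrM ler_wpM2r // ltW.
  - rewrite exchange_big /=; apply: reduce; rewrite A_gt0 //.
have B_big : 200 <= B.
  have := expr_step 0; rewrite expr0 => s0.
  have : d ^+ 140 * B <= d ^+ 1 * B by rewrite ler_wpM2r ?(ltW B0) // expr_small.
  have : d ^+ 1 * B <= 200^-1 * B by rewrite ler_wpM2r ?(ltW B0) //.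
  lra.
have [HB|BH] := lerP hr (d ^+ 47 * B).
  have /andP[t1 t2] := truncn_itv (ltW B0).
  have AE : B < (Num.truncn B)%:R + 1 by rewrite natr1.
  have BA j : (0 < j)%N -> d ^+ j * B <= (Num.truncn B)%:R.
    move=> j0; have : d ^+ j * B <= d ^+ 1 * B by rewrite ler_wpM2r ?(ltW B0) // expr_small.
    have : d ^+ 1 * B <= 200^-1 * B by rewrite ler_wpM2r ?(ltW B0) //.
    lra.
  apply: (scale (Num.truncn B)) => //; first exact: BA.
  exists H, (Num.truncn B); split => //; first by right.
  apply: le_trans HB _; rewrite (_ : 47 = 46 + 1)%N // exprD -mulrA ler_wpM2l //.
  exact: BA.
(* Here [H] exceeds $d^{47}B$; the exponent $94=47+47$ gives $A\le d^{47}(d^{47}B)\le d^{47}H$, so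
   [A] is the short side. *)
have x0 : 0 <= d ^+ 94 * B by rewrite mulr_ge0 // ltW.
have /andP[t1 t2] := truncn_itv x0; set A := Num.truncn _ in t1 t2.
have AE : d ^+ 94 * B < A%:R + 1 by rewrite natr1.
have BA : d ^+ 95 * B <= A%:R.
  have : 200 * d ^+ 95 * B <= d ^+ 94 * B by rewrite ler_wpM2r ?(ltW B0) // expr_step.
  have : d ^+ 140 * B <= d ^+ 95 * B by rewrite ler_wpM2r ?(ltW B0) // expr_small.
  lra.
apply: (scale A) => //.
  by apply: le_trans t1 _; rewrite ler_piMl // ltW.
exists A, H; split; first by left.
  apply: le_trans B1 _; rewrite (_ : 140 = 45 + 95)%N // exprD -mulrA ler_wpM2l //.
apply: le_trans t1 _; apply: le_trans (_ : d ^+ 47 * (d ^+ 47 * B) <= _).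
  by rewrite mulrA -exprD.
apply: le_trans (_ : d ^+ 47 * hr <= _); first by rewrite ler_wpM2l // ltW.
by rewrite ler_wpM2r ?(ltW hr0) // expr_small.
Qed.

End ProgressionBound.

Local Open Scope classical_set_scope.
Local Open Scope ring_scope.

(** * From finitely supported integer sums to sums over a cyclic group *)

Section FiniteSums.

Variables (T : finType) (U : choiceType) (f : T -> U).
Hypothesis f_inj : injective f.

Lemma fsum_codom (S : nmodType) (F : U -> S) :
  \sum_(u \in [set` codom f]) F u = \sum_t F (f t).
Proof.
have uf : uniq (codom f) by rewrite map_inj_uniq ?enum_uniq.
by rewrite -(fsbig_seq _ _ uf) big_map big_enum.
Qed.

Lemma fsum_support (S : nmodType) (A : set U) (F : U -> S) :
  (forall t, A (f t)) -> (forall u, A u -> F u <> 0 -> exists t, f t = u) ->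
  \sum_(u \in A) F u = \sum_t F (f t).
Proof.
move=> Af FA; rewrite -fsum_codom; apply/esym/fsbig_widen.
  by move=> u /= /codomP[t ->].
move=> u /= [Au nu]; apply: contrapT => /(FA u Au)[t tu].
by apply: nu; rewrite -tu codom_f.
Qed.

Lemma ncard_codom (A : set U) :
  (forall t, A (f t)) -> (forall u, A u -> exists t, f t = u) -> ncard A = #|T|.
Proof.
move=> Af fA; have -> : A = [set` [fset x in codom f]%fset].
  apply/seteqP; split => u /=; rewrite !inE.
    by move/fA => [t <-]; exact: codom_f.
  by move=> /codomP[t ->].
rewrite /ncard set_fsetK card_imfset //= undup_id ?size_codom //.
by rewrite map_inj_uniq ?enum_uniq.
Qed.

End FiniteSums.

Section Embedding.
Variable W : nat.
Hypothesis W1 : (1 < W)%N.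

Definition lift (x : 'Z_W) : int := (x : nat)%:Z.

Lemma lift_ge0 x : 0 <= lift x. Proof. by []. Qed.

Lemma lift_lt x : lift x < W%:Z.
Proof. by rewrite ltz_nat -[X in (_ < X)%N](Zp_cast W1) ltn_ord. Qed.

Lemma liftK x : (lift x)%:~R = x.
Proof. by rewrite /lift -pmulrn natr_Zp. Qed.

Lemma lift_intr (z : int) : 0 <= z < W%:Z -> lift z%:~R = z.
Proof.
case: z => // m; rewrite ltz_nat => /andP[_ mW].
by rewrite /lift -pmulrn val_Zp_nat // modn_small.
Qed.

Lemma lift_inj : injective lift.
Proof. exact: can_inj liftK. Qed.

Lemma natrW_eq0 : W%:R = 0 :> 'Z_W.
Proof. by apply: val_inj; rewrite /= val_Zp_nat // modnn. Qed.

Definition embed (S : Type) (F : int -> S) (x : 'Z_W) : S := F (lift x).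

(** No wrap-around: a negative [z] above [n - W] is represented by [z + W > n], where [F] vanishes,
    as it does at [z]. *)
Lemma embed_intr (S : nmodType) (F : int -> S) (n : nat) (z : int) :
  (forall y : int, ~ (1 <= y <= n%:Z) -> F y = 0) ->
  n%:Z - W%:Z < z -> z < W%:Z -> embed F z%:~R = F z.
Proof.
move=> F0 nz zW; rewrite /embed; have [z0|z0] := leP 0 z.
  by rewrite lift_intr // z0.
have -> : z%:~R = (z + W%:Z)%:~R :> 'Z_W by rewrite intrD -pmulrn natrW_eq0 addr0.
rewrite lift_intr; last by lia.
by rewrite !F0 //; lia.
Qed.

Lemma sum_embed (S : nmodType) (F : int -> S) (n : nat) : (n < W)%N ->
  (forall y : int, ~ (1 <= y <= n%:Z) -> F y = 0) ->
  \sum_x embed F x = \sum_(j < n) F (j : nat).+1%:Z.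
Proof.
move=> nW F0.
have f_inj : injective (fun j : 'I_n => (j : nat).+1%:Z) by move=> i j [] /val_inj.
rewrite -(fsum_support lift_inj (A := [set: int])) //.
  rewrite (fsum_support f_inj (A := [set: int])) // => u _ /eqP Fu.
  have u1 : 1 <= u <= n%:Z.
    by apply: contrapT => /F0 /eqP; rewrite (negbTE Fu).
  have un : (absz u - 1 < n)%N by lia.
  by exists (Ordinal un) => /=; lia.
move=> u _ Fu; exists u%:~R; rewrite lift_intr //.
have u1 : 1 <= u <= n%:Z by apply: contrapT => /F0.
lia.
Qed.

(* Every residue class has exactly one representative in [-Z, W - Z[. *)
Lemma fsum_window (S : nmodType) (F : int -> S) (Z : nat) :
  (forall y : int, ~ (- Z%:Z <= y < W%:Z - Z%:Z) -> F y = 0) ->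
  \sum_(y \in [set: int]) F y = \sum_(x : 'Z_W) F (lift (x + Z%:R) - Z%:Z).
Proof.
move=> F0; apply: fsum_support => //.
  by move=> x y /addIr /lift_inj /addIr.
move=> u _ Fu; exists u%:~R.
have uZ : - Z%:Z <= u < W%:Z - Z%:Z by apply: contrapT => /F0.
have -> : u%:~R + Z%:R = (u + Z%:Z)%:~R :> 'Z_W by rewrite intrD -pmulrn.
by rewrite lift_intr ?addrK //; lia.
Qed.

End Embedding.

Section Bracket.

Variables (R : realType) (N : R).
Hypothesis N1 : 1 <= N.

Definition nfloor : nat := absz (Num.floor N).

Lemma floorE : Num.floor N = nfloor%:Z.
Proof. by rewrite /nfloor gez0_abs // floor_ge0 (le_trans ler01). Qed.

Lemma bracketE (y : int) : bracket N y <-> 1 <= y <= nfloor%:Z.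
Proof. by rewrite /bracket /= floorE. Qed.

Lemma nfloor_gt0 : (0 < nfloor)%N.
Proof.
have : 1%:Z <= Num.floor N by rewrite floor_ge_int.
by rewrite floorE; lia.
Qed.

Lemma nfloor_le : nfloor%:R <= N.
Proof. by rewrite pmulrn -floorE floor_le_tmp. Qed.

Lemma nfloor_ge : N <= 2 * nfloor%:R.
Proof.
have : N < (Num.floor N + 1)%:~R by rewrite floorD1_gt.
rewrite floorE intrD -pmulrn => h.
have : 1 <= nfloor%:R :> R by rewrite ler1n nfloor_gt0.
lra.
Qed.

Lemma succ_inj (n : nat) : injective (fun j : 'I_n => (j : nat).+1%:Z).
Proof. by move=> i j [] /val_inj. Qed.

Lemma fsum_bracket (S : nmodType) (F : int -> S) :
  \sum_(y \in bracket N) F y = \sum_(j < nfloor) F (j : nat).+1%:Z.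
Proof.
apply: (fsum_support (@succ_inj nfloor)) => [t|u /bracketE u1 _].
  by apply/bracketE; have := ltn_ord t; lia.
have un : (absz u - 1 < nfloor)%N by lia.
by exists (Ordinal un) => /=; lia.
Qed.

Lemma ncard_bracket : ncard (bracket N) = nfloor.
Proof.
rewrite (ncard_codom (@succ_inj nfloor)) ?card_ord // => [t|u /bracketE u1].
  by apply/bracketE; have := ltn_ord t; lia.
have un : (absz u - 1 < nfloor)%N by lia.
by exists (Ordinal un) => /=; lia.
Qed.

End Bracket.


Lemma absz_sub_le (a b : int) (m : nat) :
  (absz a <= m)%N -> (absz b <= m)%N -> (absz (a - b)%R <= 2 * m)%N.
Proof. lia. Qed.

(** * The linear forms condition gives pseudorandomness in the cyclic group *)

Section LinearFormsTransfer.

Variables (R : realType) (N K L eta : R) (H : nat) (nu : int -> R).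
Hypothesis N1 : 1 <= N.
Hypothesis H_gt0 : (0 < H)%N.
Hypothesis nu_ge0 : forall y, 0 <= nu y.
Hypothesis nu_out : forall y, ~ bracket N y -> nu y = 0.
Variables (W K' am cm : nat).
Hypothesis W1 : (1 < W)%N.
Local Notation n := (nfloor N).
Hypothesis W_large : (n + 2 * (am + 4 * (cm * H)) < W)%N.

Local Notation one := (\1_(bracket N) : int -> R).

Lemma indic_out (y : int) : ~ bracket N y -> one y = 0.
Proof. by move=> Ny; rewrite indicE memNset. Qed.

Lemma indic_in (y : int) : bracket N y -> one y = 1.
Proof. by move=> Ny; rewrite indicE mem_set. Qed.

Definition coef (f : form) (t : 'I_4) : int :=
  nth 0 [:: f.2.1.1.1; f.2.1.1.2; f.2.1.2; f.2.2] t.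

Definition quad_point (h : quad H) : {ffun 'I_4 -> int} :=
  [ffun t : 'I_4 => (nth 0%N [:: h.1.1.1 : nat; h.1.1.2 : nat; h.1.2 : nat; h.2 : nat] t).+1%:Z].

(* Averages over [1, H] instead of [0, H - 1] shift the constant terms. *)
Definition base (f : form) : int := f.1 - \sum_(t < 4) coef f t.

Lemma form_valueE (f : form) (h : quad H) (x : int) :
  x + form_value f h = x + base f + \sum_(t < 4) coef f t * quad_point h t.
Proof.
rewrite /base /form_value !big_ord_recl !big_ord0 /coef /quad_point !ffunE /=.
rewrite !intS; ring.
Qed.

Lemma absz_form_value (f : form) (h : quad H) :
  small_form am cm f -> (absz (form_value f h) <= am + 4 * (cm * H))%N.
Proof.
case/and5P => f0 f1 f2 f3 f4.
have b (c : int) (i : 'I_H) : (absz c <= cm)%N -> (absz (c * (i : nat)%:Z)%R <= cm * H)%N.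
  by move=> cc; rewrite abszM leq_mul //= ltnW.
have := b _ h.1.1.1 f1; have := b _ h.1.1.2 f2; have := b _ h.1.2 f3; have := b _ h.2 f4.
rewrite /form_value; move: f0 (_ * _) (_ * _) (_ * _) (_ * _) => *; lia.
Qed.

Lemma absz_coef (f : form) t : small_form am cm f -> (absz (coef f t) <= cm)%N.
Proof. by case/and5P=> _ ? ? ? ?; case: t => -[|[|[|[|]]]]. Qed.

Lemma absz_base (f : form) : small_form am cm f -> (absz (base f) <= am + 4 * cm)%N.
Proof.
case/and5P => f0 f1 f2 f3 f4; rewrite /base !big_ord_recl big_ord0 /coef /=.
by move: f.1 f.2.1.1.1 f.2.1.1.2 f.2.1.2 f.2.2 f0 f1 f2 f3 f4; clear; lia.
Qed.

(** In the condition [x] runs over an interval inside $[N]$, here over the whole group. Translating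
    by the value of the first form [f0] makes its argument the variable, and the product vanishes
    unless that lies in $[N]$. The other forms become differences with [f0], which [W_large] keeps
    from wrapping around. *)
Lemma lf_sum_embed (w : bool -> int -> R) (f0 : bool * form) (l : seq (bool * form)) :
  (forall b y, ~ bracket N y -> w b y = 0) ->
  all (small_form am cm) (map snd (f0 :: l)) ->
  lf_sum (1 : 'Z_W) H (fun b => embed (w b)) (f0 :: l) =
  \sum_(h : quad H) \sum_(j < n) \prod_(f <- f0 :: l)
     w f.1 ((j : nat).+1%:Z + (form_value f.2 h - form_value f0.2 h)).
Proof.
move=> w0 small; apply: eq_bigr => h _.
have w0' b y : ~ (1 <= y <= n%:Z) -> w b y = 0.
  by move=> yn; apply: w0 => /(bracketE N1).
pose Psi z := \prod_(f <- f0 :: l) w f.1 (z + (form_value f.2 h - form_value f0.2 h)).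
have Psi0 z : ~ (1 <= z <= n%:Z) -> Psi z = 0.
  by move=> zn; rewrite /Psi big_cons subrr addr0 w0' ?mul0r.
have nW : (n < W)%N by apply: leq_ltn_trans W_large; rewrite leq_addr.
rewrite -(sum_embed W1 nW Psi0) -(sum_shift (- (form_value f0.2 h)%:~R : 'Z_W)).
apply: eq_bigr => x _; rewrite /lf_prod.
have shiftE (f : bool * form) : x - (form_value f0.2 h)%:~R + 1 *~ form_value f.2 h =
   (lift x + (form_value f.2 h - form_value f0.2 h))%:~R.
  by rewrite intrD liftK intrB addrA addrAC.
have [xn|xn] := boolP (1 <= lift x <= n%:Z); last first.
  rewrite [RHS]Psi0; last by apply/negP.
  rewrite big_cons shiftE subrr addr0 liftK /embed w0' ?mul0r //; exact/negP.
rewrite /embed /Psi; apply: eq_big_seq => f fl; rewrite shiftE.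
have := small; rewrite all_map => /allP small'.
have := absz_form_value h (small' _ fl).
have := absz_form_value h (small' _ (mem_head f0 l)).
move=> b0 b1; apply: (embed_intr W1 (w0' f.1)); lia.
Qed.

Lemma mass_embed : mass (embed one : 'Z_W -> R) = n%:R.
Proof.
have one0 y : ~ (1 <= y <= n%:Z) -> one y = 0.
  by move=> yn; apply: indic_out => /(bracketE N1).
have nW : (n < W)%N by apply: leq_ltn_trans W_large; rewrite leq_addr.
rewrite /mass (sum_embed W1 nW one0); transitivity (\sum_(j < n) 1 : R).
  apply: eq_bigr => j _; apply: indic_in; apply/(bracketE N1).
  by have := ltn_ord j; lia.
by rewrite sumr_const card_ord.
Qed.

Lemma quad_point_inj : injective quad_point.
Proof.
move=> [[[h1 h2] h3] h4] [[[h1' h2'] h3'] h4'] /ffunP E.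
have := E ord0; have := E (fintype.lift ord0 ord0).
have := E (fintype.lift ord0 (fintype.lift ord0 ord0)).
have := E (fintype.lift ord0 (fintype.lift ord0 (fintype.lift ord0 ord0))).
rewrite !ffunE /= => -[/val_inj ->] [/val_inj ->] [/val_inj ->] [/val_inj ->] //.
Qed.

Lemma quad_pointP (u : {ffun 'I_4 -> int}) :
  (forall t, 1 <= u t <= H%:Z) -> exists h, quad_point h = u.
Proof.
move=> uP; have P t : (absz (u t) - 1 < H)%N by have := uP t; lia.
pose v t : 'I_H := Ordinal (P t).
exists (v (inord 0), v (inord 1), v (inord 2), v (inord 3)); apply/ffunP => t.
rewrite ffunE; have := uP t.
have tE : t = inord t by apply/val_inj; rewrite /= inordK.
by case: t tE => -[|[|[|[|]]]] //= p ->; rewrite /=; lia.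
Qed.

Hypothesis lfc : linear_forms_condition K L eta N (N / H%:R) H nu.
Hypothesis K4 : 4 <= K.
Hypothesis K'K : K'%:R <= K.
Hypothesis K'8 : (8 <= K')%N.
Hypothesis L2 : 2 <= L.
Hypothesis am_small : (2 * (am + 4 * cm))%:R <= K * N.
Hypothesis cm_small : (2 * cm)%:R <= K * (N / H%:R).
Hypothesis eta_ge0 : 0 <= eta.
Hypothesis eta_le1 : eta <= 1.

Lemma avg_embed (w : bool -> int -> R) (f0 : bool * form) (l : seq (bool * form)) :
  (forall b y, ~ bracket N y -> w b y = 0) ->
  all (small_form am cm) (map snd (f0 :: l)) ->
  let g (j : 'I_(size l).+1) := nth f0 (f0 :: l) j in
  avg [set` `[1, n%:Z]] (fun x => avg (box (fun=> `[1, H%:Z])) (fun h =>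
     \prod_(j < (size l).+1) w (g j).1
        (linear_form (base (g j).2 - base f0.2)
           [ffun t => coef (g j).2 t - coef f0.2 t] x h)))
  = (n%:R * H%:R ^+ 4)^-1 * lf_sum (1 : 'Z_W) H (fun b => embed (w b)) (f0 :: l).
Proof.
move=> w0 small g.
have nE : [set` `[1, n%:Z]] = bracket N.
  apply/seteqP; split => y /=; rewrite in_itv /= => h; first exact/(bracketE N1).
  exact/(bracketE N1).
rewrite /avg nE ncard_bracket // fsum_bracket // (lf_sum_embed w0 small).
have boxP (u : {ffun 'I_4 -> int}) : box (fun=> `[1, H%:Z]) u -> exists h, quad_point h = u.
  by move=> bu; apply: quad_pointP => t; have := bu t; rewrite in_itv.
have boxQ (h : quad H) : box (fun=> `[1, H%:Z]) (quad_point h).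
  move=> t; rewrite ffunE in_itv /=.
  by case: t => -[|[|[|[|]]]] //= _; rewrite lez_nat.
rewrite (ncard_codom quad_point_inj boxQ boxP) !card_prod !card_ord invfM -mulrA.
congr (_ * _); rewrite exchange_big mulr_sumr /=; apply: eq_bigr => j _.
rewrite (fsum_support quad_point_inj boxQ) => [|u bu _]; last exact: boxP.
congr (_ * _); first by rewrite !natrM !exprS expr0 mulr1 !mulrA.
apply: eq_bigr => h _.
rewrite (big_nth f0) big_mkord; apply: eq_bigr => i _; rewrite -/(g i); congr (w _ _).
rewrite /linear_form; under eq_bigr do rewrite ffunE mulrBl.
rewrite sumrB; have := form_valueE (g i).2 h 0; have := form_valueE f0.2 h 0.
move: (form_value _ _) (form_value _ _) (\sum_t _) (\sum_t _) (base _) (base _).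
by move=> v v' s s' b b'; lia.
Qed.

(** Subtracting [f0] from every form keeps the coefficient vectors distinct and at most doubles the
    bounds on the coefficients, hence the factors 2 in [am_small] and [cm_small]. *)
Lemma pseudorandom_embed :
  pseudorandom (1 : 'Z_W) H (embed nu) (embed one) K' am cm eta.
Proof.
split=> //.
- by move=> x; exact: nu_ge0.
- by move=> x; rewrite /embed indicE lern1 leq_b1.
move=> [|f0 l] // sz small uniq_l.
pose g (j : 'I_(size l).+1) := nth f0 (f0 :: l) j.
pose w (b : bool) : int -> R := if b then nu else one.
have w0 b y : ~ bracket N y -> w b y = 0.
  by case: b => /= yN; [exact: nu_out | exact: indic_out].
have gP j : small_form am cm (g j).2.
  by move: small; rewrite all_map => /allP/(_ (g j)); apply; rewrite mem_nth.
have n0 : 0 < n%:R :> R by rewrite ltr0n nfloor_gt0.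
have Hr : 0 < H%:R :> R by rewrite ltr0n.
have f0P : small_form am cm f0.2 := proj1 (andP small).
have g0 : 0 < L := lt_le_trans (ltr0Sn R 1) L2.
have nE : [set` `[1, n%:Z]] = bracket N.
  apply/seteqP; split => y /=; rewrite in_itv /= => h; first exact/(bracketE N1).
  exact/(bracketE N1).
have HE : [set` `[1, H%:Z]] = bracket (H%:R : R).
  by apply/seteqP; split => y /=; rewrite in_itv /bracket /= pmulrn intrKfloor.
pose a j := base (g j).2 - base f0.2.
pose c j := [ffun t => coef (g j).2 t - coef f0.2 t].
have c1 : (1 <= (size l).+1)%N by [].
have c2 : (size l).+1%:R <= K.
  by apply: le_trans K'K; rewrite ler_nat; case/andP: sz.
have c3 : [set` `[1, n%:Z]] `<=` bracket N by rewrite nE.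
(* The interval taken is all of $[N]$, which has at least $N/2$ elements, so [L >= 2] is enough. *)
have c4 : N / L <= (ncard [set` `[1, n%:Z]])%:R.
  rewrite nE ncard_bracket // ler_pdivrMr //.
  apply: le_trans (nfloor_ge N1) _; rewrite mulrC.
  by have := L2; have := ltW n0; move=> ? ?; rewrite ler_wpM2l.
have c5 (t : 'I_4) : [set` `[1, H%:Z]] `<=` bracket (H%:R : R) by rewrite HE.
have c6 (t : 'I_4) : H%:R / L <= (ncard [set` `[1, H%:Z]])%:R :> R.
  rewrite HE ncard_bracket ?ler1n // /nfloor pmulrn intrKfloor /=.
  rewrite ler_pdivrMr // ler_peMr ?(ltW Hr) //; have := L2; lra.
have c7 j : `|a j|%:~R <= K * N.
  apply: le_trans am_small; rewrite -abszE -pmulrn ler_nat /a.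
  exact: absz_sub_le (absz_base (gP j)) (absz_base f0P).
have c8 j t : `|c j t|%:~R <= K * (N / H%:R).
  apply: le_trans cm_small; rewrite -abszE -pmulrn ler_nat /c ffunE.
  exact: absz_sub_le (absz_coef t (gP j)) (absz_coef t f0P).
have c9 : injective c.
  move=> j j' /ffunP E; apply/val_inj/eqP.
  have sz' : size (map snd (map snd (f0 :: l))) = (size l).+1 by rewrite !size_map.
  rewrite -(nth_uniq (0 : int, 0 : int, 0 : int, 0 : int) _ _ uniq_l) ?sz' ?ltn_ord //.
  rewrite -!map_comp !(nth_map f0) ?ltn_ord //= -!/(g _); apply/eqP.
  have E' t : coef (g j).2 t = coef (g j').2 t.
    by have := E t; rewrite !ffunE => /addIr.
  have := E' ord0; have := E' (fintype.lift ord0 ord0).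
  have := E' (fintype.lift ord0 (fintype.lift ord0 ord0)).
  have := E' (fintype.lift ord0 (fintype.lift ord0 (fintype.lift ord0 ord0))).
  rewrite /coef /=.
  by case: (g j).2.2 => [[[? ?] ?] ?]; case: (g j').2.2 => [[[? ?] ?] ?] /= -> -> -> ->.
have c10 j : w (g j).1 = nu \/ w (g j).1 = one.
  by rewrite /w; case: (g j).1; [left | right].
have := @lfc 4 _ `[1, n%:Z] (fun=> `[1, H%:Z]) a c (fun j => w (g j).1) K4 c1 c2 c3 c4 c5 c6 c7 c8 c9 c10.
rewrite (@avg_embed w f0 l w0 small).
rewrite (@avg_embed (fun=> one) f0 l (fun b y => @indic_out y) small).
rewrite -mulrBr normrM ger0_norm ?invr_ge0 ?mulr_ge0 ?exprn_ge0 //.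
rewrite mulrC ler_pdivrMr ?mulr_gt0 ?exprn_gt0 // mass_embed mulrA.
have -> // : lf_sum (1 : 'Z_W) H (fun b => embed (w b)) (f0 :: l) =
   lf_sum (1 : 'Z_W) H (weight (embed nu) (embed one)) (f0 :: l).
apply: eq_bigr => h _; apply: eq_bigr => x _; apply: eq_bigr => f _.
by rewrite /w /weight; case: f.1.
Qed.

End LinearFormsTransfer.

Local Open Scope classical_set_scope.
Local Open Scope ring_scope.

(** * Moduli, real parts and imaginary parts *)

Section Modulus.

Variable R : realType.

Local Notation re := (@complex.Re R).
Local Notation im := (@complex.Im R).

Lemma modulus_ge0 (z : R[i]) : 0 <= modulus z.
Proof. by case: z => a b; rewrite /= sqrtr_ge0. Qed.

Lemma modulus_sum (I : Type) (r : seq I) (P : pred I) (F : I -> R[i]) :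
  modulus (\sum_(i <- r | P i) F i) <= \sum_(i <- r | P i) modulus (F i).
Proof.
elim/big_ind2 : _ => [|x1 x2 y1 y2 h1 h2|//]; first by rewrite ComplexField.Normc.normc0.
by apply: le_trans (le_normcD _ _) _; rewrite lerD.
Qed.

Lemma modulus_prod (I : Type) (r : seq I) (P : pred I) (F : I -> R[i]) :
  modulus (\prod_(i <- r | P i) F i) = \prod_(i <- r | P i) modulus (F i).
Proof.
elim/big_rec2 : _ => [|i x y _ <-]; first exact: ComplexField.Normc.normc1.
exact: ComplexField.Normc.normcM.
Qed.

Lemma Re_le_modulus (z : R[i]) : `|re z| <= modulus z.
Proof. by case: z => a b /=; rewrite -sqrtr_sqr ler_wsqrtr // lerDl sqr_ge0. Qed.

Lemma Im_le_modulus (z : R[i]) : `|im z| <= modulus z.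
Proof. by case: z => a b /=; rewrite -sqrtr_sqr ler_wsqrtr // lerDr sqr_ge0. Qed.

Lemma modulus_le_ReIm (z : R[i]) : modulus z <= `|re z| + `|im z|.
Proof.
case: z => a b /=; rewrite -[leRHS]ger0_norm ?addr_ge0 // -sqrtr_sqr ler_wsqrtr //.
rewrite sqrrD !real_normK ?num_real // addrAC lerDl.
by rewrite mulrn_wge0 // mulr_ge0.
Qed.

Lemma Re_sum (I : Type) (r : seq I) (P : pred I) (F : I -> R[i]) :
  re (\sum_(i <- r | P i) F i) = \sum_(i <- r | P i) re (F i).
Proof. by elim/big_rec2 : _ => // i x [a b] _ <-; case: (F i). Qed.

Lemma Im_sum (I : Type) (r : seq I) (P : pred I) (F : I -> R[i]) :
  im (\sum_(i <- r | P i) F i) = \sum_(i <- r | P i) im (F i).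
Proof. by elim/big_rec2 : _ => // i x [a b] _ <-; case: (F i). Qed.

(** Reduces complex [lambda] and [f i] to real functions: one of the four real sums carries at least
    a quarter of the total. *)
Lemma modulus_sum_mul (I : finType) (F G : I -> R[i]) :
  modulus (\sum_i F i * G i) <=
    `|\sum_i re (F i) * re (G i)| + `|\sum_i im (F i) * im (G i)| +
    `|\sum_i re (F i) * im (G i)| + `|\sum_i im (F i) * re (G i)|.
Proof.
apply: le_trans (modulus_le_ReIm _) _; rewrite Re_sum Im_sum -addrA; apply: lerD.
  rewrite (_ : \sum_i _ = \sum_i re (F i) * re (G i) - \sum_i im (F i) * im (G i)).
    exact: ler_normB.
  by rewrite -sumrB; apply: eq_bigr => i _; case: (F i) => ? ?; case: (G i) => ? ?.
rewrite (_ : \sum_i _ = \sum_i re (F i) * im (G i) + \sum_i im (F i) * re (G i)).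
  exact: ler_normD.
by rewrite -big_split; apply: eq_bigr => i _; case: (F i) => ? ?; case: (G i) => ? ?.
Qed.

End Modulus.

(* A progression meets an interval in a progression of the same step. *)
Lemma progression_sum (S : nmodType) (F : int -> S) (n T g : nat) (X : int) :
  (0 < g)%N -> (forall y : int, ~ (1 <= y <= n%:Z) -> F y = 0) ->
  exists (a : int) (l : nat),
    (forall i : nat, (i < l)%N -> 1 <= a + i%:Z * g%:Z <= n%:Z) /\
    \sum_(t < T) F (X + g%:Z * (t : nat)%:Z) = \sum_(i < l) F (a + (i : nat)%:Z * g%:Z).
Proof.
move=> g0 F0; elim: T X => [|T IH] X.
  by exists 0, 0%N; split => //; rewrite !big_ord0.
have [X1|X1] := boolP (1 <= X <= n%:Z); last first.
  have [a [l [al Fal]]] := IH (X + g%:Z); exists a, l; split => //; rewrite -Fal.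
  rewrite big_ord_recl mulr0 addr0 F0 ?add0r; last exact/negP.
  by apply: eq_bigr => t _; congr F; rewrite /bump /= intS; ring.
have [XT|XT] := leP (X + g%:Z * T%:Z) n%:Z.
  exists X, T.+1; split; last by apply: eq_bigr => t _; rewrite mulrC.
  by move=> j jT; nia.
have [a [l [al Fal]]] := IH X; exists a, l; split => //; rewrite -Fal.
rewrite big_ord_recr /= [X in _ + X]F0 ?addr0 //; lia.
Qed.

(** * Progressions and the norm [U1plus] *)

Section UniformityNorm.

Variables (R : realType) (N : R).
Hypothesis N1 : 1 <= N.
Local Notation n := (nfloor N).

Lemma Rsup_ub (nu : int -> R) (y : int) : bracket N y -> `|nu y| <= Rsup N nu.
Proof.
move=> Ny; rewrite /Rsup le_max; apply/orP; right.
apply: ub_le_sup; last by exists y.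
exists (\sum_(j < n) `|nu (j : nat).+1%:Z|) => _ [z /(bracketE N1) zn <-].
have zj : (absz z - 1 < n)%N by lia.
rewrite (bigD1 (Ordinal zj)) //= (_ : (absz z - 1).+1%:Z = z); last by lia.
by rewrite lerDl sumr_ge0.
Qed.

Lemma U1plus_ub (f : int -> R[i]) (P : set int) :
  arith_prog P -> P `<=` bracket N ->
  modulus (\sum_(y \in P) f y) <= n%:R * U1plus N f.
Proof.
move=> aP PN; rewrite /U1plus ncard_bracket // mulrA mulfV ?mul1r; last first.
  by rewrite pnatr_eq0 -lt0n nfloor_gt0.
apply: ub_le_sup; last by exists P.
exists (\sum_(j < n) modulus (f (j : nat).+1%:Z)) => _ [Q [aQ QN] <-].
rewrite -(setIidr QN) fsbig_mkcondr fsum_bracket //.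
apply: le_trans (modulus_sum _ _ _) _; apply: ler_sum => j _.
by case: ifP => // _; rewrite ComplexField.Normc.normc0 modulus_ge0.
Qed.

Lemma progression_U1plus (f : int -> R[i]) (X : int) (T g : nat) :
  (0 < g)%N -> (forall y, ~ bracket N y -> f y = 0) ->
  modulus (\sum_(t < T) f (X + g%:Z * (t : nat)%:Z)) <= n%:R * U1plus N f.
Proof.
move=> g0 f0; have f0' y : ~ (1 <= y <= n%:Z) -> f y = 0.
  by move=> yn; apply: f0 => /(bracketE N1).
have [a [l [al ->]]] := progression_sum T X g0 f0'.
pose P := [set a + i%:Z * g%:Z | i in [set i : nat | (i < l)%N]].
have f_inj : injective (fun i : 'I_l => a + (i : nat)%:Z * g%:Z).
  by move=> i j /addrI E; apply/val_inj => /=; nia.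
have <- : \sum_(y \in P) f y = \sum_(i < l) f (a + (i : nat)%:Z * g%:Z).
  apply: (fsum_support f_inj) => [i|u [i il <-] _]; first by exists (i : nat) => //=; exact: ltn_ord.
  by exists (Ordinal il).
apply: U1plus_ub; first by exists a, g%:Z, l.
by move=> u [i il <-]; apply/(bracketE N1); exact: al.
Qed.

End UniformityNorm.

Lemma nfloor_lt (R : realType) (N : R) : 1 <= N -> N < (nfloor N)%:R + 1.
Proof.
move=> N1; have : N < (Num.floor N + 1)%:~R by rewrite floorD1_gt.
by rewrite floorE // intrD -pmulrn.
Qed.

Lemma nfloor_nat (R : realType) (H : nat) : nfloor (H%:R : R) = H.
Proof. by rewrite /nfloor pmulrn intrKfloor. Qed.

(** * The counting operator in the cyclic group *)

Section Counting.

Variables (R : realType) (N : R) (k H W c0 : nat).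
Variables (lambda : {ffun 'I_k -> int} -> R[i]) (f : 'I_k -> int -> R[i]).
Hypothesis N1 : 1 <= N.
Hypothesis H_gt0 : (0 < H)%N.
Hypothesis W1 : (1 < W)%N.
Local Notation n := (nfloor N).
Local Notation F := {ffun 'I_k -> 'I_(2 * c0).+1}.
Hypothesis W_large : (n + 2 * (c0 * H) < W)%N.
Hypothesis lambda_out : forall b, lambda b <> 0 -> forall j, (absz (b j) <= c0)%N.
Hypothesis f_out : forall j y, ~ bracket N y -> f j y = 0.

Definition offsets (b : F) : {ffun 'I_k -> int} := [ffun j => offset c0 (b j)].

Lemma offsets_inj : injective offsets.
Proof.
move=> b b' /ffunP E; apply/ffunP => j; have := E j; rewrite !ffunE.
exact: offset_inj.
Qed.

Lemma offsetsP (b : {ffun 'I_k -> int}) :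
  (forall j, (absz (b j) <= c0)%N) -> exists t, offsets t = b.
Proof.
move=> bc; have P j : (absz (b j + c0%:Z)%R < (2 * c0).+1)%N by have := bc j; lia.
exists [ffun j => Ordinal (P j)]; apply/ffunP => j; rewrite !ffunE /offset /=.
by have := bc j; lia.
Qed.

Lemma absz_offset (t : 'I_(2 * c0).+1) : (absz (offset c0 t) <= c0)%N.
Proof. by rewrite /offset; have := ltn_ord t; lia. Qed.

(** The factor of index [i] vanishes unless $1\le x+b_im\le n$, which confines [x] to a window of
    fewer than [W] integers starting from [-c0 H]; there the embedding is exact. *)
Lemma counting_op_embed (i : 'I_k) :
  counting_op H lambda f = \sum_(b : F) lambda (offsets b) *
    \sum_(z : 'I_H * 'Z_W) \prod_(j < k) embed (f j) (point 1 c0 (b j) z).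
Proof.
rewrite /counting_op (fsum_support offsets_inj) //; last first.
  move=> u _ Fu; apply: offsetsP; apply: lambda_out => l0.
  by apply: Fu; rewrite l0 mul0r.
apply: eq_bigr => b _; congr (_ * _).
have f_out' j y : ~ (1 <= y <= n%:Z) -> f j y = 0.
  by move=> yn; apply: f_out => /(bracketE N1).
have small (j : 'I_k) (m : 'I_H) : (absz (offset c0 (b j) * (m : nat).+1%:Z)%R <= c0 * H)%N.
  by rewrite abszM leq_mul ?absz_offset //=; exact: ltn_ord.
have -> : \sum_(x \in [set: int]) \sum_(m \in bracket (H%:R : R))
     \prod_(j < k) f j (x + offsets b j * m) =
   \sum_(x \in [set: int]) \sum_(m < H) \prod_(j < k) f j (x + offset c0 (b j) * (m : nat).+1%:Z).
  apply: eq_fsbigr => x _; rewrite fsum_bracket ?ler1n // nfloor_nat.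
  by apply: eq_bigr => m _; apply: eq_bigr => j _; rewrite ffunE.
rewrite (@fsum_window W W1 _ _ (c0 * H)); last first.
  move=> y yW; apply: big1 => m _; rewrite (bigD1 i) //= f_out' ?mul0r //.
  by have := small i m; move: (_ * _) => v; move: yW W_large; lia.
rewrite sum_pair exchange_big /=; apply: eq_bigr => m _; apply: eq_bigr => x _.
apply: eq_bigr => j _; set y := _ - _.
have yE : y%:~R = x.
  by rewrite /y intrB liftK // -pmulrn addrK.
have -> : point 1 c0 (b j) (m, x) = (y + offset c0 (b j) * (m : nat).+1%:Z)%:~R.
  by rewrite intrD yE.
rewrite (embed_intr W1 (f_out' j)) //.
  have := small j m; have := lift_ge0 (x + (c0 * H)%:R).
  by rewrite /y; move: (lift _) (_ * _) => u v; move: W_large; lia.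
have := small j m; have := lift_lt W1 (x + (c0 * H)%:R).
by rewrite /y; move: (lift _) (_ * _) => u v; lia.
Qed.

Variable nu : int -> R.
Hypothesis f_nu : forall j y, modulus (f j y) <= nu y.

(** Resampling the [i]-th coordinate of [b] costs the factor [2 c0 + 1]. Only [lambda] and [f i] see
    the new value [t]; the other factors come out and are bounded by [nu]. *)
Lemma counting_op_le (i : 'I_k) :
  (2 * c0).+1%:R * modulus (counting_op H lambda f) <=
   \sum_(b : F) \sum_(z : 'I_H * 'Z_W) fiber_prod 1 c0 i (embed nu) b z *
     modulus (\sum_t lambda (offsets (update i b t)) * embed (f i) (point 1 c0 t z)).
Proof.
rewrite (counting_op_embed i) mulr_natl -normcMn -(sum_update_mulrn i).
apply: le_trans (modulus_sum _ _ _) _; apply: ler_sum => b _.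
have -> : \sum_t lambda (offsets (update i b t)) *
    (\sum_(z : 'I_H * 'Z_W) \prod_(j < k) embed (f j) (point 1 c0 (update i b t j) z)) =
   \sum_(z : 'I_H * 'Z_W) (\prod_(j < k | j != i) embed (f j) (point 1 c0 (b j) z)) *
     \sum_t lambda (offsets (update i b t)) * embed (f i) (point 1 c0 t z).
  under eq_bigr do rewrite mulr_sumr; rewrite exchange_big /=.
  apply: eq_bigr => z _; rewrite mulr_sumr; apply: eq_bigr => t _.
  rewrite (bigD1 i) //= update_at [RHS]mulrC -mulrA; congr (_ * (_ * _)).
  by apply: eq_bigr => j ji; rewrite ffunE (negbTE ji).
apply: le_trans (modulus_sum _ _ _) _; apply: ler_sum => z _.
rewrite ComplexField.Normc.normcM ler_wpM2r ?modulus_ge0 // modulus_prod.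
by apply: ler_prod => j _; rewrite modulus_ge0 f_nu.
Qed.

End Counting.

Local Open Scope classical_set_scope.
Local Open Scope ring_scope.

Lemma window_large (n a c : nat) :
  [/\ (n + 2 * a < (2 * n + 2 * a + 2 * c).+2)%N, (n + 2 * c < (2 * n + 2 * a + 2 * c).+2)%N
   & (2 * n < (2 * n + 2 * a + 2 * c).+2)%N].
Proof. by split; lia. Qed.

Lemma box_sizes (c A H : nat) : A = (2 * c).+1 -> (0 < H)%N ->
  [/\ (A + c <= 2 * A)%N, (A + c <= 9 * (A * H))%N
   & (2 * (9 * (A * H) + 4 * (2 * A)) <= 34 * (A * H))%N].
Proof.
move=> -> H0; have AH : ((2 * c).+1 <= (2 * c).+1 * H)%N by rewrite leq_pmulr.
by move: ((2 * c).+1 * H)%N AH => AH; split; lia.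
Qed.

Lemma four_le (R : realDomainType) (a b c d s : R) : 4 * s <= a + b + c + d ->
  [\/ s <= a, s <= b, s <= c | s <= d].
Proof.
move=> h; have [?|sa] := leP s a; first by constructor.
have [?|sb] := leP s b; first by constructor.
have [?|sc] := leP s c; first by constructor.
by have [?|sd] := leP s d; [constructor | exfalso; lra].
Qed.

(** [Q] is the number of vectors [b] in the enlarged box, at most $(3C_0)^kB^k$. One factor [d]
    absorbs this excess and the 4 from real and imaginary parts, turning density [d] into
    [d ^+ 2]. *)
Lemma main_term_le (R : realDomainType) (d P Q Bk A n N h : R) :
  0 <= d -> d * (4 * P) <= 1 -> 0 <= A -> 0 <= n -> n <= N -> 0 <= h ->
  Q <= P * Bk -> 0 <= Bk ->
  4 * (d ^+ 2 * (Q * A * n * h)) <= A * (d * Bk * (N * h)).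
Proof.
move=> d0 dP A0 n0 nN h0 QP Bk0.
have -> : 4 * (d ^+ 2 * (Q * A * n * h)) = d * A * h * (4 * d * Q * n) by ring.
have -> : A * (d * Bk * (N * h)) = d * A * h * (Bk * N) by ring.
apply: ler_wpM2l; first by rewrite !mulr_ge0.
have le1 : 4 * d * Q <= Bk.
  apply: le_trans (_ : 4 * d * (P * Bk) <= _); first by rewrite ler_wpM2l ?mulr_ge0.
  have -> : 4 * d * (P * Bk) = d * (4 * P) * Bk by ring.
  by rewrite ler_piMl.
by apply: le_trans (ler_wpM2r n0 le1) _; rewrite ler_wpM2l.
Qed.

(** The representative [X] of [x] is taken in $(n-W,n]$, so that all the points [X + g t] stay above
    $n-W$ and at most $2n<W$, the range where [embed_intr] is exact. *)
Lemma embed_progression_U1plus (R : realType) (N : R) (W : nat) (f : int -> R[i])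
    (x : 'Z_W) (g T : nat) :
  1 <= N -> (1 < W)%N -> (2 * nfloor N < W)%N -> (forall y, ~ bracket N y -> f y = 0) ->
  (0 < g)%N -> (g * T <= nfloor N)%N ->
  modulus (\sum_(t < T) embed f (x + 1 *~ (g%:Z * (t : nat)%:Z))) <=
    (nfloor N)%:R * U1plus N f.
Proof.
move=> N1 W1; set n := nfloor N => W_n f_out g0 gT.
pose X : int := if lift x <= n%:Z then lift x else lift x - W%:Z.
have XE : X%:~R = x.
  rewrite /X; case: ifP => _; first exact: liftK.
  by rewrite intrB liftK // -[W%:~R]pmulrn natrW_eq0 // subr0.
have X1 : n%:Z - W%:Z < X.
  rewrite /X; case: ifP => [_|/negbT]; last by rewrite -ltNge; lia.
  by apply: lt_le_trans (lift_ge0 x); move: W_n; lia.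
have X2 : X <= n%:Z.
  by rewrite /X; case: ifP => // _; have := lift_lt W1 x; lia.
rewrite (eq_bigr (fun t : 'I_T => f (X + g%:Z * (t : nat)%:Z))).
  exact: progression_U1plus.
move=> t _; rewrite -[in LHS]XE -intrD.
have gt_n : (g * t <= n)%N by apply: leq_trans gT; rewrite leq_mul2l ltnW ?orbT.
apply: (embed_intr (n := n) W1) => [y yn||]; first by apply: f_out => /(bracketE N1).
  by rewrite -PoszM; move: (X) X1 gt_n => Y; lia.
by rewrite -PoszM; move: (X) X2 W_n gt_n => Y; lia.
Qed.

(** * Assembling the estimates in terms of [N], [B] and [delta] *)

Section LowerBound.

Variables (R : realType) (N delta eta C0 K L : R) (k H : nat) (i : 'I_k).
Variables (nu : int -> R) (lambda : {ffun 'I_k -> int} -> R[i]) (f : 'I_k -> int -> R[i]).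
Local Notation B := (N / H%:R).
Local Notation M := (Rsup N nu).
Local Notation n := (nfloor N).
Local Notation re := (@complex.Re R).
Local Notation im := (@complex.Im R).

Lemma U1plus_lower_bound :
  (1 < k)%N -> 1 <= C0 -> 1 <= N -> 0 < delta -> delta <= 200^-1 -> (0 < H)%N ->
  delta * k%:R ^+ 2 <= 1 -> delta * (4 * (3 * C0) ^+ k) <= 1 ->
  200 * C0 + 2 * k%:R + 8 <= K -> 2 <= L ->
  1 <= B -> 1 <= delta ^+ 45 * H%:R -> M ^+ (2 * k) <= delta ^+ 141 * B ->
  0 < eta -> eta <= delta ^+ 182 ->
  (forall y, 0 <= nu y) -> (forall y, ~ bracket N y -> nu y = 0) ->
  linear_forms_condition K L eta N B H nu ->
  (forall b, modulus (lambda b) <= 1) ->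
  (forall b, lambda b <> 0 -> forall j, `|b j|%:~R <= C0 * B) ->
  (forall j y, ~ bracket N y -> f j y = 0) ->
  (forall j y, modulus (f j y) <= nu y) ->
  delta * B ^+ k * (N * H%:R) <= modulus (counting_op H lambda f) ->
  delta ^+ 272 <= U1plus N (f i).
Proof.
move=> k1 C01 N1 d0 d200 H0 dk dC KC L2 B1 dH MB eta0 eta_d nu_ge0 nu_out lfc lam1 lamB f_out f_nu big.
have Hr : 0 < H%:R :> R by rewrite ltr0n.
have NE : B * H%:R = N by rewrite mulfVK // gt_eqF.
pose c0 := Num.truncn (C0 * B).
have CB1 : 1 <= C0 * B by rewrite mulr_ege1.
have /andP[c0_le c0_gt] := truncn_itv (le_trans ler01 CB1).
have {}c0_gt : C0 * B < c0%:R + 1 by rewrite natr1.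
pose A0 := (2 * c0).+1.
have A0E : A0%:R = 2 * c0%:R + 1 :> R by rewrite /A0 -natr1 natrM.
have A0_le : A0%:R <= 3 * (C0 * B) by rewrite A0E; lra.
have B_C : B <= C0 * B by rewrite ler_peMl // (le_trans ler01).
have B_A0 : B <= A0%:R by rewrite A0E; have : 0 <= c0%:R :> R by []; lra.
(* [K'] covers the [2 k] points of [excess_product_le] and the eight forms of [box_bound]; the 9 in
   [am] is that of [slice_le]. *)
pose cm := (2 * A0)%N; pose am := (9 * (A0 * H))%N; pose K' := (2 * k + 8)%N.
(* The three summands rule out wrap-around for progressions, linear forms and the counting operator
   respectively. *)
pose W := (2 * n + 2 * (am + 4 * (cm * H)) + 2 * (c0 * H)).+2.
have W1 : (1 < W)%N by [].
have [W_lf W_count W_n] := window_large n (am + 4 * (cm * H)) (c0 * H).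
have [A0_cm A0_am am_nat] := box_sizes (erefl A0) H0.
have N_CN : N <= C0 * N by rewrite ler_peMl // (le_trans ler01).
have A0H : A0%:R * H%:R <= 3 * (C0 * N).
  have -> : 3 * (C0 * N) = 3 * (C0 * B) * H%:R by rewrite -[in LHS]NE !mulrA.
  by rewrite ler_pM2r.
have k0 : 0 <= k%:R :> R by [].
have am_small : (2 * (am + 4 * cm))%:R <= K * N.
  apply: le_trans (_ : (34 * (A0 * H))%:R <= _); first by rewrite ler_nat.
  rewrite !natrM; apply: le_trans (_ : 200 * C0 * N <= _); first by lra.
  by rewrite ler_wpM2r ?(le_trans ler01) //; lra.
have cm_small : (2 * cm)%:R <= K * B.
  rewrite /cm !natrM; apply: le_trans (_ : 200 * C0 * B <= _); first by lra.
  by rewrite ler_wpM2r ?(le_trans ler01) //; lra.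
have K'K : K'%:R <= K by rewrite /K' natrD natrM; lra.
have eta1 : eta <= 1.
  by apply: le_trans eta_d _; rewrite exprn_ile1 ?ltW //; lra.
have pr := pseudorandom_embed N1 H0 nu_ge0 nu_out W1 W_lf lfc _ K'K _ L2 am_small cm_small
  (ltW eta0) eta1.
have {}pr := pr ltac:(lra) ltac:(by rewrite /K' addnC).
have nu_M (x : 'Z_W) : embed nu x <= M.
  rewrite /embed; have [Nx|Nx] := pselect (bracket N (lift x)).
    by apply: le_trans (ler_norm _) _; exact: Rsup_ub.
  by rewrite nu_out // /Rsup le_max ler01.
have M1 : 1 <= M by rewrite /Rsup le_max lexx.
pose tau := n%:R * U1plus N (f i).
have n0 : 0 < n%:R :> R by rewrite ltr0n nfloor_gt0.
have nN : n%:R <= N by exact: nfloor_le.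
have mE : mass (embed \1_(bracket N) : 'Z_W -> R) = n%:R by exact: mass_embed W_lf.
have prog (v : R[i] -> R) : {morph v : x y / x + y} -> v 0 = 0 ->
    (forall z, `|v z| <= modulus z) ->
    forall (x : 'Z_W) (g T : nat), (0 < g)%N -> (g * T)%:R <= B * H%:R ->
     `|\sum_(t < T) v (embed (f i) (x + 1 *~ (g%:Z * (t : nat)%:Z)))| <= tau.
  move=> vD v0 v_le x g T g0; rewrite NE => gTN.
  have gT : (g * T <= n)%N.
    by rewrite -ltnS -(ltr_nat R) (le_lt_trans gTN) // -natr1; have := nfloor_lt N1.
  rewrite -(big_morph v vD v0); apply: le_trans (v_le _) _.
  exact: (embed_progression_U1plus x N1 W1 W_n (f_out i) g0 gT).
pose fs (u v : R[i] -> R) : R := first_sum (1 : 'Z_W) H (embed nu) (v \o embed (f i)) c0 i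
   (fun b : {ffun 'I_k -> 'I_A0} => u (lambda (offsets b))).
have fs_tau (u v : R[i] -> R) : (forall z, `|u z| <= modulus z) ->
    {morph v : x y / x + y} -> v 0 = 0 -> (forall z, `|v z| <= modulus z) ->
    delta ^+ 2 * (#|{: {ffun 'I_k -> 'I_A0}}|%:R * A0%:R * n%:R * H%:R) <= fs u v ->
    delta ^+ 272 * N <= tau.
  move=> u_le vD v0 v_le fs_ge; rewrite -NE.
  have p_nu (x : 'Z_W) : `|(v \o embed (f i)) x| <= embed nu x.
    by apply: le_trans (v_le _) _; exact: f_nu.
  have lam_le b : `|u (lambda (offsets (b : {ffun 'I_k -> 'I_A0})))| <= 1.
    exact: le_trans (u_le _) (lam1 _).
  have kK : (2 * k <= K')%N by rewrite /K' leq_addr.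
  have M_B : k%:R ^+ 2 * M ^+ (2 * k) <= delta ^+ 140 * B.
    apply: le_trans (ler_wpM2l _ MB) _; first by rewrite exprn_ge0.
    have -> : k%:R ^+ 2 * (delta ^+ 141 * B) = delta * k%:R ^+ 2 * (delta ^+ 140 * B).
      by rewrite (exprS delta 140); move: B (delta ^+ 140) => b e; ring.
    rewrite ler_piMl //; exact: mulr_ge0 (exprn_ge0 _ (ltW d0)) (le_trans ler01 B1).
  have lower := progression_lower_bound pr p_nu nu_M M1 d0 d200 eta_d (i := i) lam_le k1 kK
    A0_cm A0_am (leqnn _) B_A0 M_B dH.
  apply: lower; rewrite ?mE // => x g T; exact: prog.
have main : delta ^+ 272 * N <= tau.
  suff : 4 * (delta ^+ 2 * (#|{: {ffun 'I_k -> 'I_A0}}|%:R * A0%:R * n%:R * H%:R)) <=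
     fs re re + fs im im + fs re im + fs im re.
    have reD : {morph re : x y / x + y} by case=> ? ? [].
    have imD : {morph im : x y / x + y} by case=> ? ? [].
    by case/four_le; apply: fs_tau => //; (exact: Re_le_modulus || exact: Im_le_modulus).
  have lam_c0 b : lambda b <> 0 -> forall j, (absz (b j) <= c0)%N.
    move=> b0 j; rewrite -ltnS -(ltr_nat R) -natr1; apply: le_lt_trans c0_gt.
    by rewrite pmulrn abszE; exact: lamB.
  have le1 := counting_op_le N1 H0 W1 W_count lam_c0 f_out f_nu i.
  have le2 : A0%:R * (delta * B ^+ k * (N * H%:R)) <=
      fs re re + fs im im + fs re im + fs im re.
    apply: le_trans (ler_wpM2l _ big) _ => //; apply: le_trans le1 _.
    rewrite /fs /first_sum -!big_split /=; apply: ler_sum => b _.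
    rewrite -!big_split /=; apply: ler_sum => z _; rewrite -!mulrDr.
    apply: ler_wpM2l; last exact: modulus_sum_mul.
    by apply: prodr_ge0 => j _; exact: nu_ge0.
  apply: le_trans le2; apply: (@main_term_le _ _ ((3 * C0) ^+ k)) => //; last first.
  - by rewrite exprn_ge0 // (le_trans ler01).
  - rewrite card_ffun !card_ord natrX -exprMn; apply: lerXn2r; rewrite ?nnegrE //.
      by rewrite !mulr_ge0 // (le_trans ler01).
    by rewrite -mulrA.
  - exact: ltW.
have n_le : n%:R * delta ^+ 272 <= n%:R * U1plus N (f i).
  by apply: le_trans main; rewrite mulrC ler_wpM2l // exprn_ge0 // ltW.
by move: n_le; rewrite ler_pM2l.
Qed.

End LowerBound.

Lemma small_constant (R : realFieldType) (a b : R) : 0 <= a -> 0 <= b ->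
  exists2 c : R, 0 < c <= 1 & forall d, 0 < d < c ->
    [/\ d <= 200^-1, d * a <= 1 & d * b <= 1].
Proof.
move=> a0 b0; have s0 : 0 < 200 + a + b.
  by rewrite -addrA ltr_pwDl ?ltr0n // addr_ge0.
exists (200 + a + b)^-1 => [|d /andP[d0 dc]].
  rewrite invr_gt0 s0 invf_le1 // -addrA; apply: (@le_trans _ _ 200); first by rewrite ler1n.
  by rewrite lerDl addr_ge0.
have dP y : y <= 200 + a + b -> d * y <= 1.
  move=> yc; apply: le_trans (ler_wpM2l (ltW d0) yc) _.
  by apply: le_trans (ler_wpM2r (ltW s0) (ltW dc)) _; rewrite mulVf // gt_eqF.
split; last 2 first.
- by apply: dP; rewrite addrAC lerDr addr_ge0 ?ler0n.
- by apply: dP; rewrite lerDr addr_ge0 ?ler0n.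
rewrite -[leRHS]mul1r ler_pdivlMr ?ltr0n //; apply: dP.
by rewrite -addrA lerDl addr_ge0.
Qed.

Local Open Scope classical_set_scope.
Local Open Scope ring_scope.

Theorem theorem6p7 (R : realType) (k : nat) (hk : (3 <= k)%N) :
  exists2 C : R, 0 < C &
  forall C0 : R, 1 <= C0 ->
  exists K c : R, 2 <= K /\ 0 < c /\
  forall (N delta : R) (H : nat) (eta : R) (nu : int -> R)
         (lambda : {ffun 'I_k -> int} -> R[i]) (f : 'I_k -> int -> R[i]),
    let B := N / H%:R in
    let L := delta `^ (- C) in
    1 <= N -> 0 < delta < c -> (0 < H)%N ->
    delta `^ (- C) <= B -> B <= N * delta `^ C ->
    0 < eta -> eta <= delta `^ C ->
    (forall n, 0 <= nu n) -> (forall n, ~ bracket N n -> nu n = 0) ->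
    linear_forms_condition K L eta N B H nu ->
    Rsup N nu `^ C / B <= delta `^ C ->
    (forall b, modulus (lambda b) <= 1) ->
    (forall b, lambda b <> 0 -> forall i, `|b i|%:~R <= C0 * B) ->
    (forall i n, ~ bracket N n -> f i n = 0) ->
    (forall i n, modulus (f i n) <= nu n) ->
    delta * B ^+ k * (N ^+ 2 / B) <= modulus (counting_op H lambda f) ->
    forall i, c * delta `^ C <= U1plus N (f i).
Proof.
(* The losses add up to less than the power 1000 of delta; the factor k turns
   the hypothesis on R_nu into a bound for its 2k-th power. *)
have [E E1000 kE] : exists2 E : nat, (1000 <= E)%N & (2 * k <= E)%N.
  by exists (1000 * k)%N; rewrite ?leq_pmulr ?leq_mul2r ?orbT // (leq_trans _ hk).
exists E%:R => [|C0 C01]; first by rewrite ltr0n (leq_trans _ E1000).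
have P0 : 0 <= 3 * C0 by rewrite mulr_ge0 // (le_trans ler01).
have k0 : 0 <= k%:R :> R by [].
have k2 : 0 <= k%:R ^+ 2 :> R by rewrite exprn_ge0.
have C0k : 0 <= 4 * (3 * C0) ^+ k by rewrite mulr_ge0 // exprn_ge0.
have [c /andP[c0 c1] c_small] := small_constant k2 C0k.
exists (200 * C0 + 2 * k%:R + 8), c; split; first by lra.
split=> // N delta H eta nu lambda f B L N1 /[dup] /c_small[d200 dk dC] /andP[d0 _] H0 LB BN
  eta0 eta_d nu_ge0 nu_out lfc M_B lam1 lamB f_out f_nu big i.
have Hr : 0 < H%:R :> R by rewrite ltr0n.
have d1 : delta <= 1 by lra.
have dE : delta `^ E%:R = delta ^+ E by rewrite powR_mulrn // ltW.
have LE : L = (delta ^+ E)^-1 by rewrite /L powRN dE.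
have dE_le j : (j <= 1000)%N -> delta ^+ E <= delta ^+ j.
  by move=> j1; apply: ler_wiXn2l; rewrite ?(leq_trans j1) // ltW.
have D0 : 0 < delta ^+ E by rewrite exprn_gt0.
have L2 : 2 <= L.
  have le1 : delta ^+ E <= delta by have := dE_le 1%N isT; rewrite expr1.
  by rewrite LE -(ler_pM2r D0) mulVf ?gt_eqF //; lra.
have B1 : 1 <= B by apply: le_trans LB; rewrite -/L; lra.
(* As [B = N / H], the assumption [B <= N * delta ^+ E] says that [H] is at least the inverse of
   [delta ^+ E]. *)
have dH : 1 <= delta ^+ 45 * H%:R.
  apply: le_trans (_ : delta ^+ E * H%:R <= _); last first.
    by apply: ler_wpM2r => //; exact: dE_le.
  move: BN; rewrite dE /B ler_pdivrMr // -[leLHS]mulr1 -mulrA ler_pM2l //.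
  exact: lt_le_trans N1.
have M1 : 1 <= Rsup N nu by rewrite /Rsup le_max lexx.
have MB : Rsup N nu ^+ (2 * k) <= delta ^+ 141 * B.
  apply: le_trans (_ : delta ^+ E * B <= _); last first.
    by apply: ler_wpM2r; [exact: le_trans B1 | exact: dE_le].
  move: M_B; rewrite dE powR_mulrn ?(le_trans ler01) // ler_pdivrMr ?(lt_le_trans ltr01) //.
  by apply: le_trans; rewrite ler_weXn2l.
have big' : delta * B ^+ k * (N * H%:R) <= modulus (counting_op H lambda f).
  apply: le_trans big; rewrite /B invf_div expr2 -!mulrA.
  by rewrite (mulrC N (H%:R / N)) divfK // gt_eqF // (lt_le_trans ltr01).
have eta_d' : eta <= delta ^+ 182.
  by apply: le_trans eta_d _; rewrite dE; exact: dE_le.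
have k1 : (1 < k)%N by exact: leq_trans hk.
have lower := @U1plus_lower_bound R N delta eta C0 _ L k H i nu lambda f k1 C01 N1 d0 d200 H0 dk dC (lexx _) L2 B1 dH MB eta0
  eta_d' nu_ge0 nu_out lfc lam1 lamB f_out f_nu big'.
apply: le_trans lower; rewrite dE; apply: le_trans (dE_le 272%N isT).
by apply: ler_piMl; first exact: ltW.
Qed.
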